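(* Let $(\mathbb{B},\mathbb{X})$ be as in the context and assume it satisfies (A1), (A2), (A3); let $\alpha$ be a simple root whose reflection $\sigma$ belongs to $W_0$, and assume (A5) for $\alpha$. For each $u\in J(X)$ fix $x_u\in X_u$ and let $\mathbb{P}_u$ be the stabilizer of $x_u$ in $\mathbb{P}$. Let $\gamma^\eta_{u\nu}(s)$ ($\nu\in J_u$) be the rational functions of $q^{s_1/e},\dots,q^{s_n/e}$ for which $$\widetilde\Omega_u(\mathcal{F}(\widetilde\phi);s)=\sum_{\nu\in J_u}\gamma^\eta_{u\nu}(s)\,\widetilde\Omega_\nu(\widetilde\phi;\sigma(s)+\varepsilon_\sigma)\qquad(\widetilde\phi\in\mathcal{S}(\widetilde X)).$$ Then the prehomogeneous vector space $(\mathbb{P}_u\times R_{k'/k}(GL_1),\mathbb{V})$ has the following functional equation: for every $\phi\in\mathcal{S}(V)$, $$\int_V\mathcal{F}_V(\phi)(v)\,|\widetilde f(x_u,v)|_u^s\,dv=\sum_{\nu\in J_u}\gamma^\eta_{u\nu}(s)\int_V\phi(v)\,|\widetilde f(x_u,v)|_\nu^{\sigma(s)+\varepsilon_\sigma}\,dv,$$ the integrals being understood by analytic continuation in $s$.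
   Context: **Basic setting.** $k$ is a non-archimedean local field of characteristic $0$ with ring of integers $\mathcal{O}$, prime element $\pi$, residue field of cardinality $q$, $|\pi|=q^{-1}$, $|0|=0$. $\mathbb{G}$ is a connected reductive linear algebraic group over $k$, $\mathbb{X}$ an affine algebraic variety over $k$ which is $\mathbb{G}$-homogeneous (action over $k$). Ordinary letters denote $k$-rational points. $\mathbb{B}$ is a minimal parabolic $k$-subgroup of $\mathbb{G}$, $\mathbb{T}\subset\mathbb{B}$ a maximal $k$-split torus, $W$ the relative Weyl group. $K$ is a special, good, maximal compact open subgroup of $G$ with $G=KB=BK$. $\delta$ is the modulus character of $B$ ($d(pb^{-1})=\delta(b)\,dp$ for a left Haar measure $dp$). **Relative invariants.** For a connected linear algebraic $k$-group $\mathbb{H}'$ acting on an affine $k$-variety $\mathbb{Y}$, $\mathfrak{X}(\mathbb{H}')$ is the group of $k$-rational characters; a rational function $f$ on $\mathbb{Y}$ over $k$ is a relative $\mathbb{H}'$-invariant if $f(g\cdot y)=\psi(g)f(y)$ for some $\psi\in\mathfrak{X}(\mathbb{H}')$; $\mathfrak{X}_0(\mathbb{H}')$ is the group of characters so arising; a set of relative invariants is basic if the corresponding characters form a basis of $\mathfrak{X}_0(\mathbb{H}')$. Conditions for $(\mathbb{B},\mathbb{X})$: (A1) $\mathbb{X}$ has only finitely many $\mathbb{B}$-orbits. (A2) There is a basic set of relative $\mathbb{B}$-invariants consisting of regular functions on $\mathbb{X}$. (A3) For every $y\in\mathbb{X}$ not in the open orbit there is $\psi\in\mathfrak{X}_0(\mathbb{B})$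 whose restriction to the identity component of $\mathbb{B}_y$ is nontrivial. Let $f_1,\dots,f_n$ be a basic set of regular relative $\mathbb{B}$-invariants with characters $\psi_i$. $X^{op}=\mathbb{X}^{op}(k)=\bigsqcup_{u\in J(X)}X_u$ is the decomposition of the $k$-points of the open $\mathbb{B}$-orbit into open $B$-orbits. $|\psi|^s=\prod|\psi_i|^{s_i}$. **$W_0$, $\sigma(s)$, $\varepsilon_\sigma$.** $W$ acts on characters of $B$ (identified with characters of $Z_G(T)$) by $(\sigma\xi)(b)=\xi(n_\sigma^{-1}bn_\sigma)$, $n_\sigma\in N_G(T)$ representing $\sigma$. Fix $x_0\in X^{op}$ and let $H=G_{x_0}$; $W_0=\{\sigma\in W:\sigma(|\psi|^s)\equiv1,\ \sigma(\delta)=\delta\text{ on }B\cap H\}$ ($s$ a variable). For $\sigma\in W_0$, $\sigma(s)$ is defined by $|\psi|^{\sigma(s)}=\sigma(|\psi|^s)$ and $\varepsilon_\sigma\in\mathbb{Q}^n$ by $|\psi|^{2\varepsilon_\sigma}=\delta\sigma(\delta^{-1})$. **(A5)** for a simple root $\alpha$ with reflection $\sigma$: let $\mathbb{P}=\mathbb{P}_{\{\alpha\}}\supset\mathbb{B}$ be the standard parabolic subgroup attached to $\{\alpha\}$. There is a finite unramified extension $k'/k$ and a $k$-rational representation $\rho:\mathbb{P}\to R_{k'/k}(GL_2)$ ($R_{k'/k}$ = restriction of scalars) such that $\rho(\mathbb{P})=R_{k'/k}(GL_2)$ or $R_{k'/k}(SL_2)$; $\rho(\sigma)=\mathbf{j}=\begin{pmatrix}0&1\\-1&0\end{pmatrix}$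 (for a representative of $\sigma$); $\rho^{-1}(\mathbb{B}_2)\subset\mathbb{B}$, where $\mathbb{B}_2$ is the group of upper triangular matrices in $\rho(\mathbb{P})$; and $\rho(K\cap\mathbb{P})\supset R_{k'/k}(SL_2)(\mathcal{O})$. **The space $\widetilde{\mathbb{X}}$.** $J_u=\{\nu\in J(X):P\cdot X_\nu=P\cdot X_u\}$; $e=[\mathfrak{X}(\mathbb{B})\cap(\mathfrak{X}_0(\mathbb{B})\otimes_{\mathbb{Z}}\mathbb{Q}):\mathfrak{X}_0(\mathbb{B})]$. Let $\mathbb{V}=R_{k'/k}(M_{21})$ (so $V=k'^2$, column vectors), $\widetilde{\mathbb{X}}=\mathbb{X}\times\mathbb{V}$, $\widetilde{\mathbb{P}}=\mathbb{P}\times R_{k'/k}(GL_1)$ acting by $(p,t)\cdot(x,v)=(p\cdot x,\rho(p)vt^{-1})$; $\mathbb{P}_u\times R_{k'/k}(GL_1)$ acts on $\mathbb{V}$ by $(p,t)\cdot v=\rho(p)vt^{-1}$. Let $v_0=\binom10$; $\mathbb{B}$ is identified with the stabilizer of $v_0$ in $\widetilde{\mathbb{P}}$ via $b\mapsto(b,\rho(b)_1)$, $\rho(b)_1$ the upper left entry of $\rho(b)$. It is known that $X_u\mapsto\widetilde X_u:=\widetilde P\cdot(X_u\times\{v_0\})$ is a bijection between open $B$-orbits in $X$ and open $\widetilde P$-orbits in $\widetilde X$, and that there is a basic set $\{\widetilde f_i(x,v)\}_{1\le i\le n}$ of relative $\widetilde{\mathbb{P}}$-invariants, regular on $\widetilde{\mathbb{X}}$,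 with $\widetilde f_i(x,v_0)=f_i(x)$. Put $|\widetilde f(x,v)|_u^s=\prod_i|\widetilde f_i(x,v)|^{s_i}$ if $(x,v)\in\widetilde X_u$ and $0$ otherwise. **Integrals and Fourier transforms.** $\mathcal{S}(\cdot)$ denotes locally constant compactly supported functions; $dx$ is a $G$-invariant measure on $X$, $dv$ a Haar measure on $V$; $\widetilde\Omega_u(\widetilde\phi;s)=\int_{\widetilde X}\widetilde\phi(x,v)|\widetilde f(x,v)|_u^s\,dx\,dv$ for $\widetilde\phi\in\mathcal{S}(\widetilde X)$ (convergent for $\mathrm{Re}(s_i)\ge0$, continued to a rational function of the $q^{s_i}$). $\eta$ is a nontrivial additive character of $k'$, $\mathcal{F}(\widetilde\phi)(x,v)=\int_V\eta({}^tv\,\mathbf{j}\,w)\widetilde\phi(x,w)\,dw$ and $\mathcal{F}_V(\phi)(v)=\int_V\eta({}^tv\,\mathbf{j}\,w)\phi(w)\,dw$. It is a known theorem that the rational functions $\gamma^\eta_{u\nu}(s)$ in the claim exist whenever $(\mathbb{B},\mathbb{X})$ satisfies (A1), (A2), (A3), the reflection $\sigma$ of the simple root $\alpha$ belongs to $W_0$, and (A5) holds for $\alpha$. *)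

(* Defs.v *)
From HB Require Import structures.
From mathcomp Require Import all_boot all_order all_algebra.
From mathcomp Require Import all_classical all_reals all_analysis.
From mathcomp Require Import -(notations) complex.
From mathcomp Require Import -(notations) mpoly.

Set Implicit Arguments.
Unset Strict Implicit.
Unset Printing Implicit Defensive.

Import Order.TTheory GRing.Theory Num.Theory.
Import numFieldNormedType.Exports.

Local Open Scope classical_set_scope.
Local Open Scope ring_scope.

(* [lf_card] is the cardinality q of the residue field, and the absolute value
   is normalized by |pi| = q^-1 for a generator pi of the maximal ideal.      *)
Record localField (R : realType) := LocalField {
  lf_field : fieldType;
  lf_abs : lf_field -> R;
  lf_card : nat;
  lf_abs_ge0 : forall x, 0 <= lf_abs x;
  lf_abs0 : lf_abs 0 = 0;
  lf_abs_eq0 : forall x, lf_abs x = 0 -> x = 0;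
  lf_absM : forall x y, lf_abs (x * y) = lf_abs x * lf_abs y;
  lf_absD : forall x y, lf_abs (x + y) <= Num.max (lf_abs x) (lf_abs y);
  lf_prime : exists p, lf_abs p = (lf_card%:R)^-1 /\
    (forall x, lf_abs x < 1 -> lf_abs x <= lf_abs p);
  lf_residue : exists r : 'I_lf_card -> lf_field,
    (forall i, lf_abs (r i) <= 1) /\
    (forall x, lf_abs x <= 1 -> exists! i, lf_abs (x - r i) < 1);
  lf_complete : forall u : nat -> lf_field,
    (forall e, 0 < e -> exists N, forall i j, (N <= i)%N -> (N <= j)%N ->
       lf_abs (u i - u j) < e) ->
    exists l, forall e, 0 < e -> exists N, forall i, (N <= i)%N ->
       lf_abs (u i - l) < e;
  lf_char0 : [pchar lf_field] =i pred0
}.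

(* The carrier is a copy of [lf_field k], so that it can bear both the field
   structure and the metric topology of the absolute value.                   *)
Definition lf_sort (R : realType) (k : localField R) : Type := lf_field k.
Coercion lf_sort : localField >-> Sortclass.

Section LocalFieldTopology.
Context (R : realType) (k : localField R).

HB.instance Definition _ := GRing.Field.on (lf_sort k).
HB.instance Definition _ := isPointed.Build (lf_sort k) 0.

Definition absv (x : k) : R := lf_abs (x : lf_field k).
Definition lf_dist (x y : k) : R := absv (x - y).

Lemma absvN (x : k) : absv (- x) = absv x.
Proof.
have a1 : absv (1 : k) = 1.
  have n0 : absv (1 : k) != 0.
    by apply/eqP => /(@lf_abs_eq0 _ k) /eqP; rewrite oner_eq0.
  apply: (mulfI n0); rewrite mulr1 -[RHS]/(lf_abs (1 : lf_field k)).
  by rewrite -[in RHS](mulr1 (1 : lf_field k)) lf_absM.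
have aN1 : absv (- 1 : k) = 1.
  apply/eqP; rewrite -(@pexpr_eq1 _ _ 2) ?lf_abs_ge0//.
  by rewrite expr2 -[_ * _](@lf_absM _ k) mulrNN mulr1; exact/eqP.
rewrite -mulN1r -[LHS]/(lf_abs ((- 1 : lf_field k) * x)) lf_absM.
by rewrite [lf_abs (- 1)]aN1 mul1r.
Qed.

Lemma lf_distxx x : lf_dist x x = 0.
Proof. by rewrite /lf_dist subrr; exact: lf_abs0. Qed.

Lemma lf_dist_eq0 x y : lf_dist x y = 0 -> x = y.
Proof. by move/(@lf_abs_eq0 _ k)/eqP; rewrite subr_eq0 => /eqP. Qed.

Lemma lf_distC x y : lf_dist x y = lf_dist y x.
Proof. by rewrite /lf_dist -absvN opprB. Qed.

Lemma lf_dist_triangle y x z : lf_dist x z <= lf_dist x y + lf_dist y z.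
Proof.
have -> : lf_dist x z = absv ((x - y) + (y - z)).
  by rewrite /lf_dist addrA subrK.
apply: (le_trans (@lf_absD _ k _ _)).
by rewrite ge_max lerDl lerDr !lf_abs_ge0.
Qed.

HB.instance Definition _ :=
  isMetric.Build R (lf_sort k) lf_distxx lf_dist_eq0 lf_distC lf_dist_triangle.
End LocalFieldTopology.

(* Affine varieties and linear algebraic groups over k, as sets of points
   over an algebraic closure kb of k (ib is the inclusion of k in kb).    *)

Section Varieties.
Context (k : fieldType) (kb : closedFieldType) (ib : {rmorphism k -> kb}).

Definition kval n (p : mpoly n k) (x : 'rV[kb]_n) : kb :=
  mpoly.mmap ib (x 0) p.
Definition bval n (p : mpoly n kb) (x : 'rV[kb]_n) : kb :=
  mpoly.meval (x 0) p.

(* In what follows, c : T -> 'rV_n gives affine coordinates on the points T. *)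
Definition regular_on T n (c : T -> 'rV[kb]_n) (D : set T) (F : T -> kb) :=
  exists p : mpoly n k, forall x, D x -> F x = kval p (c x).

Definition zclosed T n (c : T -> 'rV[kb]_n) (D A : set T) :=
  exists I : set (mpoly n kb),
    A = D `&` [set x | forall p, I p -> bval p (c x) = 0].

Definition kclosed T n (c : T -> 'rV[kb]_n) (D A : set T) :=
  exists I : set (mpoly n k),
    A = D `&` [set x | forall p, I p -> kval p (c x) = 0].

Definition zconnected T n (c : T -> 'rV[kb]_n) (A : set T) :=
  forall A1 A2, zclosed c A A1 -> zclosed c A A2 ->
    A1 `|` A2 = A -> A1 `&` A2 = set0 -> A1 = set0 \/ A2 = set0.

Definition zcomponent T n (c : T -> 'rV[kb]_n) (A : set T) (x : T) : set T :=
  [set y | exists C, [/\ C `<=` A, zconnected c C, C x & C y]].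

Definition paircrd T1 T2 n1 n2 (c1 : T1 -> 'rV[kb]_n1) (c2 : T2 -> 'rV[kb]_n2)
  (x : T1 * T2) : 'rV[kb]_(n1 + n2) := row_mx (c1 x.1) (c2 x.2).

Record kaction := KAction {
  ka_grp : Type;
  ka_gdim : nat;
  ka_gcrd : ka_grp -> 'rV[kb]_ka_gdim;
  ka_gset : set ka_grp;
  ka_mul : ka_grp -> ka_grp -> ka_grp;
  ka_spc : Type;
  ka_sdim : nat;
  ka_scrd : ka_spc -> 'rV[kb]_ka_sdim;
  ka_sset : set ka_spc;
  ka_act : ka_grp -> ka_spc -> ka_spc
}.

Definition kcharacter T n (c : T -> 'rV[kb]_n) (H : set T) (mul : T -> T -> T)
    (chi : T -> kb) :=
  [/\ regular_on c H chi, (forall g, H g -> chi g != 0) &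
      forall g h, H g -> H h -> chi (mul g h) = chi g * chi h].

Section Action.
Variable A : kaction.
Let H := @ka_gset A.
Let Y := @ka_sset A.

Definition orbit_of (y : ka_spc A) : set (ka_spc A) :=
  [set z | exists g, H g /\ z = ka_act g y].

Definition achar (chi : ka_grp A -> kb) :=
  kcharacter (@ka_gcrd A) H (@ka_mul A) chi.

(* The rational function is f1 / f2; the varieties to which this is applied
   are irreducible, so that a function which does not vanish identically is
   not a zero divisor and the identity below can be stated with cleared
   denominators.                                                             *)
Definition relative_invariant (chi : ka_grp A -> kb) (f1 f2 : ka_spc A -> kb) :=
  [/\ regular_on (@ka_scrd A) Y f1, regular_on (@ka_scrd A) Y f2,
      exists2 y, Y y & f1 y != 0, exists2 y, Y y & f2 y != 0 &
      forall g y, H g -> Y y ->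
        f1 (ka_act g y) * f2 y = chi g * (f1 y * f2 (ka_act g y))].

Definition X0 (chi : ka_grp A -> kb) :=
  achar chi /\ exists f1 f2, relative_invariant chi f1 f2.

Definition is_basis_X0 n (psi : 'I_n -> ka_grp A -> kb) :=
  (forall i, X0 (psi i)) /\
  forall chi, X0 chi -> exists! a : {ffun 'I_n -> int},
    forall g, H g -> chi g = \prod_i (psi i g) ^ (a i).

(* Characters psi_i and invariants f_i are given by polynomials over k in the
   coordinates, so that they can be evaluated at k-rational points too.      *)
Definition basic_regular n (f : 'I_n -> mpoly (ka_sdim A) k)
    (psi : 'I_n -> mpoly (ka_gdim A) k) :=
  is_basis_X0 (fun i g => kval (psi i) (ka_gcrd g)) /\
  forall i, relative_invariant (fun g => kval (psi i) (ka_gcrd g))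
    (fun y => kval (f i) (ka_scrd y)) (fun _ => 1).

(* Characters in X(H) /\ (X_0(H) (x) Q). *)
Definition X0_saturation (chi : ka_grp A -> kb) :=
  achar chi /\ exists2 r, (0 < r)%N & X0 (fun g => chi g ^+ r).

Definition X0_index (e : nat) :=
  exists t : 'I_e -> ka_grp A -> kb,
    (forall i, X0_saturation (t i)) /\
    forall chi, X0_saturation chi -> exists! i, X0 (fun g => chi g / t i g).

Definition in_open_orbit (y : ka_spc A) :=
  Y y /\ zclosed (@ka_scrd A) Y (Y `\` orbit_of y).

Definition prehomogeneous :=
  exists2 y, Y y & forall p : mpoly (ka_sdim A) kb,
    (forall z, orbit_of y z -> bval p (ka_scrd z) = 0) ->
    forall z, Y z -> bval p (ka_scrd z) = 0.

Definition condA1 :=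
  exists r (t : 'I_r -> ka_spc A),
    (forall i, Y (t i)) /\ forall y, Y y -> exists i, orbit_of (t i) y.

Definition condA2 :=
  exists n (f : 'I_n -> mpoly (ka_sdim A) k) (psi : 'I_n -> mpoly (ka_gdim A) k),
    basic_regular f psi.

Definition condA3 (one : ka_grp A) :=
  forall y, Y y -> ~ in_open_orbit y ->
    exists2 chi, X0 chi &
      exists2 b, zcomponent (@ka_gcrd A)
                   (H `&` [set g | ka_act g y = y]) one b & chi b != 1.
End Action.

Definition GLcrd (L : fieldType) N (g : 'M[L]_N) : 'rV[L]_(N * N + 1) :=
  row_mx (mxvec g) (\row_(_ < 1) (\det g)^-1).

Section LinearGroups.
Context (N : nat).
Local Notation MN := 'M[kb]_N.
Local Notation crd := (@GLcrd kb N).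
Implicit Types G H S T U : set MN.

Definition GLN : set MN := [set g | g \in unitmx].

Definition matgroup (L : fieldType) (H : set 'M[L]_N) :=
  [/\ H `<=` [set g | g \in unitmx], H 1%:M,
      (forall g h, H g -> H h -> H (g *m h)) &
      (forall g, H g -> H (invmx g))].

Definition alg_group H := matgroup H /\ zclosed crd GLN H.
Definition k_group H := matgroup H /\ kclosed crd GLN H.

Definition unipotent H := forall u, H u -> (u - 1%:M) ^+ N = 0.

Definition solvable_group H := exists r (D : nat -> set MN),
  [/\ D 0 = H, D r = [set 1%:M], (forall i, matgroup (D i)),
      (forall i, D i.+1 `<=` D i) &
      forall i g h, D i g -> D i h -> D i.+1 (g *m h *m invmx g *m invmx h)].

Definition normalized_by U H :=
  forall h u, H h -> U u -> U (h *m u *m invmx h).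

Definition in_unipotent_radical H : set MN := [set u | exists U,
  [/\ alg_group U, U `<=` H, zconnected crd U & unipotent U] /\
  (normalized_by U H /\ U u)].

Definition connected_reductive G :=
  [/\ k_group G, zconnected crd G & in_unipotent_radical G = [set 1%:M]].

Definition borel_subgroup G S :=
  [/\ alg_group S, S `<=` G, zconnected crd S, solvable_group S &
      forall S', alg_group S' -> S' `<=` G -> zconnected crd S' ->
        solvable_group S' -> S `<=` S' -> S' `<=` S].

Definition parabolic G S :=
  [/\ alg_group S, S `<=` G & exists2 S', borel_subgroup G S' & S' `<=` S].

Definition min_parabolic_k G B :=
  [/\ k_group B, parabolic G B &
      forall S, k_group S -> parabolic G S -> S `<=` B -> B `<=` S].

(* A k-split torus is a group k-isomorphic to (GL_1)^r. *)
Definition k_split_torus T := k_group T /\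
  exists r (a : MN -> 'rV[kb]_r) (b : 'rV[kb]_r -> MN),
    let Gm := [set y : 'rV[kb]_r | forall i, y 0 i != 0] in
    let Gmcrd := fun y : 'rV[kb]_r => row_mx y (map_mx GRing.inv y) in
    [/\ (forall t, T t -> Gm (a t) /\ b (a t) = t),
        (forall y, Gm y -> T (b y) /\ a (b y) = y),
        (forall t t', T t -> T t' ->
           forall i, a (t *m t') 0 i = a t 0 i * a t' 0 i),
        (forall i, regular_on crd T (fun t => a t 0 i)) &
        (forall i j, regular_on Gmcrd Gm (fun y => b y i j))].

Definition max_k_split_torus G T :=
  [/\ k_split_torus T, T `<=` G &
      forall S, k_split_torus S -> S `<=` G -> T `<=` S -> S `<=` T].

Definition centralizer G S : set MN :=
  [set g | G g /\ forall s, S s -> g *m s = s *m g].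
Definition normalizer G S : set MN :=
  [set g | G g /\ forall s, S s <-> S (g *m s *m invmx g)].

Definition LieAlg G : set MN := [set A | forall p : mpoly (N * N) kb,
  (forall g, G g -> bval p (mxvec g) = 0) ->
  \sum_i bval (mpoly.mderiv i p) (mxvec 1%:M) * mxvec A 0 i = 0].

Definition is_root T H (alpha : MN -> kb) :=
  [/\ kcharacter crd T mulmx alpha, (exists2 t, T t & alpha t != 1) &
      exists2 A, LieAlg H A & A != 0 /\
        forall t, T t -> t *m A *m invmx t = alpha t *: A].

(* The positive roots are those of B, the simple ones are the positive roots
   that are not a sum of two positive roots (characters being written
   multiplicatively here).                                                   *)
Definition simple_root T B alpha :=
  is_root T B alpha /\
  ~ exists beta gamma, [/\ is_root T B beta, is_root T B gamma &
      forall t, T t -> alpha t = beta t * gamma t].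

Definition ker_comp T (alpha : MN -> kb) : set MN :=
  zcomponent crd (T `&` [set t | alpha t = 1]) 1%:M.

(* P = Z_G(S) . R_u(B), where S is the identity component of ker alpha *)
Definition standard_parabolic G B T alpha (P : set MN) :=
  [/\ k_group P, parabolic G P, B `<=` P &
      P = [set g | exists z u, [/\ centralizer G (ker_comp T alpha) z,
                                  in_unipotent_radical B u & g = z *m u]]].

Definition kpts (m n : nat) (H : set 'M[kb]_(m, n)) : set 'M[k]_(m, n) :=
  [set g | H (map_mx ib g)].

(* w represents the reflection of alpha in N_G(T) / Z_G(T): its class is the
   nontrivial one acting trivially on the identity component of ker alpha.   *)
Definition reflection_rep G T alpha (w : 'M[k]_N) :=
  [/\ kpts (normalizer G T) w, ~ kpts (centralizer G T) w &
      kpts (centralizer G (ker_comp T alpha)) w].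

End LinearGroups.
End Varieties.

Arguments basic_regular {k kb} ib A {n} f psi.
Arguments condA3 {k kb} ib A one.

Notation borel T := (g_sigma_algebraType (@open T)).

Section Analysis.
Context (R : realType).
Local Notation C := (complex.complex R).
Local Notation cRe := (@complex.Re R).
Local Notation cIm := (@complex.Im R).

(* a^s for a >= 0, with 0^s = 0 *)
Definition cpow (a : R) (s : C) : C :=
  if a == 0 then (0 : C) else
  complex.Complex (expR (cRe s * ln a) * cos (cIm s * ln a))
                  (expR (cRe s * ln a) * sin (cIm s * ln a)).

Section Integral.
Context d (T : measurableType d) (mu : {measure set T -> \bar R}).
Definition cintegrable (D : set T) (f : T -> C) :=
  mu.-integrable D (fun x => (cRe (f x))%:E) /\
  mu.-integrable D (fun x => (cIm (f x))%:E).
Definition cintegral (D : set T) (f : T -> C) : C :=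
  complex.Complex (Rintegral mu D (fun x => cRe (f x)))
                  (Rintegral mu D (fun x => cIm (f x))).
End Integral.

(* S(D) for a subspace D of T; values outside D are irrelevant. *)
Definition schwartz (T : topologicalType) (D : set T) (phi : T -> C) :=
  (forall x, D x -> \forall y \near nbhs x, D y -> phi y = phi x) /\
  exists2 Q, compact Q /\ Q `<=` D & forall x, D x -> ~ Q x -> phi x = 0.

(* A Borel measure on T, viewed as a measure on its subspace D, that is
   finite on compact sets and positive on nonempty open sets of D.           *)
Definition radon_on (T : ptopologicalType) (D : set T)
    (mu : {measure set (borel T) -> \bar R}) :=
  [/\ mu (~` D) = 0%E,
      (forall Q : set T, compact Q -> Q `<=` D -> (mu Q < +oo)%E) &
      (forall O : set T, open O -> D `&` O !=set0 -> (0 < mu (D `&` O))%E)].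

Record ratfun n := RatFun {
  rf_num : mpoly n C;
  rf_den : mpoly n C;
  rf_den_neq0 : rf_den != 0
}.

Definition qpt (q e : nat) n (s : 'rV[C]_n) (i : 'I_n) : C :=
  cpow q%:R (s 0 i / e%:R).

Section Continuation.
Variables (q e n : nat).

Definition rf_defined (f : ratfun n) (s : 'rV[C]_n) :=
  mpoly.meval (qpt q e s) (rf_den f) != 0.
Definition rf_value (f : ratfun n) (s : 'rV[C]_n) : C :=
  mpoly.meval (qpt q e s) (rf_num f) / mpoly.meval (qpt q e s) (rf_den f).
End Continuation.

Definition Re_nonneg n (s : 'rV[C]_n) := forall i, 0 <= cRe (s 0 i).

(* f, as a rational function of the q^{s_i}, continues I from Re(s_i) >= 0. *)
Definition continued_by q n (I : 'rV[C]_n -> C) (f : ratfun n) :=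
  forall s, Re_nonneg s ->
    mpoly.meval (qpt q 1 s) (rf_num f) =
    mpoly.meval (qpt q 1 s) (rf_den f) * I s.

(* z is the value at s of the analytic continuation of I *)
Definition continuation_value q n (I : 'rV[C]_n -> C) (s : 'rV[C]_n) (z : C) :=
  exists f : ratfun n,
    [/\ continued_by q I f, rf_defined q 1 f s & z = rf_value q 1 f s].

(* The integrals of F s converge for Re(s_i) >= 0 and continue to a rational
   function of the q^{s_i}.                                                  *)
Definition zeta_integral q n d (T : measurableType d)
    (mu : {measure set T -> \bar R}) (D : set T) (F : 'rV[C]_n -> T -> C) :=
  (forall s, Re_nonneg s -> cintegrable mu D (F s)) /\
  exists f : ratfun n, continued_by q (fun s => cintegral mu D (F s)) f.

(* I(s) = \sum_(j in Js) gamma_j(s) I'_j(Sg s + eps), as meromorphic functions;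
   gamma_j is a rational function of the q^{s_i/e}.                          *)
Definition functional_equation q e n (J : finType) (Js : set J)
    (gamma : J -> ratfun n) (Sg : 'rV[C]_n -> 'rV[C]_n) (eps : 'rV[C]_n)
    (I : 'rV[C]_n -> C) (I' : J -> 'rV[C]_n -> C) :=
  forall s z (z' : J -> C),
    continuation_value q I s z ->
    (forall j, Js j -> rf_defined q e (gamma j) s /\
       continuation_value q (I' j) (Sg s + eps) (z' j)) ->
    z = \sum_(j | `[< Js j >]) rf_value q e (gamma j) s * z' j.
End Analysis.

(* A finite unramified extension k'/k, with an integral basis (a basis of the
   ring of integers of k' over that of k); the last clause says that a prime
   element of k stays prime in k'.                                           *)
Record unramifiedExt (R : realType) (k k' : localField R) := UnramifiedExt {
  ue_inj : {rmorphism k -> k'};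
  ue_deg : nat;
  ue_basis : 'I_ue_deg -> k';
  ue_coord : k' -> 'rV[k]_ue_deg;
  ue_coordK : forall a, \sum_l ue_inj (ue_coord a 0 l) * ue_basis l = a;
  ue_basisK : forall c : 'rV[k]_ue_deg,
    ue_coord (\sum_l ue_inj (c 0 l) * ue_basis l) = c;
  ue_integral : forall a,
    absv a <= 1 <-> forall l, absv (ue_coord a 0 l) <= 1;
  ue_unramified : forall p : k, absv p = ((lf_card k)%:R)^-1 ->
    absv (ue_inj p) = ((lf_card k')%:R)^-1
}.

Arguments ue_basis {R k k'} u _.
Arguments ue_coord {R k k'} u _.
Arguments ue_inj {R k k'} u.

Section Setting.
Context (R : realType) (k : localField R) (kb : closedFieldType).
Context (ib : {rmorphism k -> kb}).
Local Notation C := (complex.complex R).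

Section RestrictionOfScalars.
Context (k' : localField R) (E : unramifiedExt k k').
Local Notation d := (ue_deg E).

(* The regular representation of k' over k. R_{k'/k}(M_{r,c}) is realized by
   r x c matrices with entries in the span of [reg k'], i.e. in k' (x) kb
   seen as a commutative subalgebra of 'M[kb]_d.                             *)
Definition reg (a : k') : 'M[k]_d :=
  \matrix_(i, j) ue_coord E (a * ue_basis E i) 0 j.

Definition in_res (z : 'M[kb]_d) := exists c : 'rV[kb]_d,
  z = \sum_l c 0 l *: map_mx ib (reg (ue_basis E l)).

Definition resM r c : set 'M['M[kb]_d]_(r, c) :=
  [set A | forall i j, in_res (A i j)].

Definition det2 (A : 'M['M[kb]_d]_2) : 'M[kb]_d :=
  A 0 0 *m A 1 1 - A 0 1 *m A 1 0.

Definition resGL2 : set 'M['M[kb]_d]_2 :=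
  @resM 2 2 `&` [set A | det2 A \in unitmx].
Definition resSL2 : set 'M['M[kb]_d]_2 :=
  @resM 2 2 `&` [set A | det2 A = 1%:M].
Definition resGL1 : set 'M[kb]_d := [set z | in_res z /\ z \in unitmx].

(* k-rational points of R_{k'/k}(M_{r,c}), i.e. matrices over k' *)
Definition emb r c (A : 'M[k']_(r, c)) : 'M['M[kb]_d]_(r, c) :=
  map_mx (fun a => map_mx ib (reg a)) A.

Definition Vcrd (L : fieldType) (v : 'cV['M[L]_d]_2) : 'rV[L]_(d * d + d * d) :=
  row_mx (mxvec (v 0 0)) (mxvec (v 1 0)).

Definition jmx (L : pzRingType) : 'M[L]_2 :=
  \matrix_(i, j) (if (i == 0) && (j == 1) then 1
                  else if (i == 1) && (j == 0) then -1 else 0).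
Definition v0 : 'cV[k']_2 := delta_mx 0 0.

Section Fourier.
Context (eta : k' -> C) (nu : {measure set (borel 'cV[k']_2) -> \bar R}).

Definition additive_character :=
  [/\ continuous (fun a => complex.Re (eta a)) /\
      continuous (fun a => complex.Im (eta a)),
      (forall a, `|eta a| = 1),
      (forall a b, eta (a + b) = eta a * eta b) & exists a, eta a != 1].

Definition haar_V := radon_on setT nu /\
  forall (v : 'cV[k']_2) (A : set 'cV[k']_2),
    measurable (A : set (borel 'cV[k']_2)) ->
    nu [set v + a | a in A] = nu A.

Definition kernelV (v w : 'cV[k']_2) : C := eta ((v^T *m jmx k' *m w) 0 0).

Definition fourierV (phi : 'cV[k']_2 -> C) (v : 'cV[k']_2) : C :=
  cintegral nu setT (fun w => kernelV v w * phi w).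

Definition fourierXV (T : Type) (phi : T * 'cV[k']_2 -> C)
    (xv : T * 'cV[k']_2) : C :=
  cintegral nu setT (fun w => kernelV xv.2 w * phi (xv.1, w)).
End Fourier.
End RestrictionOfScalars.
Arguments resM {k'} E r c _.
Arguments resGL2 {k'} E _.
Arguments resSL2 {k'} E _.
Arguments resGL1 {k'} E _.
Arguments emb {k'} E {r c} A.

Section Groups.
Context (N m : nat).
Context (G B T : set 'M[kb]_N) (X : set 'rV[kb]_m).
Context (act : 'M[kb]_N -> 'rV[kb]_m -> 'rV[kb]_m).
Context (K : set 'M[k]_N).
Local Notation kp H := (kpts ib H).

Definition ksat (H : set 'M[kb]_N) (S : set 'rV[k]_m) : set 'rV[k]_m :=
  [set y | exists b x, [/\ kp H b, S x &
     map_mx ib y = act (map_mx ib b) (map_mx ib x)]].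

Definition Xk : set 'rV[k]_m := kp X.

Definition homogeneous_affine_variety :=
  [/\ kclosed ib id setT X, X !=set0,
      (forall j, regular_on ib (paircrd (@GLcrd kb N) id) (G `*` X)
         (fun gx => act gx.1 gx.2 0 j)) &
      [/\ (forall g x, G g -> X x -> X (act g x)),
          (forall x, X x -> act 1%:M x = x),
          (forall g h x, G g -> G h -> X x -> act (g *m h) x = act g (act h x)) &
          (forall x y, X x -> X y -> exists2 g, G g & y = act g x)]].

(* "Special" is expressed through the group-theoretic properties of the
   stabilizer of a special vertex in the apartment of S: it represents all of
   the Weyl group of S, and the Cartan decomposition holds.                  *)
Definition special_subgroup := exists S : set 'M[kb]_N,
  [/\ max_k_split_torus ib G S,
      (forall w, kp (normalizer G S) w -> exists2 x, K x &
         kp (normalizer G S) x /\ kp (centralizer G S) (invmx w *m x)) &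
      (forall g, kp G g -> exists x z y,
         [/\ K x, kp (centralizer G S) z, K y & g = x *m z *m y])].

Definition good_maximal_compact :=
  [/\ [/\ matgroup K, K `<=` kp G, compact K &
          exists2 O, open O & K = kp G `&` O],
      (forall K', matgroup K' -> K' `<=` kp G -> compact K' ->
         K `<=` K' -> K' `<=` K),
      special_subgroup,
      (forall g, kp G g -> exists x b, [/\ K x, kp B b & g = x *m b]) &
      (forall g, kp G g -> exists b x, [/\ kp B b, K x & g = b *m x])].

Definition basic_setting :=
  [/\ connected_reductive ib G, homogeneous_affine_variety,
      min_parabolic_k ib G B,
      max_k_split_torus ib G T /\ T `<=` B & good_maximal_compact].

Definition BX : kaction kb :=
  @KAction kb 'M[kb]_N _ (@GLcrd kb N) B mulmx 'rV[kb]_m m id X act.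

Definition left_haar (muB : {measure set (borel 'M[k]_N) -> \bar R}) :=
  radon_on (kp B) muB /\
  forall b (A : set 'M[k]_N), kp B b -> A `<=` kp B ->
    measurable (A : set (borel 'M[k]_N)) ->
    muB [set b *m p | p in A] = muB A.

Definition modulus (muB : {measure set (borel 'M[k]_N) -> \bar R})
    (delta : 'M[k]_N -> R) :=
  forall b (A : set 'M[k]_N), kp B b -> A `<=` kp B ->
    measurable (A : set (borel 'M[k]_N)) ->
    muB [set p *m invmx b | p in A] = ((delta b)%:E * muB A)%E.

Definition G_invariant (muX : {measure set (borel 'rV[k]_m) -> \bar R}) :=
  radon_on Xk muX /\
  forall g (A : set 'rV[k]_m), kp G g -> A `<=` Xk ->
    measurable (A : set (borel 'rV[k]_m)) ->
    muX [set y | exists2 x, A x &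
           map_mx ib y = act (map_mx ib g) (map_mx ib x)] = muX A.

Definition Xop : set 'rV[k]_m := [set x | @in_open_orbit kb BX (map_mx ib x)].

Definition orbit_decomposition (J : finType) (Xu : J -> set 'rV[k]_m) :=
  [/\ (forall u, exists2 x, Xop x & Xu u = ksat B [set x]),
      (forall u, exists2 O, open O & Xu u = Xk `&` O) &
      (forall x, Xop x -> exists! u, Xu u x)].

(* For b = z u in B with z in Z_G(T) and u in the unipotent radical, b' is
   w^-1 z w; thus (sigma xi)(b) = xi(b') for a character xi of B.            *)
Definition weyl_twist (w b b' : 'M[k]_N) := exists z u,
  [/\ kp (centralizer G T) z, kp (in_unipotent_radical B) u,
      b = z *m u & b' = invmx w *m z *m w].

Section Characters.
Context (n : nat) (psi : 'I_n -> mpoly (N * N + 1) k).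
Context (delta : 'M[k]_N -> R) (w : 'M[k]_N).

Definition psi_pow (b : 'M[k]_N) (s : 'rV[C]_n) : C :=
  \prod_i cpow (absv (mpoly.meval (GLcrd b 0) (psi i))) (s 0 i).

Definition in_W0 (x0 : 'rV[k]_m) :=
  kp (normalizer G T) w /\
  forall b b', kp B b -> act (map_mx ib b) (map_mx ib x0) = map_mx ib x0 ->
    weyl_twist w b b' ->
    (forall s, psi_pow b' s = 1) /\ delta b' = delta b.

Definition is_sigma (Sg : {linear 'rV[C]_n -> 'rV[C]_n}) :=
  forall s b b', weyl_twist w b b' -> psi_pow b (Sg s) = psi_pow b' s.

Definition is_epsilon (eps : 'rV[rat]_n) :=
  forall b b', weyl_twist w b b' ->
    psi_pow b (map_mx ratr (2 *: eps)) =
    complex.Complex (delta b / delta b') 0.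
End Characters.

Section ExtendedSpace.
Context (P : set 'M[kb]_N) (k' : localField R) (E : unramifiedExt k k').
Local Notation d := (ue_deg E).
Context (rho : 'M[kb]_N -> 'M['M[kb]_d]_2).

Definition condA5 (w : 'M[k]_N) :=
  [/\ (forall i j a b, regular_on ib (@GLcrd kb N) P (fun p => rho p i j a b)),
      (forall p p', P p -> P p' -> rho (p *m p') = rho p *m rho p'),
      rho @` P = resGL2 E \/ rho @` P = resSL2 E,
      rho (map_mx ib w) = emb E (jmx k') &
      (forall p, P p -> rho p 1 0 = 0 -> B p) /\
      (forall A : 'M[k']_2, (forall i j, absv (A i j) <= 1) -> \det A = 1 ->
         exists2 x, K x & P (map_mx ib x) /\ rho (map_mx ib x) = emb E A)].

Definition actV (pt : 'M[kb]_N * 'M[kb]_d) (v : 'cV['M[kb]_d]_2) :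
    'cV['M[kb]_d]_2 :=
  map_mx (fun z => z *m invmx pt.2) (rho pt.1 *m v).

Definition actXV (pt : 'M[kb]_N * 'M[kb]_d)
    (xv : 'rV[kb]_m * 'cV['M[kb]_d]_2) : 'rV[kb]_m * 'cV['M[kb]_d]_2 :=
  (act pt.1 xv.1, actV pt xv.2).

Definition pairmul (g h : 'M[kb]_N * 'M[kb]_d) := (g.1 *m h.1, g.2 *m h.2).

Definition PXV : kaction kb :=
  @KAction kb ('M[kb]_N * 'M[kb]_d)%type _
    (paircrd (@GLcrd kb N) (@GLcrd kb d)) (P `*` resGL1 E) pairmul
    ('rV[kb]_m * 'cV['M[kb]_d]_2)%type _
    (paircrd id (@Vcrd k' E kb)) (X `*` resM E 2 1) actXV.

(* The action of P_u x R_{k'/k}(GL_1) on V, P_u being the stabilizer of xu. *)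
Definition PuV (xu : 'rV[k]_m) : kaction kb :=
  @KAction kb ('M[kb]_N * 'M[kb]_d)%type _
    (paircrd (@GLcrd kb N) (@GLcrd kb d))
    ((P `&` [set p | act p (map_mx ib xu) = map_mx ib xu]) `*` resGL1 E) pairmul
    'cV['M[kb]_d]_2 _ (@Vcrd k' E kb) (resM E 2 1) actV.

(* B is the stabilizer of v0 in P~, through b |-> (b, rho(b)_1). *)
Definition B_is_stabilizer := forall p t,
  [/\ P p, resGL1 E t & actV (p, t) (emb E (v0 k')) = emb E (v0 k')] <->
  B p /\ t = rho p 0 0.

Definition kPsat (S : set ('rV[k]_m * 'cV[k']_2)) : set ('rV[k]_m * 'cV[k']_2) :=
  [set yv | exists p (t : k') xw, [/\ kp P p, t != 0, S xw &
     (map_mx ib yv.1, emb E yv.2) =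
     actXV (map_mx ib p, map_mx ib (reg E t)) (map_mx ib xw.1, emb E xw.2)]].

Definition XVk : set ('rV[k]_m * 'cV[k']_2) := Xk `*` setT.

Section Orbits.
Context (J : finType) (Xu : J -> set 'rV[k]_m).

Definition XVu (u : J) : set ('rV[k]_m * 'cV[k']_2) :=
  kPsat (Xu u `*` [set v0 k']).

Definition open_in_XVk (S : set ('rV[k]_m * 'cV[k']_2)) :=
  exists2 O, open O & S = XVk `&` O.

(* X_u |-> X~_u is a bijection between the open B-orbits in X and the open
   P~-orbits in X~.                                                          *)
Definition orbit_bijection :=
  [/\ (forall u, open_in_XVk (XVu u) /\
         exists2 xv, XVk xv & XVu u = kPsat [set xv]),
      injective XVu &
      (forall xv, XVk xv -> open_in_XVk (kPsat [set xv]) ->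
         exists u, XVu u = kPsat [set xv])].

Definition Ju (u : J) : set J := [set j | ksat P (Xu j) = ksat P (Xu u)].

Context (n : nat) (tf : 'I_n -> mpoly (m + (d * d + d * d)) k).

Definition tf_pow (u : J) (s : 'rV[C]_n) (xv : 'rV[k]_m * 'cV[k']_2) : C :=
  if `[< XVu u xv >] then
    \prod_i cpow (absv (mpoly.meval
      (row_mx xv.1 (Vcrd (map_mx (reg E) xv.2)) 0) (tf i))) (s 0 i)
  else 0.

Definition tf_extends (f : 'I_n -> mpoly m k) :=
  forall i x, X x ->
    kval ib (tf i) (row_mx x (Vcrd (emb E (v0 k')))) = kval ib (f i) x.

Context (muX : {sigma_finite_measure set (borel 'rV[k]_m) -> \bar R}).
Context (nu : {sigma_finite_measure set (borel 'cV[k']_2) -> \bar R}).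

Definition Omega_measure : {measure set _ -> \bar R} := (muX \x nu)%E.

Definition Omega_integrand (phi : 'rV[k]_m * 'cV[k']_2 -> C) (u : J)
    (s : 'rV[C]_n) (xv : borel 'rV[k]_m * borel 'cV[k']_2) : C :=
  phi xv * tf_pow u s xv.

Definition Omega (phi : 'rV[k]_m * 'cV[k']_2 -> C) (u : J) (s : 'rV[C]_n) : C :=
  cintegral Omega_measure XVk (Omega_integrand phi u s).

Definition fiber_integrand (xu : 'rV[k]_m) (phi : 'cV[k']_2 -> C) (u : J)
    (s : 'rV[C]_n) (v : borel 'cV[k']_2) : C :=
  phi v * tf_pow u s (xu, v).

Definition fiber_zeta (xu : 'rV[k]_m) (phi : 'cV[k']_2 -> C) (u : J)
    (s : 'rV[C]_n) : C :=
  cintegral nu setT (fiber_integrand xu phi u s).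
End Orbits.
End ExtendedSpace.
End Groups.
End Setting.

Arguments XVk {R k kb} ib {m} X k'.

(* Main.v *)
(* Fix u and shrink to a ball D around x_u.  By the open mapping theorem for the
   transitive action of B on X_u (Baire), every point of X in D is b x_u with b in
   B close to 1.  For such b, rho(b) lies in GL_2 of the integers of k', close to 1:
   it preserves dv and fixes phi and its Fourier transform, and |psi~_i(b, 1)| = 1,
   so the relative invariance of the f~_i makes the fiber integral at b x_u equal to
   the one at x_u.  By Fubini, Omega_nu(1_D (x) phi; s) is vol(X /\ D) times the
   fiber integral at x_u, and F(1_D (x) phi) = 1_D (x) F_V(phi): the functional
   equation of Omega specializes to that of the fiber.

   For prehomogeneity, let h be a polynomial that is nonzero at x_u and vanishes
   outside B x_u.  If p in P has rho(p) = [1 0; c 1], then n |-> h(p^-n x_u) is a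
   linear recurrence with invertible matrix, so it is nonzero for infinitely many
   n, and then p^n B meets P_u and (1, n c) is in the orbit of v_0.  Infinitely
   many n are Zariski dense in the line through c. *)

Require Import Defs.
From HB Require Import structures.
From mathcomp Require Import all_boot all_order all_algebra.
From mathcomp Require Import all_classical all_reals all_analysis.
From mathcomp Require Import measurable_realfun.
From mathcomp Require Import -(notations) complex.
From mathcomp Require Import -(notations) mpoly.
From mathcomp Require Import ring lra.
From mathcomp Require mxtens.

Set Implicit Arguments.
Unset Strict Implicit.
Unset Printing Implicit Defensive.

Import Order.TTheory GRing.Theory Num.Theory.
Import numFieldNormedType.Exports.

Local Open Scope classical_set_scope.
Local Open Scope ring_scope.

(** * Non-archimedean absolute values *)

(** What is known concerns integrals over X~, and a single fiber is invisible to them: even the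
    convergence of the integral over the fiber at x_u has to be proved. Fubini yields it on almost
    every fiber over the ball, hence on at least one, and the translation by b carries it to x_u.
    Here b and b^-1 must both be close to 1, since orbit membership and integrality of rho are
    needed in both directions. One ball serves phi and its Fourier transform, so that the same
    positive volume multiplies both sides of the functional equation and cancels.

    The action and rho are given over kb, which carries no topology. Every continuity argument
    therefore rests on a descent: at rational points the action is given by polynomials over k, and
    rho(b) is a matrix over k' depending continuously on b.

    For prehomogeneity only the image of rho is at hand. A unipotent matrix in it has a lift p, but
    this p need not lie on a one-parameter subgroup; only its powers are controlled. Sequences
    indexed by n, together with characteristic 0, take the place of curves in the group. *)

Section LocalFieldTheory.
Context (R : realType) (k : localField R).
Implicit Types x y z : k.

Lemma absv_ge0 x : 0 <= absv x. Proof. exact: lf_abs_ge0. Qed.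

Lemma absv0 : absv (0 : k) = 0. Proof. exact: lf_abs0. Qed.

Lemma absv_eq0 x : (absv x == 0) = (x == 0).
Proof.
by apply/eqP/eqP => [/(@lf_abs_eq0 _ k)//|->]; rewrite absv0.
Qed.

Lemma absvM x y : absv (x * y) = absv x * absv y.
Proof. exact: (@lf_absM _ k). Qed.

Lemma absv1 : absv (1 : k) = 1.
Proof.
have n0 : absv (1 : k) != 0 by rewrite absv_eq0 oner_eq0.
by apply: (mulfI n0); rewrite -absvM !mulr1.
Qed.

Lemma absvV x : absv x^-1 = (absv x)^-1.
Proof.
have [->|x0] := eqVneq x 0; first by rewrite invr0 absv0 invr0.
have ax0 : absv x != 0 by rewrite absv_eq0.
by apply: (mulfI ax0); rewrite -absvM !divff// absv1.
Qed.

Lemma absvX x n : absv (x ^+ n) = absv x ^+ n.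
Proof. by elim: n => [|n IH]; rewrite ?expr0 ?absv1// !exprS absvM IH. Qed.

Lemma absvBC x y : absv (x - y) = absv (y - x).
Proof. by rewrite -absvN opprB. Qed.

Lemma absvD_max x y : absv (x + y) <= Num.max (absv x) (absv y).
Proof. exact: (@lf_absD _ k). Qed.

Lemma absvD_le x y c : absv x <= c -> absv y <= c -> absv (x + y) <= c.
Proof. by move=> xc yc; rewrite (le_trans (absvD_max _ _))// ge_max xc. Qed.

Lemma absvD_lt x y c : absv x < c -> absv y < c -> absv (x + y) < c.
Proof. by move=> xc yc; rewrite (le_lt_trans (absvD_max _ _))// gt_max xc. Qed.

Lemma absvB_lt x y c : absv x < c -> absv y < c -> absv (x - y) < c.
Proof. by move=> xc yc; rewrite absvD_lt// absvN. Qed.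

Lemma absvB_le x y c : absv x <= c -> absv y <= c -> absv (x - y) <= c.
Proof. by move=> xc yc; rewrite absvD_le// absvN. Qed.

Lemma absv_tri_lt y x z c : absv (x - y) < c -> absv (y - z) < c ->
  absv (x - z) < c.
Proof. by move=> xy yz; rewrite -(subrKA y) absvD_lt. Qed.

(** The two longest sides of an ultrametric triangle are equal. Hence the absolute value of a
    continuous function is locally constant away from its zeros. *)
Lemma absv_isosceles x y : absv (x - y) < absv y -> absv x = absv y.
Proof.
move=> xy; apply/eqP; rewrite eq_le; apply/andP; split.
  by rewrite -[x](subrK y) absvD_le// ltW.
rewrite leNgt; apply/negP => yx; have : absv y < absv y.
  by rewrite -[X in absv X < _](subKr x) absvB_lt.
by rewrite ltxx.
Qed.

Lemma absv_sum_le I (r : seq I) (P : pred I) (F : I -> k) c : 0 <= c ->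
  (forall i, P i -> absv (F i) <= c) -> absv (\sum_(i <- r | P i) F i) <= c.
Proof.
move=> c0 h; elim/big_ind : _ => //; first by rewrite absv0.
by move=> x y; exact: absvD_le.
Qed.

Lemma absv_sum_lt I (r : seq I) (P : pred I) (F : I -> k) c : 0 < c ->
  (forall i, P i -> absv (F i) < c) -> absv (\sum_(i <- r | P i) F i) < c.
Proof.
move=> c0 h; elim/big_ind : _ => //; first by rewrite absv0.
by move=> x y; exact: absvD_lt.
Qed.

Lemma absv_prod I (r : seq I) (P : pred I) (F : I -> k) :
  absv (\prod_(i <- r | P i) F i) = \prod_(i <- r | P i) absv (F i).
Proof. exact: (big_morph _ absvM absv1). Qed.

Lemma absv_det_le1 n (A : 'M[k]_n) :
  (forall i j, absv (A i j) <= 1) -> absv (\det A) <= 1.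
Proof.
move=> h; rewrite /determinant; apply: absv_sum_le => // s _.
rewrite absvM absv_prod; apply: mulr_ile1 => //.
- exact: absv_ge0.
- by rewrite prodr_ge0// => i _; exact: absv_ge0.
- by rewrite absvX absvN absv1 expr1n.
- by apply: prodr_ile1 => i _; rewrite absv_ge0 h.
Qed.

(** The inverse is the adjugate divided by a unit, and cofactors of an integral matrix are
    integral. *)
Lemma absv_invmx_le1 n (A : 'M[k]_n) : absv (\det A) = 1 ->
  (forall i j, absv (A i j) <= 1) -> forall i j, absv (invmx A i j) <= 1.
Proof.
move=> dA h i j; rewrite /invmx unitmxE unitfE -absv_eq0 dA oner_eq0 /=.
rewrite !mxE absvM absvV dA invr1 mul1r absvM absvX absvN absv1 expr1n mul1r.
by apply: absv_det_le1 => a b; rewrite !mxE.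
Qed.

Lemma absv_mulmx_lt a b c (A : 'M[k]_(a, b)) (B : 'M[k]_(b, c)) (e : R) :
  0 < e -> (forall i j, absv (A i j) <= 1) -> (forall i j, absv (B i j) < e) ->
  forall i j, absv ((A *m B) i j) < e.
Proof.
move=> e0 hA hB i j; rewrite mxE; apply: absv_sum_lt => // l _.
rewrite absvM (le_lt_trans _ (hB l j))// -[leRHS]mul1r.
by rewrite ler_wpM2r ?absv_ge0.
Qed.

(** With at most one residue class, 0 and 1 would share a representative, which forces |1| < 1. *)
Lemma lf_card_gt1 : (1 < lf_card k)%N.
Proof.
have [r [r1 rP]] := lf_residue k.
have [i [hi _]] := rP (0 : k) ltac:(by rewrite -/(absv (0 : k)) absv0 ler01).
have [j [hj _]] := rP (1 : k) ltac:(by rewrite -/(absv (1 : k)) absv1).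
rewrite ltnNge; apply/negP => le1.
have eij : i = j by apply/val_inj; case: (i) (j) => [[|a] ha] [[|b] hb] //=;
  have := leq_trans ha le1; have := leq_trans hb le1.
move: hj; rewrite -eij => hj.
have : absv ((1 : k) - 0) < 1.
  by apply: (@absv_tri_lt (r i)); rewrite // absvBC.
by rewrite subr0 absv1 ltxx.
Qed.
End LocalFieldTheory.

(** * Topology of matrices over a local field *)

Section LocalFieldTopology.
Context (R : realType) (k : localField R).
Implicit Types x y z : k.
Local Notation q := ((lf_card k)%:R : R).

Lemma lf_ballE x e y : ball x e y = (absv (x - y) < e) :> Prop.
Proof. by []. Qed.

Lemma lf_card_gt1R : 1 < q.
Proof. by rewrite ltr1n lf_card_gt1. Qed.

Lemma lf_card_gt0R : 0 < q.
Proof. exact: lt_trans ltr01 lf_card_gt1R. Qed.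

Lemma lf_uniformizer : exists p : k, absv p = q^-1 /\
  forall x, absv x < 1 -> absv x <= q^-1.
Proof. by have [p [p1 p2]] := lf_prime k; exists p; split=> // x /p2; rewrite p1. Qed.

Lemma lf_bound (C : R) : exists n, C <= q ^+ n.
Proof.
have [n Cn] : exists n : nat, C <= n%:R.
  by exists (Num.trunc C).+1; rewrite ltW// truncnS_gt.
exists n; apply: le_trans Cn _; rewrite -natrX ler_nat ltnW//.
by rewrite ltn_expl// lf_card_gt1.
Qed.

Lemma lf_small (e : R) : 0 < e -> exists n, q ^- n < e.
Proof.
move=> e0; have [n en] := lf_bound e^-1.
exists n.+1; rewrite invf_plt ?posrE ?exprn_gt0 ?lf_card_gt0R//.
by rewrite (le_lt_trans en)// ltr_eXn2l// lf_card_gt1R.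
Qed.

(** Digit expansion: subtract the representative of the residue class, divide by the uniformizer
    [p], and recurse. Each digit gains a factor [q^-1]. *)
Lemma lf_net1 n : exists s : seq k, forall x, absv x <= 1 ->
  exists2 c, c \in s & absv (x - c) <= q ^- n.
Proof.
have [p [p1 p2]] := lf_uniformizer; have [r [r1 rP]] := lf_residue k.
have p0 : p != 0.
  by rewrite -absv_eq0 p1 invr_eq0 gt_eqF// lf_card_gt0R.
elim: n => [|n [s IH]].
  by exists [:: 0] => x x1; exists 0; rewrite ?inE// subr0 expr0 invr1.
exists [seq (r i : k) + p * c | i <- enum 'I_(lf_card k), c <- s] => x x1.
have [i [/p2 xi _]] := rP x x1.
have [|c cs xc] := IH ((x - r i) / p).
  rewrite absvM absvV p1 invrK -ler_pdivlMr ?lf_card_gt0R// mul1r.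
  exact: xi.
exists (r i + p * c).
  by apply/allpairsP; exists (i, c); rewrite mem_enum.
have -> : x - (r i + p * c) = p * ((x - r i) / p - c).
  by rewrite mulrBr mulrCA divff// mulr1 opprD addrA.
by rewrite absvM p1 exprS invfM ler_wpM2l.
Qed.

Lemma lf_net (C e : R) : 0 < e -> exists s : seq k, forall x, absv x <= C ->
  exists2 c, c \in s & absv (x - c) < e.
Proof.
move=> e0; have [p [p1 _]] := lf_uniformizer; have [j Cj] := lf_bound C.
have p0 : p != 0.
  by rewrite -absv_eq0 p1 invr_eq0 gt_eqF// lf_card_gt0R.
have qj0 : 0 < q ^+ j by rewrite exprn_gt0// lf_card_gt0R.
have [n ne] := @lf_small (e / q ^+ j) (divr_gt0 e0 qj0).
have [s sP] := lf_net1 n.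
exists [seq c / p ^+ j | c <- s] => x xC.
have [|c cs xc] := sP (x * p ^+ j).
  rewrite absvM absvX p1 exprVn ler_pdivrMr ?mul1r//.
  exact: le_trans xC Cj.
exists (c / p ^+ j); first exact: map_f.
have -> : x - c / p ^+ j = (x * p ^+ j - c) / p ^+ j.
  by rewrite mulrBl mulfK// expf_neq0.
rewrite absvM absvV absvX p1 exprVn invrK -ltr_pdivlMr//.
exact: le_lt_trans xc ne.
Qed.

(** An ultrafilter contains one ball out of every finite net, so it is Cauchy, and the chosen
    centers converge by completeness. Compactness of bounded sets of matrices follows from this
    entry by entry. *)
Lemma ultra_lf_cvg T (F : set_system T) (g : T -> k) (C : R) : UltraFilter F ->
  F [set t | absv (g t) <= C] ->
  exists2 l, absv l <= C & forall e, 0 < e -> F [set t | absv (g t - l) < e].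
Proof.
move=> UF FC.
have ex e : 0 < e -> exists c, F [set t | absv (g t - c) < e].
  move=> e0; have [s sP] := @lf_net C e e0.
  have : F [set t | exists2 c, c \in s & absv (g t - c) < e].
    by apply: filterS FC => t; exact: sP.
  elim: s {sP} => [|c s IH] Fs.
    by have [t [c]] := filter_ex Fs; rewrite in_nil.
  have [|Fn] := in_ultra_setVsetC [set t | absv (g t - c) < e] UF.
    by exists c.
  apply: IH; apply: filterS2 Fs Fn => t [d]; rewrite inE => /orP[/eqP->//|].
  by exists d.
have /choice[c cP] n : exists c, F [set t | absv (g t - c) < q ^- n].
  by apply: ex; rewrite invr_gt0 exprn_gt0// lf_card_gt0R.
have decr i n : (n <= i)%N -> q ^- i <= q ^- n.
  move=> ni; rewrite lef_pV2 ?posrE ?exprn_gt0 ?lf_card_gt0R//.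
  by rewrite ler_weXn2l// ltW// lf_card_gt1R.
have cc n i j : (n <= i)%N -> (n <= j)%N -> absv (c i - c j) < q ^- n.
  move=> ni nj; have [t [ti tj]] := filter_ex (filterI (cP i) (cP j)).
  apply: (@absv_tri_lt _ _ (g t)).
    by rewrite absvBC (lt_le_trans ti)// decr.
  by rewrite (lt_le_trans tj)// decr.
have [l lP] : exists l : k, forall e, 0 < e ->
    exists N, forall i, (N <= i)%N -> absv (c i - l) < e.
  apply: (@lf_complete _ k) => e e0; have [n ne] := lf_small e0.
  by exists n => i j ni nj; exact: lt_trans (cc n i j ni nj) ne.
have Fl e : 0 < e -> F [set t | absv (g t - l) < e].
  move=> e0; have [n ne] := lf_small e0; have [N NP] := lP _ e0.
  apply: filterS (cP (maxn n N)) => t /= tc.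
  apply: (@absv_tri_lt _ _ (c (maxn n N))); last exact: (NP _ (leq_maxr _ _)).
  exact: lt_trans tc (le_lt_trans (decr _ _ (leq_maxl _ _)) ne).
(* If [|l| > C], the points closer to [l] than [|l|] have absolute value [|l|], against the bound
   [C]. *)
exists l => //; rewrite leNgt; apply/negP => Cl.
have [t0 t0C] := filter_ex FC.
have l0 : 0 < absv l by rewrite (le_lt_trans _ Cl)// (le_trans (absv_ge0 (g t0))).
have [t [tC /absv_isosceles tl]] := filter_ex (filterI FC (Fl _ l0)).
by move: tC Cl => /=; rewrite tl leNgt => /negbTE ->.
Qed.

Section Matrices.
Variables a b : nat.
Implicit Types A B : 'M[k]_(a, b).

Lemma mx_ballP A e B : 0 < e ->
  (ball A e B <-> forall i j, absv (A i j - B i j) < e).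
Proof. by move=> e0; split => [[]|h]. Qed.

Lemma mx_ball_gt0 A e B : ball A e B -> 0 < e.
Proof. by case. Qed.

Lemma mx_ball_ultra A B D e : ball A e B -> ball B e D -> ball A e D.
Proof.
by move=> [e0 h1] [_ h2]; split=> // i j; exact: absv_tri_lt (h1 i j) (h2 i j).
Qed.

Lemma mx_ball_eq A B e : ball A e B -> ball A e = ball B e.
Proof.
move=> AB; apply/seteqP; split => D; last exact: mx_ball_ultra.
by apply: mx_ball_ultra; exact: ball_sym.
Qed.

Lemma mx_ball_open A e : open (ball A e).
Proof.
rewrite openE => B AB; apply/nbhs_ballP; exists e; first exact: mx_ball_gt0 AB.
by move=> D; exact: mx_ball_ultra.
Qed.

Lemma mx_ball_closed A e : closed (ball A e).
Proof.
have [e0|e0] := ltP 0 e; last first.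
  suff -> : ball A e = set0 by exact: closed0.
  by apply/seteqP; split=> // B /mx_ball_gt0; rewrite ltNge e0.
rewrite -[ball A e]setCK; apply: open_closedC; rewrite openE => B AB.
apply/nbhs_ballP; exists e => // D BD AD; apply: AB.
by apply: mx_ball_ultra AD _; exact: ball_sym.
Qed.

Lemma mx_bounded_compact (C : R) :
  compact [set A : 'M[k]_(a, b) | forall i j, absv (A i j) <= C].
Proof.
rewrite compact_ultra => F UF FC.
have /choice[L LP] (ij : 'I_a * 'I_b) : exists l : k, absv l <= C /\
    forall e, 0 < e -> F [set A : 'M[k]_(a, b) | absv (A ij.1 ij.2 - l) < e].
  have [|l l1 l2] := @ultra_lf_cvg _ F (fun A => A ij.1 ij.2) C UF.
    by apply: filterS FC => A; apply.
  by exists l.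
exists (\matrix_(i, j) L (i, j)); split=> [i j|].
  by rewrite mxE; have [] := LP (i, j).
move=> U /nbhs_ballP[e e0 eU].
suff : F [set A : 'M[k]_(a, b) | forall ij : 'I_a * 'I_b,
    absv (A ij.1 ij.2 - L ij) < e].
  apply: filterS => A h; apply: eU; split=> // i j.
  by rewrite lf_ballE mxE absvBC; exact: (h (i, j)).
apply: filter_forall => ij; have [_] := LP ij; exact.
Qed.

Lemma absv_sum_ge0 A : 0 <= \sum_i \sum_j absv (A i j).
Proof. by do 2!apply: sumr_ge0 => ? _; exact: absv_ge0. Qed.

Lemma absv_entry_le A i j : absv (A i j) <= \sum_i \sum_j absv (A i j).
Proof.
rewrite (bigD1 i)//= (bigD1 j)//= -addrA lerDl addr_ge0 ?sumr_ge0// => *.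
  exact: absv_ge0.
by apply: sumr_ge0 => ? _; exact: absv_ge0.
Qed.

Lemma mx_ball_compact A e : compact (ball A e).
Proof.
have [e0|e0] := ltP 0 e; last first.
  suff -> : ball A e = set0 by exact: compact0.
  by apply/seteqP; split=> // B /mx_ball_gt0; rewrite ltNge e0.
pose C := \sum_i \sum_j absv (A i j) + e.
have cC := @mx_bounded_compact C.
apply: subclosed_compact cC _; first exact: mx_ball_closed.
move=> B [_ AB] i j; rewrite -[B i j](subKr (A i j)).
have AC : absv (A i j) <= C by rewrite ler_wpDr ?absv_entry_le// ltW.
have eC : e <= C.
  by rewrite lerDr absv_sum_ge0.
by apply: absvB_le => //; apply: le_trans eC; apply/ltW/AB.
Qed.

Lemma compact_mx_bounded (Q : set 'M[k]_(a, b)) : compact Q ->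
  exists C : R, forall A, Q A -> forall i j, absv (A i j) <= C.
Proof.
move=> /compact_near_coveringP cQ.
have := cQ R (+oo) (fun C A => forall i j, absv (A i j) <= C) _.
case=> [A QA|C [_ CP]]; last first.
  by exists (C + 1) => A QA; apply: CP => //; rewrite ltrDl.
pose C := \sum_i \sum_j absv (A i j) + 1.
have AC i j : absv (A i j) <= C by rewrite ler_wpDr// absv_entry_le.
exists (ball A 1, [set D | C < D]) => /=.
  split; first exact: nbhsx_ballx.
  by exists C; rewrite num_real.
move=> [B D] [/= [_ AB] CD] i j.
rewrite -[B i j](subKr (A i j)).
have h1 : 1 <= C.
  by rewrite lerDr absv_sum_ge0.
apply: absvB_le; first exact: le_trans (AC i j) (ltW CD).
by apply: le_trans (ltW (AB i j)) _; apply: le_trans h1 (ltW CD).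
Qed.

(** Each entry is indexed by a triple: a bound, a precision, and a position in the finite net for
    that bound and precision. *)
Lemma mx_dense : exists D : 'M[nat * nat * nat]_(a, b) -> 'M[k]_(a, b),
  forall A e, 0 < e -> exists I, ball A e (D I).
Proof.
have n0 n : 0 < n.+1%:R^-1 :> R by rewrite invr_gt0 ltr0n.
have /choice[s sP] (p : nat * nat) := @lf_net p.1%:R p.2.+1%:R^-1 (n0 p.2).
pose d (p : nat * nat * nat) : k := nth 0 (s p.1) p.2.
exists (map_mx d) => A e e0.
have : forall ij : 'I_a * 'I_b, exists p, absv (A ij.1 ij.2 - d p) < e.
  move=> [i j] /=.
  have ne : (Num.trunc e^-1).+1%:R^-1 < e.
    by rewrite invf_plt ?posrE// truncnS_gt.
  pose t := ((Num.trunc (absv (A i j))).+1, Num.trunc e^-1).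
  have [|c cs Ac] := sP t (A i j).
    by rewrite /= ltW// truncnS_gt.
  exists (t, index c (s t)).
  rewrite /d /= nth_index//; exact: lt_trans Ac ne.
move=> /choice[p pP]; exists (\matrix_(i, j) p (i, j)).
by split=> // i j; rewrite !mxE; exact: (pP (i, j)).
Qed.
End Matrices.
End LocalFieldTopology.

(** * Limits, Baire category and open orbits *)

Section Limits.
Context (R : realType) (k : localField R) (T : Type) (F : set_system T).
Context {FF : Filter F}.
Implicit Types (f g : T -> k) (l a b : k).

Lemma lf_cvgP f l :
  (f @ F --> l) <-> forall e, 0 < e -> \forall t \near F, absv (l - f t) < e.
Proof. exact: cvg_ballP. Qed.

Lemma lf_cvgD f g a b : f @ F --> a -> g @ F --> b ->
  (fun t => f t + g t) @ F --> a + b.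
Proof.
move=> /lf_cvgP fa /lf_cvgP gb; apply/lf_cvgP => e e0.
apply: filterS2 (fa _ e0) (gb _ e0) => t ft gt.
by rewrite opprD addrACA absvD_lt.
Qed.

Lemma lf_cvgM f g a b : f @ F --> a -> g @ F --> b ->
  (fun t => f t * g t) @ F --> a * b.
Proof.
move=> /lf_cvgP fa /lf_cvgP gb; apply/lf_cvgP => e e0.
pose c := 1 + absv a + absv b.
have c0 : 0 < c by rewrite !ltr_wpDr ?absv_ge0.
have ac : absv a < c by rewrite /c addrAC ltrDr ltr_wpDr// absv_ge0.
have bc : absv b < c by rewrite /c ltrDr ltr_wpDr// absv_ge0.
apply: filterS3 (fa _ c0) (fa _ (divr_gt0 e0 c0)) (gb _ (divr_gt0 e0 c0)).
move=> t fac fae gbe.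
have ftc : absv (f t) < c by rewrite -[f t](subKr a) absvB_lt.
have -> : a * b - f t * g t = (a - f t) * b + f t * (b - g t).
  by rewrite mulrBl mulrBr addrA subrK.
rewrite absvD_lt// absvM.
  rewrite mulrC -[e](mulfVK (lt0r_neq0 c0)) mulrC.
  by rewrite ltr_pM// absv_ge0.
by rewrite -[e](mulfVK (lt0r_neq0 c0)) mulrC ltr_pM// absv_ge0.
Qed.

Lemma lf_cvgV f a : a != 0 -> f @ F --> a -> (fun t => (f t)^-1) @ F --> a^-1.
Proof.
move=> a0 /lf_cvgP fa; apply/lf_cvgP => e e0.
have aa0 : 0 < absv a by rewrite lt_def absv_eq0 a0 absv_ge0.
(* Once [|f t| = |a|], the inverses differ by [|f t - a| / |a|^2], whence this radius. *)
have ea0 : 0 < e * (absv a * absv a) by rewrite !mulr_gt0.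
apply: filterS2 (fa _ aa0) (fa _ ea0) => t h1 h2.
have ft : absv (f t) = absv a by apply: absv_isosceles; rewrite absvBC.
have ft0 : f t != 0 by rewrite -absv_eq0 ft absv_eq0.
have -> : a^-1 - (f t)^-1 = (f t - a) / (a * f t).
  by rewrite mulrBl invfM mulrCA divff// mulr1 mulrA divff// mul1r.
by rewrite absvM absvV absvM ft absvBC ltr_pdivrMr// mulr_gt0.
Qed.

Lemma lf_cvg_sum I (r : seq I) (P : pred I) (f : I -> T -> k) (a : I -> k) :
  (forall i, P i -> f i @ F --> a i) ->
  (fun t => \sum_(i <- r | P i) f i t) @ F --> \sum_(i <- r | P i) a i.
Proof.
move=> fa; elim: r => [|i r IH].
  by under eq_fun do rewrite big_nil; rewrite big_nil; exact: cvg_cst.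
under eq_fun do rewrite big_cons; rewrite big_cons.
by case: ifP => // Pi; apply: lf_cvgD => //; exact: fa.
Qed.

Lemma lf_cvg_prod I (r : seq I) (P : pred I) (f : I -> T -> k) (a : I -> k) :
  (forall i, P i -> f i @ F --> a i) ->
  (fun t => \prod_(i <- r | P i) f i t) @ F --> \prod_(i <- r | P i) a i.
Proof.
move=> fa; elim: r => [|i r IH].
  by under eq_fun do rewrite big_nil; rewrite big_nil; exact: cvg_cst.
under eq_fun do rewrite big_cons; rewrite big_cons.
by case: ifP => // Pi; apply: lf_cvgM => //; exact: fa.
Qed.

Lemma lf_cvgX f a n : f @ F --> a -> (fun t => f t ^+ n) @ F --> a ^+ n.
Proof.
move=> fa; elim: n => [|n IH].
  by under eq_fun do rewrite expr0; rewrite expr0; exact: cvg_cst.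
by under eq_fun do rewrite exprS; rewrite exprS; exact: lf_cvgM.
Qed.

Lemma lf_cvg_meval n (f : T -> 'I_n -> k) (a : 'I_n -> k) (p : mpoly.mpoly n k) :
  (forall i, (fun t => f t i) @ F --> a i) ->
  (fun t => mpoly.meval (f t) p) @ F --> mpoly.meval a p.
Proof.
move=> fa; under eq_fun do rewrite mpoly.mevalE.
rewrite mpoly.mevalE; apply: lf_cvg_sum => m _.
apply: lf_cvgM; first exact: cvg_cst.
by apply: lf_cvg_prod => i _; exact: lf_cvgX.
Qed.

Lemma mx_cvgP (a b : nat) (f : T -> 'M[k]_(a, b)) (A : 'M[k]_(a, b)) :
  (forall i j, (fun t => f t i j) @ F --> A i j) -> f @ F --> A.
Proof.
move=> fA; apply/cvg_ballP => e e0.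
have : \forall t \near F, forall ij : 'I_a * 'I_b,
    absv (A ij.1 ij.2 - f t ij.1 ij.2) < e.
  by apply: filter_forall => ij; have /lf_cvgP := fA ij.1 ij.2; exact.
by apply: filterS => t h; split=> // i j; exact: (h (i, j)).
Qed.

Lemma lf_cvg_det n (f : T -> 'M[k]_n) (A : 'M[k]_n) :
  (forall i j, (fun t => f t i j) @ F --> A i j) ->
  (fun t => \det (f t)) @ F --> \det A.
Proof.
move=> fA; apply: lf_cvg_sum => s _; apply: lf_cvgM; first exact: cvg_cst.
by apply: lf_cvg_prod => i _.
Qed.

Lemma lf_cvg_mulmx (a b c : nat) (f : T -> 'M[k]_(a, b)) (A : 'M[k]_(a, b))
    (g : T -> 'M[k]_(b, c)) (B : 'M[k]_(b, c)) :
  (forall i j, (fun t => f t i j) @ F --> A i j) ->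
  (forall i j, (fun t => g t i j) @ F --> B i j) ->
  forall i j, (fun t => (f t *m g t) i j) @ F --> (A *m B) i j.
Proof.
move=> fA gB i j; under eq_fun do rewrite mxE; rewrite mxE.
by apply: lf_cvg_sum => l _; exact: lf_cvgM.
Qed.

Lemma lf_cvg_row_mx n1 n2 (f : T -> 'rV[k]_n1) (g : T -> 'rV[k]_n2)
    (u : 'rV[k]_n1) (v : 'rV[k]_n2) :
  (forall i, (fun t => f t 0 i) @ F --> u 0 i) ->
  (forall i, (fun t => g t 0 i) @ F --> v 0 i) ->
  forall i : 'I_(n1 + n2), (fun t => row_mx (f t) (g t) 0 i) @ F --> row_mx u v 0 i.
Proof.
move=> fu gv i; under eq_fun do rewrite mxE; rewrite mxE.
by case: (fintype.split i) => j; [exact: fu|exact: gv].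
Qed.

Lemma lf_cvg_GLcrd n (f : T -> 'M[k]_n) (A : 'M[k]_n) : \det A != 0 ->
  (forall i j, (fun t => f t i j) @ F --> A i j) ->
  forall i : 'I_(n * n + 1), (fun t => GLcrd (f t) 0 i) @ F --> GLcrd A 0 i.
Proof.
move=> dA fA; apply: lf_cvg_row_mx => i.
  by case/mxvec_indexP: i => a b; under eq_fun do rewrite mxvecE;
    rewrite mxvecE; exact: fA.
under eq_fun do rewrite mxE; rewrite mxE.
by apply: lf_cvgV => //; exact: lf_cvg_det.
Qed.
End Limits.

Section MatrixSpace.
Context (R : realType) (k : localField R) (a b : nat).

Lemma entry_cvg (A : 'M[k]_(a, b)) i j : (fun B : 'M[k]_(a, b) => B i j) @ A --> A i j.
Proof.
apply/(@lf_cvgP _ _ _ (nbhs A)) => e e0.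
by apply/nbhs_ballP; exists e => // B [_ AB]; exact: AB.
Qed.

Lemma mulmx_cvg c (A : 'M[k]_(c, a)) (B : 'M[k]_(a, b)) :
  (fun D => A *m D) @ B --> A *m B.
Proof.
apply: (@mx_cvgP _ _ _ (nbhs B)).
apply: (@lf_cvg_mulmx _ _ _ (nbhs B) _ _ _ _ (fun=> A) A id B) => i j.
  exact: cvg_cst.
exact: entry_cvg.
Qed.

Lemma mx_hausdorff : hausdorff_space 'M[k]_(a, b).
Proof.
move=> A B AB; apply/matrixP => i j; apply/eqP.
rewrite -subr_eq0 -absv_eq0; apply: contraT => nAB.
have e0 : 0 < absv (A i j - B i j) by rewrite lt_def nAB absv_ge0.
have [D [AD BD]] := AB _ _ (nbhsx_ballx A _ e0) (nbhsx_ballx B _ e0).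
have [_ /(_ i j)] := mx_ball_ultra AD (ball_sym BD).
by rewrite lf_ballE ltxx.
Qed.

(** Baire category: if no [C n] had interior in [Z], every ball would contain a smaller one missing
    [C n]. The nested balls would then have a common point, by compactness, lying in no [C n]. *)
Lemma mx_baire (Z : set 'M[k]_(a, b)) (C : nat -> set 'M[k]_(a, b)) x r :
  closed Z -> (forall n, closed (C n)) -> Z x -> 0 < r ->
  Z `&` ball x r `<=` \bigcup_n C n ->
  exists n y s, [/\ 0 < s, Z y & Z `&` ball y s `<=` C n].
Proof.
move=> cZ cC Zx r0 ZC; apply: contrapT => H.
pose good (p : 'M[k]_(a, b) * R) := Z p.1 /\ 0 < p.2.
(* The condition [good p] stands under the existential so that choice produces a total function. *)
have step (n : nat) (p : 'M[k]_(a, b) * R) : exists p', good p ->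
    [/\ good p', ball p.1 p.2 p'.1, p'.2 <= p.2 & ball p'.1 p'.2 `<=` ~` C n].
  have [[Zp p0]|?] := EM (good p); last by exists p.
  apply: contrapT => nex; apply: H; exists n, p.1, p.2; split => // y [Zy py].
  apply: contrapT => nCy; apply: nex.
  have : nbhs y (~` C n) by apply: open_nbhs_nbhs; split; [exact: closed_openC|].
  move=> /nbhs_ballP[s s0 sC]; exists (y, Num.min s p.2) => _; split=> //=.
  - by split=> //=; rewrite lt_min s0.
  - by rewrite ge_min lexx orbT.
  - by apply: subset_trans sC; apply: le_ball; rewrite ge_min lexx.
have [nxt nxtP] := choice (fun np : nat * _ => step np.1 np.2).
pose s := fix s n := if n is n'.+1 then nxt (n', s n') else (x, r).
have gs n : good (s n).
  by elim: n => [//|n IH] /=; have [] := nxtP (n, s n) IH.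
have ls i n : (s (n + i)%N).2 <= (s n).2 /\ ball (s n).1 (s n).2 (s (n + i)%N).1.
  elim: i => [|i [IH1 IH2]].
    by rewrite addn0; split=> //; apply: ballxx; case: (gs n).
  rewrite addnS /=; have [_ h1 h2 _] := nxtP ((n + i)%N, s (n + i)%N) (gs _).
  split; first exact: le_trans h2 IH1.
  by apply: mx_ball_ultra IH2 _; apply: le_ball h1.
(* A cluster point of the centers serves as the limit; by the ultrametric inequality it lies in
   every ball of the sequence. *)
have cpt : compact (Z `&` ball x r).
  by rewrite setIC; apply: compact_closedI => //; exact: mx_ball_compact.
have [|z [[Zz xz] zcl]] := cpt ((fun n => (s n).1) @ \oo).
  exists 0%N => // n _ /=; split; first by case: (gs n).
  by have [_] := ls n 0%N; rewrite add0n.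
have [n _ Cz] : (\bigcup_n C n) z by exact: ZC.
have [_ _ _ nC] := nxtP (n, s n) (gs n).
apply: (nC z) Cz.
rewrite -[nxt _]/(s n.+1); have sn0 : 0 < (s n.+1).2 by case: (gs n.+1).
have [||y [/= h1 h2]] := zcl (ball (s n.+1).1 (s n.+1).2) (ball z (s n.+1).2).
- exists n.+1 => // i /= ni; have [_] := ls (i - n.+1)%N n.+1.
  by rewrite subnKC.
- exact: nbhsx_ballx.
- by apply: mx_ball_ultra h1 _; exact: ball_sym.
Qed.
End MatrixSpace.

Section Congruence.
Context (R : realType) (k : localField R) (N : nat).
Implicit Types g h : 'M[k]_N.

(** Near 1 the entries are integral and the determinant is a unit, so inverses are integral as well.
    Then [1 - g h = (1 - g) + g (1 - h)] and [g^-1 - 1 = g^-1 (1 - g)] are as small as [1 - g] and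
    [1 - h]. *)
Lemma congruence_subgroup : exists2 r : R, 0 < r & forall d, d <= r ->
  (forall g, ball (1%:M : 'M[k]_N) d g ->
     g \in unitmx /\ ball (1%:M : 'M[k]_N) d (invmx g)) /\
  (forall g h, ball (1%:M : 'M[k]_N) d g -> ball (1%:M : 'M[k]_N) d h ->
     ball (1%:M : 'M[k]_N) d (g *m h)).
Proof.
have /lf_cvgP : (fun g => \det g) @ (1%:M : 'M[k]_N) --> \det (1%:M : 'M[k]_N).
  by apply: (lf_cvg_det (FF := nbhs_filter _)) => i j; exact: entry_cvg.
rewrite det1 => /(_ _ ltr01)/nbhs_ballP[r0 r00 r0P].
(* [r0] makes the determinant a unit; the bound 1 makes the entries integral. *)
exists (Num.min r0 1); first by rewrite lt_min r00/=.
move=> d; rewrite le_min => /andP[dr d1].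
have int g : ball (1%:M : 'M[k]_N) d g -> forall i j, absv (g i j) <= 1.
  move=> [d0 h] i j; rewrite -[g i j](subKr ((1%:M : 'M[k]_N) i j)).
  apply: absvB_le; last by rewrite ltW//; exact: lt_le_trans (h i j) d1.
  by rewrite mxE; case: eqP => _; rewrite ?absv1// absv0.
have detg g : ball (1%:M : 'M[k]_N) d g -> absv (\det g) = 1.
  move=> bg; have := r0P g (le_ball dr bg).
  by rewrite absvBC -[X in _ < X](absv1 k) => h; rewrite (absv_isosceles h) absv1.
have gunit g : ball (1%:M : 'M[k]_N) d g -> g \in unitmx.
  by move=> /detg dg; rewrite unitmxE unitfE -absv_eq0 dg oner_eq0.
split=> [g bg|g h bg bh]; last first.
  have d0 := mx_ball_gt0 bg; apply/mx_ballP => // i j.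
  have -> : (1%:M : 'M[k]_N) i j - (g *m h) i j =
      (1%:M - g) i j + (g *m (1%:M - h)) i j.
    by rewrite mulmxBr mulmx1 !mxE addrA subrK.
  apply: absvD_lt; first by case: bg => _ /(_ i j); rewrite !mxE.
  apply: absv_mulmx_lt => // [|a b]; first exact: int.
  by case: bh => _ /(_ a b); rewrite !mxE.
have ug := gunit g bg; split=> //.
have d0 := mx_ball_gt0 bg; apply/mx_ballP => // i j.
have -> : (1%:M : 'M[k]_N) i j - invmx g i j = (- (invmx g *m (1%:M - g))) i j.
  by rewrite mulmxBr mulmx1 mulVmx// opprB !mxE.
rewrite mxE absvN; apply: absv_mulmx_lt => //; last first.
  by move=> a b; case: bg => _ /(_ a b); rewrite !mxE.
by apply: absv_invmx_le1; [exact: detg|exact: int].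
Qed.
End Congruence.

(* An open mapping theorem, by Baire's argument: the group is a countable union
   of translates of the small compact subgroup. *)
Section OpenOrbit.
Context (R : realType) (k : localField R) (N m : nat).
Variables (H : set 'M[k]_N) (Z : set 'rV[k]_m).
Variable a : 'M[k]_N -> 'rV[k]_m -> 'rV[k]_m.
Hypothesis H_group : matgroup H.
Hypothesis H_closed :
  forall g, g \in unitmx -> ~ H g -> \forall h \near g, ~ H h.
Hypothesis Z_closed : closed Z.
Hypothesis Za : forall g x, H g -> Z x -> Z (a g x).
Hypothesis a1 : forall x, Z x -> a 1%:M x = x.
Hypothesis aM : forall g h x, H g -> H h -> Z x -> a (g *m h) x = a g (a h x).
Hypothesis a_contl :
  forall g x, H g -> Z x -> (fun h => a h x) @ g --> a g x.
Hypothesis a_contr : forall g x, H g -> Z x -> a g @ x --> a g x.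

(** The dense matrices need not lie in [H]. So for each basic ball one picks an element of [H] that
    approximates all of [H] inside the ball, whenever there is one; for small balls around [h] the
    element [h] itself shows that there is. *)
Lemma group_separable (e : R) : 0 < e ->
  exists G : nat -> 'M[k]_N, (forall i, H (G i)) /\
    forall h, H h -> exists i, ball (1%:M : 'M[k]_N) e (invmx (G i) *m h).
Proof.
move=> e0; have [HU H1 HM HV] := H_group; have [D DP] := mx_dense k N N.
pose U (i : 'M[nat * nat * nat]_N * nat) : set 'M[k]_N :=
  ball (D i.1) i.2.+1%:R^-1.
have /choice[G GP] (i : 'M[nat * nat * nat]_N * nat) : exists g, H g /\
    ((exists g', H g' /\ forall h, H h -> U i h ->
        ball (1%:M : 'M[k]_N) e (invmx g' *m h)) ->
      forall h, H h -> U i h -> ball (1%:M : 'M[k]_N) e (invmx g *m h)).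
  have [[g' [h1 h2]]|n] := EM (exists g', H g' /\
      forall h, H h -> U i h -> ball (1%:M : 'M[k]_N) e (invmx g' *m h)).
    by exists g'.
  by exists 1%:M; split=> // /n.
exists (fun n => if unpickle n is Some i then G i else 1%:M); split=> [n|h Hh].
  by case: unpickle => // i; have [] := GP i.
have : (fun h' => invmx h *m h') @ h --> invmx h *m h.
  exact: mulmx_cvg.
rewrite mulVmx; last exact: HU.
move=> /cvg_ballP/(_ e e0)/nbhs_ballP[r r0 rP].
have nr : (Num.trunc r^-1).+1%:R^-1 < r.
  by rewrite invf_plt ?posrE// truncnS_gt.
have n0 : 0 < (Num.trunc r^-1).+1%:R^-1 :> R by rewrite invr_gt0 ltr0n.
have [I hI] := DP h _ n0; pose i := (I, Num.trunc r^-1).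
have UE : U i = ball h (Num.trunc r^-1).+1%:R^-1.
  by rewrite /U /=; apply/esym/mx_ball_eq.
exists (pickle i); rewrite pickleK; have [_] := GP i; apply => //; last first.
  by rewrite UE; exact: ballxx.
by exists h; split=> // h' _; rewrite UE => /(le_ball (ltW nr)); exact: rP.
Qed.

Lemma open_orbit_map x (r : R) (e : R) : Z x -> 0 < r -> 0 < e ->
  Z `&` ball x r `<=` [set a g x | g in H] ->
  exists2 s, 0 < s & forall y, Z y -> ball x s y ->
    exists g, [/\ H g, ball (1%:M : 'M[k]_N) e g,
      ball (1%:M : 'M[k]_N) e (invmx g) & y = a g x].
Proof.
move=> Zx r0 e0 orb; have [HU H1 HM HV] := H_group.
have [d0 d00 dP] := congruence_subgroup k N.
pose d := Num.min d0 e.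
have dd0 : 0 < d by rewrite lt_min d00.
have [dV dM] : _ /\ _ := dP d ltac:(by rewrite ge_min lexx).
pose K := H `&` ball (1%:M : 'M[k]_N) d.
have cK : compact K.
  have cb := @mx_ball_compact _ _ _ _ (1%:M : 'M[k]_N) d.
  apply: subclosed_compact cb _; last by move=> g [].
  rewrite -[K]setCK; apply: open_closedC; rewrite openE => g nKg.
  (* [H_closed] speaks of invertible matrices only. Inside the small ball all matrices are
     invertible, so [K] is closed among all matrices. *)
  have [bg|nbg] := EM (ball (1%:M : 'M[k]_N) d g); last first.
    apply: (filterS _ (_ : nbhs g (~` ball (1%:M : 'M[k]_N) d))) => [h nh [_ /nh]//|].
    apply: open_nbhs_nbhs; split=> //; apply: closed_openC.
    exact: mx_ball_closed.
  have ug : g \in unitmx by have [] := dV g bg.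
  have /(H_closed ug) : ~ H g by move=> Hg; apply: nKg.
  by apply: filterS => h nh [/nh].
have [G [HG GP]] := group_separable dd0.
pose C n := [set a (G n *m h) x | h in K].
have cC n : closed (C n).
  apply: (compact_closed (@mx_hausdorff R k 1 m)).
  apply: (@continuous_compact _ _ (fun h => a (G n *m h) x)) => //.
  apply/subspace_continuousP => h [Hh _].
  have HGh : H (G n *m h) by exact: HM.
  apply: cvg_within_filter.
  apply: (@cvg_comp _ _ _ (fun h => G n *m h) (fun g => a g x) _ (nbhs (G n *m h))).
    exact: mulmx_cvg.
  exact: a_contl.
have sC : Z `&` ball x r `<=` \bigcup_n C n.
  move=> y /orb[g Hg <-]; have [i bi] := GP g Hg.
  exists i => //; exists (invmx (G i) *m g); last by rewrite mulKVmx// HU.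
  by split=> //; apply: HM => //; exact: HV.
(* Baire yields an interior point [y = G_n h x] of some translate, whereas a neighborhood of [x] is
   wanted: a point [z] near [x] is moved by [G_n h] to a point near [y], hence to some [G_n h' x],
   and then [z = h^-1 h' x]. *)
have [n [y [s [s0 Zy yC]]]] := mx_baire Z_closed cC Zx r0 sC.
have [h [Hh bh] hy] : C n y by apply: yC; split=> //; exact: ballxx.
have HGh : H (G n *m h) by exact: HM.
have /cvg_ballP/(_ s s0)/nbhs_ballP[t t0 tP] := a_contr HGh Zx.
exists t => // z Zz xz.
have [|h' [Hh' bh'] h'z] := yC (a (G n *m h) z).
  by split; [exact: Za|rewrite -hy; exact: tP].
have Hhh' : H (invmx h *m h') by apply: HM => //; exact: HV.
exists (invmx h *m h'); split=> //.
- apply: (@le_ball _ _ _ d); first by rewrite ge_min lexx orbT.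
  by apply: dM => //; have [] := dV h bh.
- apply: (@le_ball _ _ _ d); first by rewrite ge_min lexx orbT.
  by apply: (dV _ _).2; apply: dM => //; have [] := dV h bh.
- have HVG := HV _ HGh.
  rewrite -[z]a1// -(mulVmx (HU _ HGh)) aM// -h'z -aM//; last exact: HM.
  have -> : G n *m h' = (G n *m h) *m (invmx h *m h').
    by rewrite -mulmxA mulKVmx//; exact: HU.
  by rewrite mulKmx//; exact: HU.
Qed.
End OpenOrbit.

(** * Integration *)

Section ChangeOfVariables.
Context (R : realType) d (T : measurableType d) (mu : {measure set T -> \bar R}).
Variable g : T -> T.
Hypothesis mg : measurable_fun setT g.
Hypothesis g_mu : forall A, measurable A -> mu (g @^-1` A) = mu A.

Lemma ge0_integral_invariant (f : T -> \bar R) : measurable_fun setT f ->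
  (forall x, (0 <= f x)%E) -> (\int[mu]_x f (g x) = \int[mu]_x f x)%E.
Proof.
move=> mf f0.
have -> : (\int[mu]_x f (g x) = \int[pushforward mu g]_x f x)%E.
  by rewrite ge0_integral_pushforward// preimage_setT.
by apply: eq_measure_integral => A mA _; exact: g_mu.
Qed.

Lemma integral_invariant (f : T -> \bar R) : measurable_fun setT f ->
  (\int[mu]_x f (g x) = \int[mu]_x f x)%E.
Proof.
move=> mf; rewrite [LHS]integralE [RHS]integralE; congr (_ - _)%E.
  have h := @ge0_integral_invariant (f^\+%E) (measurable_funepos mf).
  rewrite -(h (fun x => funepos_ge0 f x)).
  by apply: eq_integral => x _; rewrite -[fun x => f (g x)]/(f \o g) funepos_comp.
have h := @ge0_integral_invariant (f^\-%E) (measurable_funeneg mf).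
rewrite -(h (fun x => funeneg_ge0 f x)).
by apply: eq_integral => x _; rewrite -[fun x => f (g x)]/(f \o g) funeneg_comp.
Qed.

Lemma integrable_invariant (f : T -> \bar R) :
  mu.-integrable setT f -> mu.-integrable setT (fun x => f (g x)).
Proof.
move=> /integrableP[mf fi]; apply/integrableP; split.
  exact: measurableT_comp.
rewrite (ge0_integral_invariant (f := fun x => `|f x|%E))//.
exact: measurableT_comp.
Qed.
End ChangeOfVariables.

Section ComplexIntegral.
Context (R : realType).
Local Notation C := (complex.complex R).

Lemma complexP (z w : C) : complex.Re z = complex.Re w ->
  complex.Im z = complex.Im w -> z = w.
Proof. by case: z w => [a b] [c e] /= -> ->. Qed.

Lemma complex_ReM (z w : C) : complex.Re (z * w) =
  complex.Re z * complex.Re w - complex.Im z * complex.Im w.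
Proof. by case: z w => [a b] [c e]. Qed.

Lemma complex_ImM (z w : C) : complex.Im (z * w) =
  complex.Re z * complex.Im w + complex.Im z * complex.Re w.
Proof. by case: z w => [a b] [c e]. Qed.

Context d (T : measurableType d) (mu : {measure set T -> \bar R}).

Lemma eq_cintegral (f g : T -> C) : f =1 g -> cintegral mu setT f = cintegral mu setT g.
Proof. by move=> /funext ->. Qed.

Lemma cintegralZl (c : C) (f : T -> C) : cintegrable mu setT f ->
  cintegral mu setT (fun x => c * f x) = c * cintegral mu setT f.
Proof.
move=> [fr fi].
have Zr (r : R) (h : T -> R) : mu.-integrable setT (EFin \o h) ->
    mu.-integrable setT (EFin \o (fun x => r * h x)).
  by move=> hi; exact: (integrableZl _ r hi).
apply: complexP; rewrite ?complex_ReM ?complex_ImM /=.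
  under eq_Rintegral do rewrite complex_ReM.
  by rewrite RintegralB ?RintegralZl//; exact: Zr.
under eq_Rintegral do rewrite complex_ImM.
by rewrite RintegralD ?RintegralZl//; exact: Zr.
Qed.

Lemma cintegral_invariant (g : T -> T) (f : T -> C) :
  measurable_fun setT g -> (forall A, measurable A -> mu (g @^-1` A) = mu A) ->
  cintegrable mu setT f ->
  cintegrable mu setT (fun x => f (g x)) /\
  cintegral mu setT (fun x => f (g x)) = cintegral mu setT f.
Proof.
move=> mg g_mu [fr fi]; split.
  by split; [exact: (integrable_invariant mg g_mu fr)|
             exact: (integrable_invariant mg g_mu fi)].
congr complex.Complex; rewrite /Rintegral.
  by rewrite (integral_invariant mg g_mu (measurable_int _ fr)).
by rewrite (integral_invariant mg g_mu (measurable_int _ fi)).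
Qed.
End ComplexIntegral.

Section Fubini.
Context (R : realType) d1 d2 (T1 : measurableType d1) (T2 : measurableType d2).
Context (m1 : {sigma_finite_measure set T1 -> \bar R}).
Context (m2 : {sigma_finite_measure set T2 -> \bar R}).
Local Open Scope ereal_scope.

(** Integrability of [g] is a conclusion: Fubini makes almost every slice integrable, [U] has
    positive measure and so contains such a slice, and the transfer from that slice to [g] is the
    first of the last two hypotheses. Only then can slice integrals be compared. *)
Lemma integral_product_cst (U : set T1) (f : T1 * T2 -> \bar R)
    (g : T2 -> \bar R) :
  measurable U -> 0 < m1 U -> m1 U < +oo -> (m1 \x m2).-integrable setT f ->
  (forall x y, ~ U x -> f (x, y) = 0) ->
  (forall x, U x -> m2.-integrable setT (fun y => f (x, y)) ->
    m2.-integrable setT g) ->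
  (forall x, U x -> m2.-integrable setT g ->
    \int[m2]_y f (x, y) = \int[m2]_y g y) ->
  m2.-integrable setT g /\
  \int[m1 \x m2]_z f z = m1 U * \int[m2]_y g y.
Proof.
move=> mU U0 Uoo fi f0 fg fgE.
have gi : m2.-integrable setT g.
  have [A [mA A0 hA]] := ae_integrable1 fi.
  have [x [Ux nAx]] : exists x, U x /\ ~ A x.
    apply: contrapT => nex.
    have : m1 U <= m1 A.
      apply: le_measure; rewrite ?inE// => x Ux; apply: contrapT => nAx.
      by apply: nex; exists x.
    by rewrite A0 leNgt U0.
  by apply: (fg x Ux); apply: contrapT => h; apply: nAx; exact: hA.
split=> //; rewrite -integral12_prod_meas1//.
have -> : fubini_F m2 f = fun x => (\int[m2]_y g y) * (\1_U x)%:E.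
  apply/funext => x; rewrite /fubini_F indicE.
  have [xU|xU] := boolP (x \in U).
    by rewrite mule1 fgE// -in_setE.
  by rewrite mule0 integral0_eq// => y _; apply: f0 => Ux;
      by rewrite (mem_set Ux) in xU.
have /fineK <- := integrable_fin_num measurableT gi.
rewrite integralZl//; last first.
  apply/integrableP; split; first exact/measurable_EFinP/measurable_indic.
  under eq_integral do rewrite gee0_abs ?lee_fin//.
  by rewrite integral_indic// setIT.
by rewrite integral_indic// setIT muleC.
Qed.
End Fubini.

Section MatrixMeasure.
Context (R : realType) (k : localField R) (a b : nat).
Local Notation M := 'M[k]_(a, b).

Lemma open_borel (A : set M) : open A -> measurable (A : set (borel M)).
Proof. exact: sub_sigma_algebra. Qed.

Lemma measurable_mx_cvg (g : M -> M) : continuous g ->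
  measurable_fun setT (g : borel M -> borel M).
Proof.
have mE : @measurable _ (borel M) = <<s @open M >> by [].
move=> cg; have h := @measurability _ _ (borel M) (borel M) setT g _ mE.
refine (h _) => _ [B oB <-]; rewrite setTI; apply: open_borel.
by apply: open_comp => // x _; exact: cg.
Qed.

Lemma measurable_locally_cst d (T : measurableType d) (f : M -> T) :
  (forall x, \forall y \near x, f y = f x) ->
  measurable_fun setT (f : borel M -> T).
Proof.
move=> lf _ B mB; rewrite setTI; apply: open_borel; rewrite openE => x Bx.
by apply: filterS (lf x) => y; rewrite /preimage /= => ->.
Qed.

(** Balls of radius [1/(i+1)] around the dense family form a countable base. Two balls are nested or
    disjoint, so adding the empty set makes the family stable under intersection, as the uniqueness
    theorem for measures requires. *)
Lemma borel_balls : @measurable _ (borel M) =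
  <<s [set A : set (borel M) | A = set0 \/ exists x e, A = ball (x : M) e] >>.
Proof.
have [D DP] := mx_dense k a b; apply/seteqP; split; last first.
  apply: smallest_sub; first exact: sigma_algebra_measurable.
  move=> A [->|[x [e ->]]]; first exact: measurable0.
  by apply: open_borel; exact: mx_ball_open.
apply: smallest_sub; first exact: smallest_sigma_algebra.
move=> A oA.
pose U (i : 'M[nat * nat * nat]_(a, b) * nat) : set M :=
  ball (D i.1) i.2.+1%:R^-1.
(* Codes that name no ball, or a ball not contained in [A], contribute the empty set. *)
pose V (n : nat) : set M := if unpickle n is Some i then
  if `[< U i `<=` A >] then U i else set0 else set0.
have -> : A = \bigcup_n V n.
  apply/seteqP; split=> [x Ax|x [n _]]; last first.
    by rewrite /V; case: unpickle => // i; case: asboolP => // UA /UA.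
  have /nbhs_ballP[r r0 rP] : nbhs x A by apply: open_nbhs_nbhs.
  have nr : (Num.trunc r^-1).+1%:R^-1 < r.
    by rewrite invf_plt ?posrE// truncnS_gt.
  have n0 : 0 < (Num.trunc r^-1).+1%:R^-1 :> R by rewrite invr_gt0 ltr0n.
  have [I hI] := DP x _ n0; pose i := (I, Num.trunc r^-1).
  have UE : U i = ball x (Num.trunc r^-1).+1%:R^-1.
    by rewrite /U /=; apply/esym/mx_ball_eq.
  exists (pickle i) => //; rewrite /V pickleK.
  case: asboolP => [_|]; first by rewrite UE; exact: ballxx.
  by case; rewrite UE => y /(le_ball (ltW nr)); exact: rP.
apply: sigma_algebra_bigcup => n; apply: sub_sigma_algebra.
rewrite /V; case: unpickle => [i|]; last by left.
by case: asboolP => _; [right; exists (D i.1), i.2.+1%:R^-1|left].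
Qed.

Lemma measure_balls_unique (m1 m2 : {measure set (borel M) -> \bar R}) :
  (forall (x : M) e, m1 (ball x e) = m2 (ball x e)) ->
  (forall (x : M) e, (m1 (ball x e) < +oo)%E) ->
  forall A : set (borel M), measurable A -> m1 A = m2 A.
Proof.
move=> m12 mfin A mA.
apply: (@measure_unique _ _ _ _
  (fun n => ball (0 : M) n.+1%:R : set (borel M)) borel_balls) => //.
- move=> A1 A2 [->|[x [e ->]]]; first by left; rewrite set0I.
  case=> [->|[y [f ->]]]; first by left; rewrite setI0.
  have [[z [xz yz]]|nz] := EM (ball x e `&` ball y f !=set0); last first.
    left; apply: contrapT => h; apply: nz; exact/set0P/eqP.
  right; rewrite (mx_ball_eq xz) (mx_ball_eq yz); exists z.
  have [ef|fe] := leP e f.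
    by exists e; apply/setIidPl; exact: le_ball.
  by exists f; apply/setIidPr; apply: le_ball; exact: ltW.
- by move=> i; right; exists 0, i.+1%:R.
- apply/seteqP; split=> // x _.
  exists (Num.trunc (\sum_i \sum_j absv (x i j))) => //.
  apply/mx_ballP; first by rewrite ltr0n.
  move=> i j; rewrite mxE sub0r absvN.
  by apply: le_lt_trans (absv_entry_le x i j) _; rewrite truncnS_gt.
- move=> A1 [->|[x [e ->]]]; [by rewrite !measure0|exact: m12].
Qed.
End MatrixMeasure.

(** * Fourier transforms of Schwartz functions *)

Section Schwartz.
Context (R : realType) (k : localField R) (a b : nat).
Local Notation C := (complex.complex R).
Local Notation M := 'M[k]_(a, b).
Implicit Types phi : M -> C.

Lemma schwartz_bounded phi : schwartz setT phi ->
  exists2 c : R, 0 < c & forall v : M, ~ ball (0 : M) c v -> phi v = 0.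
Proof.
move=> [_ [Q [cQ _] Q0]]; have [c cP] := compact_mx_bounded cQ.
have c0 : 0 < `|c| + 1 by rewrite ltr_wpDl.
exists (`|c| + 1) => // v nv; apply: Q0 => // Qv; apply: nv; apply/mx_ballP => // i j.
rewrite mxE sub0r absvN (le_lt_trans (cP _ Qv i j))//.
by rewrite ltr_pwDr// ler_norm.
Qed.

Lemma schwartz_uniform phi : schwartz setT phi ->
  exists2 r : R, 0 < r & forall v w, ball v r w -> phi w = phi v.
Proof.
move=> [lc [Q [cQ _] Q0]]; move/compact_near_coveringP in cQ.
have := cQ R (0^'+) (fun r v => forall w, ball v r w -> phi w = phi v) _.
case=> [v Qv|r /= r0 rP].
  have /nbhs_ballP[r r0 rP] := lc v I.
  have vr w : ball v r w -> phi w = phi v by move=> vw; exact: rP.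
  exists (ball v r, [set s | s < r]) => /=.
    split; first exact: nbhsx_ballx.
    by apply: nbhs_right_lt.
  move=> [w s] [/= vw sr] x wx; rewrite (vr w)// (vr x)//.
  by apply: mx_ball_ultra vw _; exact: le_ball (ltW sr) _ wx.
exists (r / 2); first by rewrite divr_gt0.
have r2 : 0 < r / 2 by rewrite divr_gt0.
have h v w : Q v -> ball v (r / 2) w -> phi w = phi v.
  move=> Qv; apply: (rP (r / 2)) => //=.
  by rewrite sub0r normrN gtr0_norm// ltr_pdivrMr// mulr_natr mulr2n ltrDl.
(* The uniform radius is known at points of [Q]. If only [w] lies in [Q], the roles are exchanged;
   if neither does, both values vanish. *)
move=> v w vw; have [Qv|nQv] := EM (Q v); first exact: h.
have [Qw|nQw] := EM (Q w); first by rewrite (h w v)//; exact: ball_sym.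
by rewrite !Q0.
Qed.

Lemma schwartz_intro phi (r c : R) : 0 < r ->
  (forall v w, ball v r w -> phi w = phi v) ->
  (forall v : M, ~ ball (0 : M) c v -> phi v = 0) -> schwartz setT phi.
Proof.
move=> r0 rP cP; split=> [v _|].
  by apply/nbhs_ballP; exists r => // w vw _; exact: rP.
exists (ball (0 : M) c); first by split=> //; exact: mx_ball_compact.
by move=> v _; exact: cP.
Qed.

Lemma schwartz_le phi : schwartz setT phi -> exists M : R, forall v,
  `|complex.Re (phi v)| <= M /\ `|complex.Im (phi v)| <= M.
Proof.
move=> [lc [Q [cQ _] Q0]]; move/compact_near_coveringP in cQ.
pose n v := `|complex.Re (phi v)| + `|complex.Im (phi v)|.
have := cQ R (+oo) (fun c v => n v <= c) _.
case=> [v Qv|c [_ cP]].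
  exists ([set w | phi w = phi v], [set c | n v < c]) => /=.
    split; first by apply: filterS (lc v I) => w; exact.
    by exists (n v); rewrite num_real.
  by move=> [w c] [/= ww /ltW]; rewrite /n ww.
exists (`|c| + 1) => v.
have : n v <= `|c| + 1.
  have [Qv|nQv] := EM (Q v); last by rewrite /n Q0//= !normr0 addr0 addr_ge0.
  by apply: cP => //; rewrite ltr_pwDr// ler_norm.
rewrite /n => h; split; apply: le_trans h; by rewrite ?lerDl ?lerDr.
Qed.

Context (mu : {measure set (borel M) -> \bar R}).
Hypothesis mu_radon : radon_on setT mu.

Lemma schwartz_integrable phi : schwartz setT phi -> cintegrable mu setT phi.
Proof.
move=> sphi; have [c c0 cP] := schwartz_bounded sphi.
have [B BP] := schwartz_le sphi; have [lc _] := sphi.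
have B0 : 0 <= B by have [h _] := BP 0; exact: le_trans h.
have mball : measurable (ball (0 : M) c : set (borel M)).
  by apply: open_borel; exact: mx_ball_open.
have fin : (mu (ball (0%R : M) c) < +oo)%E.
  by have [_ h _] := mu_radon; apply: h => //; exact: mx_ball_compact.
have main (f : M -> R) : (forall v, \forall w \near v, f w = f v) ->
    (forall v, `|f v| <= B) -> (forall v, ~ ball (0 : M) c v -> f v = 0) ->
    mu.-integrable setT (fun v : borel M => (f v)%:E).
  move=> lf fB f0.
  apply: (@le_integrable _ _ _ mu setT measurableT _
    (fun v => B%:E * (\1_(ball (0%R : M) c) v)%:E)%E).
  - apply: measurable_locally_cst => v; apply: filterS (lf v) => w ->//.
  - move=> v _; rewrite /= lee_fin indicE.
    have [vb|/negP vb] := boolP (v \in _).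
      by rewrite mulr1 (ger0_norm B0).
    by rewrite mulr0 normr0 f0 ?normr0// => h; apply: vb; rewrite inE.
  - apply: integrableZl => //; apply/integrableP; split.
      exact/measurable_EFinP/measurable_indic.
    under eq_integral do rewrite gee0_abs ?lee_fin//.
    by rewrite integral_indic// setIT.
split; apply: main.
- by move=> v; apply: filterS (lc v I) => w ->.
- by move=> v; have [] := BP v.
- by move=> v /cP ->.
- by move=> v; apply: filterS (lc v I) => w ->.
- by move=> v; have [] := BP v.
- by move=> v /cP ->.
Qed.
End Schwartz.

Section FourierTransform.
Context (R : realType) (k : localField R).
Local Notation C := (complex.complex R).
Local Notation V := 'cV[k]_2.
Variable eta : k -> C.
Hypothesis eta_char : additive_character eta.

Lemma eta_ReIm x : complex.Re (eta x) ^+ 2 + complex.Im (eta x) ^+ 2 = 1.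
Proof.
have [_ n1 _ _] := eta_char.
apply: (@complex.complexI R); rewrite complex.add_Re2_Im2 n1.
by rewrite expr1n.
Qed.

Lemma eta0 : eta 0 = 1.
Proof.
have [_ n1 M _] := eta_char.
have e0 : eta 0 != 0 by rewrite -normr_eq0 n1 oner_eq0.
by apply: (mulfI e0); rewrite -M addr0 mulr1.
Qed.

(* If 1 - Re z < 1/2 and |z| = 1, then 1 - Re z^2 >= 3 (1 - Re z): the circle
   has no small subgroups. *)
Lemma eta_trivial_ball : exists2 r : R, 0 < r & forall x, absv x < r -> eta x = 1.
Proof.
have [[cRe _] _ M _] := eta_char.
have : (fun x : k => complex.Re (eta x)) @ (0 : k) --> (1 : R).
  by have := cRe 0; rewrite /continuous_at eta0.
have h2 : 0 < 2^-1 :> R by rewrite invr_gt0.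
move=> /cvg_ballP/(_ _ h2)/nbhs_ballP[r r0 rP]; exists r => // x xr.
pose t y := 1 - complex.Re (eta y).
have t_lt y : absv y < r -> t y < 2^-1.
  move=> yr; have := rP y; rewrite lf_ballE sub0r absvN => /(_ yr).
  by rewrite /ball/= => /ltr_normlW.
have Re_le y : complex.Re (eta y) <= 1.
  rewrite leNgt; apply/negP => h; have := eta_ReIm y.
  have h1 : 1 < complex.Re (eta y) ^+ 2 by rewrite expr_gt1 ?ltW// (lt_trans _ h).
  move=> e; have : 1 < complex.Re (eta y) ^+ 2 + complex.Im (eta y) ^+ 2.
    by rewrite ltr_wpDr// sqr_ge0.
  by rewrite e ltxx.
have t0 y : 0 <= t y by rewrite subr_ge0.
have dbl (y : k) : absv y < r -> absv (y + y) < r by move=> yr; exact: absvD_lt.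
have t3 y : absv y < r -> 3 * t y <= t (y + y).
  move=> yr; have := t_lt y yr; have := t0 y; rewrite /t M complex_ReM.
  have := eta_ReIm y; move: (complex.Re _) (complex.Im _) => p q.
  by rewrite -!expr2; nra.
(* Doubling preserves the ball and multiplies [t] by at least 3, so [3^n t(y)] stays below 1/2 for
   every [n], which forces [t(x) = 0]. *)
have tn n : forall y, absv y < r -> 3 ^+ n * t y < 2^-1.
  elim: n => [|n IH] y yr; first by rewrite expr0 mul1r; exact: t_lt.
  apply: le_lt_trans; last exact: (IH (y + y) (dbl y yr)).
  by rewrite exprSr -mulrA ler_wpM2l ?exprn_ge0// t3.
have tx : t x = 0.
  apply/eqP; rewrite eq_le t0 andbT leNgt; apply/negP => tx0.
  pose n := Num.trunc (t x)^-1.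
  have := tn n.+1 x xr; apply/negP; rewrite -leNgt.
  have : (t x)^-1 <= 3 ^+ n.+1.
    apply: (@le_trans _ _ n.+1%:R); first by rewrite ltW// truncnS_gt.
    by rewrite -natrX ler_nat ltnW// ltn_expl.
  rewrite -[X in X <= _]mul1r ler_pdivrMr// => h; apply: le_trans h.
  by rewrite invf_le1// ler1n.
have Re1 : complex.Re (eta x) = 1 by apply/eqP; rewrite eq_sym -subr_eq0 -/(t x) tx.
apply: complexP => //=; apply/eqP; rewrite -sqrf_eq0.
by have := eta_ReIm x; rewrite Re1 expr1n => /(canRL (addKr _)) ->; rewrite addNr.
Qed.

Lemma pairingE (v w : V) :
  (v^T *m jmx k *m w) 0 0 = v 0 0 * w 1 0 - v 1 0 * w 0 0.
Proof.
rewrite !mxE !big_ord_recl big_ord0 !mxE !big_ord_recl !big_ord0 !mxE /=.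
have -> : lift ord0 ord0 = 1 :> 'I_2 by apply/val_inj.
by rewrite /= !(mulr0, addr0, add0r, mulr1, mulrN1, mulNr) addrC.
Qed.

Lemma absv_pairing (v w : V) (r s : R) :
  (forall i, absv (v i 0) <= r) -> (forall i, absv (w i 0) < s) -> 0 < r ->
  absv ((v^T *m jmx k *m w) 0 0) < r * s.
Proof.
move=> vr ws r0; rewrite pairingE; apply: absvB_lt; rewrite absvM.
  by rewrite (le_lt_trans (ler_wpM2r (absv_ge0 _) (vr _)))// ltr_pM2l.
by rewrite (le_lt_trans (ler_wpM2r (absv_ge0 _) (vr _)))// ltr_pM2l.
Qed.

Lemma kernelV_addl (v v' w : V) :
  kernelV eta (v + v') w = kernelV eta v w * kernelV eta v' w.
Proof. by have [_ _ M _] := eta_char; rewrite /kernelV linearD !mulmxDl mxE M. Qed.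

Lemma kernelV_addr (v w w' : V) :
  kernelV eta v (w + w') = kernelV eta v w * kernelV eta v w'.
Proof. by have [_ _ M _] := eta_char; rewrite /kernelV mulmxDr mxE M. Qed.

Lemma schwartz_kernelM (phi : V -> C) v : schwartz setT phi ->
  schwartz setT (fun w => kernelV eta v w * phi w).
Proof.
move=> sphi; have [c c0 cP] := schwartz_bounded sphi.
have [r r0 rP] := schwartz_uniform sphi; have [s s0 sP] := eta_trivial_ball.
(* A positive bound for the entries of [v]: vectors with entries below [s / n] pair with [v] to
   something below [s], where [eta] is trivial. *)
pose n := absv (v 0 0) + absv (v 1 0) + 1.
have n0 : 0 < n by rewrite ltr_wpDl// addr_ge0// absv_ge0.
apply: (@schwartz_intro _ _ _ _ _ (Num.min r (s / n)) c).
- by rewrite lt_min r0 divr_gt0.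
- move=> w w' ww'; rewrite (rP w w'); last first.
    by apply: le_ball ww'; rewrite ge_min lexx.
  congr (_ * _); rewrite -[w'](subrK w) kernelV_addr -[RHS]mul1r.
  congr (_ * _); rewrite /kernelV sP//.
  rewrite -[s](mulfVK (lt0r_neq0 n0)) mulrC; apply: absv_pairing => //.
    move=> i; have [->|->] : i = 0 \/ i = 1.
      by case: i => [[|[|//]] hi]; [left|right]; exact/val_inj.
      by rewrite /n -addrA lerDl addr_ge0// absv_ge0.
    by rewrite /n addrAC lerDr addr_ge0// absv_ge0.
  move=> i; rewrite !mxE absvBC.
  have [_ /(_ i 0) h] := ww'.
  by apply: lt_le_trans h _; rewrite ge_min lexx orbT.
- by move=> w /cP ->; rewrite mulr0.
Qed.

Context (nu : {measure set (borel V) -> \bar R}).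
Hypothesis nu_haar : haar_V nu.

Lemma measurable_translation (l : V) :
  measurable_fun setT ((fun w => w + l) : borel V -> borel V).
Proof.
apply: measurable_mx_cvg => w; apply/(@cvg_ballP _ _ _ (nbhs w)) => e e0.
apply/nbhs_ballP; exists e => // w' [_ h]; split=> // i j.
by have := h i j; rewrite !lf_ballE !mxE opprD addrACA subrr addr0.
Qed.

Lemma haar_translation (l : V) (A : set (borel V)) : measurable A ->
  nu ((fun w : V => w + l) @^-1` A) = nu A.
Proof.
move=> mA; have [_ /(_ (- l) _ mA) <-] := nu_haar.
congr (nu _); apply/seteqP; split=> [w /= Aw|_ [w Aw <-]].
  by exists (w + l) => //; rewrite addrC addrK.
by rewrite /= addrC addNKr.
Qed.

(** Bounded support of [phi] makes the transform locally constant. Invariance of [phi] under small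
    translations [l] bounds its support: translating the variable multiplies the transform at [v] by
    [eta] of the pairing of [v] with [l], and for large [v] some [l] makes this factor different
    from 1. *)
Lemma fourierV_schwartz (phi : V -> C) : schwartz setT phi ->
  schwartz setT (fourierV eta nu phi).
Proof.
move=> sphi; have [c c0 cP] := schwartz_bounded sphi.
have [r r0 rP] := schwartz_uniform sphi; have [s s0 sP] := eta_trivial_ball.
have [_ _ _ [x0 x01]] := eta_char.
(* On the support of [phi], a change of [v] below [s / c] changes the pairing by less than [s].
   Beyond [|x0| / r] a translation smaller than [r] pairs with [v] to [x0]; the summand 1 only keeps
   the radius positive. *)
apply: (@schwartz_intro _ _ _ _ _ (s / c) (absv x0 / r + 1)).
- by rewrite divr_gt0.
- move=> v v' vv'; apply: eq_cintegral => w.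
  have [wc|nwc] := EM (ball (0 : V) c w); last by rewrite cP ?mulr0.
  congr (_ * _); rewrite -[v'](subrK v) kernelV_addl -[RHS]mul1r; congr (_ * _).
  rewrite /kernelV sP// pairingE.
  have h i : absv ((v' - v) i 0) < s / c.
    by rewrite !mxE absvBC; case: vv' => _; exact.
  have h' i : absv (w i 0) < c.
    by case: wc => _ /(_ i 0); rewrite lf_ballE mxE sub0r absvN.
  rewrite -[s](mulfVK (lt0r_neq0 c0)).
  by apply: absvB_lt; rewrite absvM ltr_pM// absv_ge0.
- move=> v nv.
  have [i vi] : exists i, absv x0 / r < absv (v i 0).
    apply: contrapT => nex; apply: nv.
    have p0 : 0 < absv x0 / r + 1 by rewrite ltr_wpDl// divr_ge0// ?absv_ge0// ltW.
    apply/mx_ballP => // i j; rewrite mxE sub0r absvN ord1.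
    apply: (@le_lt_trans _ _ (absv x0 / r)); last by rewrite ltrDl.
    by rewrite leNgt; apply/negP => h; apply: nex; exists i.
  have vi0 : v i 0 != 0.
    by rewrite -absv_eq0 gt_eqF// (le_lt_trans _ vi)// divr_ge0// ?absv_ge0// ltW.
  have vp : 0 < absv (v i 0) by rewrite lt_def absv_eq0 vi0 absv_ge0.
  have small : absv (x0 / v i 0) < r.
    by rewrite absvM absvV ltr_pdivrMr// mulrC -ltr_pdivrMr.
  (* The form is alternating, so [l] is supported on the coordinate other than [i], with the sign of
     the form compensated. *)
  have [l lr lx] : exists2 l : V, ball (0 : V) r l & (v^T *m jmx k *m l) 0 0 = x0.
    have [i0|i1] : i = 0 \/ i = 1.
      by case: (i) => [[|[|//]] hi]; [left|right]; exact/val_inj.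
    - subst i; exists (\col_j (if j == 0 then 0 else x0 / v 0 0)).
        apply/mx_ballP => // i j; rewrite !mxE sub0r absvN.
        by case: ifP => // _; rewrite absv0.
      by rewrite pairingE !mxE /= mulr0 subr0 mulrC divfK.
    - subst i; exists (\col_j (if j == 0 then - (x0 / v 1 0) else 0)).
        apply/mx_ballP => // i j; rewrite !mxE sub0r absvN.
        by case: ifP => // _; rewrite ?absvN// absv0.
      by rewrite pairingE !mxE /= mulr0 sub0r mulrN opprK mulrC divfK.
  have int := schwartz_integrable (nu_haar.1) (schwartz_kernelM v sphi).
  have [_ e] := cintegral_invariant (measurable_translation l)
    (@haar_translation l) int.
  have : fourierV eta nu phi v = eta x0 * fourierV eta nu phi v.
    rewrite {1}/fourierV -e -cintegralZl//; apply: eq_cintegral => w.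
    rewrite kernelV_addr (rP w (w + l)).
      by rewrite {2}/kernelV lx mulrCA mulrA.
    apply/mx_ballP => // p q; rewrite mxE opprD addrA subrr sub0r absvN.
    by case: lr => _ /(_ p q); rewrite lf_ballE mxE sub0r absvN.
  move/eqP; rewrite -{1}[fourierV eta nu phi v]mul1r -subr_eq0 -mulrBl mulf_eq0.
  by rewrite subr_eq0 eq_sym (negbTE x01) => /eqP.
Qed.
End FourierTransform.

(** * Restriction of scalars and linear recurrences *)

Section Evaluation.
Context (k : fieldType) (kb : closedFieldType) (ib : {rmorphism k -> kb}).

Lemma kval_map n (p : mpoly.mpoly n k) (x : 'rV[k]_n) :
  kval ib p (map_mx ib x) = ib (mpoly.meval (x 0) p).
Proof.
rewrite /kval /mpoly.mmap mpoly.mevalE rmorph_sum; apply: eq_bigr => m _.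
rewrite rmorphM /mpoly.mmap1 rmorph_prod; congr (_ * _); apply: eq_bigr => i _.
by rewrite mxE rmorphXn.
Qed.

Lemma map_GLcrd N (g : 'M[k]_N) :
  GLcrd (map_mx ib g) = map_mx ib (GLcrd g).
Proof.
rewrite /GLcrd map_row_mx map_mxvec det_map_mx; congr row_mx.
by apply/rowP => i; rewrite !mxE fmorphV.
Qed.

Lemma map_mx_inj_eq a b (A A' : 'M[k]_(a, b)) : map_mx ib A = map_mx ib A' -> A = A'.
Proof.
move/matrixP => h; apply/matrixP => i j.
by have := h i j; rewrite !mxE => /fmorph_inj.
Qed.
End Evaluation.

Section RestrictionOfScalars.
Context (R : realType) (k k' : localField R) (E : unramifiedExt k k').
Context (kb : closedFieldType) (ib : {rmorphism k -> kb}).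
Local Notation d := (ue_deg E).
Local Notation coord := (ue_coord E).
Local Notation basis := (ue_basis E).
Implicit Types (a b : k') (z : 'M[kb]_d) (c : 'rV[kb]_d).

Lemma ue_coordD a b : coord (a + b) = coord a + coord b.
Proof.
rewrite -[RHS](ue_basisK (u := E)); congr coord.
under eq_bigr do rewrite mxE rmorphD mulrDl.
by rewrite big_split /= !ue_coordK.
Qed.

Lemma ue_coordZ (c : k) a : coord (ue_inj E c * a) = c *: coord a.
Proof.
rewrite -[RHS](ue_basisK (u := E)); congr coord.
under eq_bigr do rewrite mxE rmorphM -mulrA.
by rewrite -mulr_sumr ue_coordK.
Qed.

Lemma ue_coord0 : coord 0 = 0.
Proof. by rewrite -[X in coord X](mul0r 0) -(rmorph0 (ue_inj E)) ue_coordZ scale0r. Qed.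

Lemma ue_coord_sum I (r : seq I) (P : pred I) (F : I -> k') :
  coord (\sum_(i <- r | P i) F i) = \sum_(i <- r | P i) coord (F i).
Proof. exact: (big_morph _ ue_coordD ue_coord0). Qed.

Lemma ue_coord_basis l : coord (basis l) = delta_mx 0 l.
Proof.
rewrite -[RHS](ue_basisK (u := E)); congr coord.
rewrite (bigD1 l)//= big1 => [|i il]; first by rewrite mxE !eqxx rmorph1 mul1r addr0.
by rewrite mxE eqxx /= (negbTE il) rmorph0 mul0r.
Qed.

Lemma ue_coord_inj : injective coord.
Proof. by move=> a b ab; rewrite -(ue_coordK E a) -(ue_coordK E b) ab. Qed.

Lemma coord_reg a b : coord b *m reg E a = coord (a * b).
Proof.
rewrite -[in RHS](ue_coordK E b) mulr_sumr ue_coord_sum; apply/rowP => j.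
rewrite mxE summxE; apply: eq_bigr => i _.
by rewrite mulrCA ue_coordZ !mxE.
Qed.

(** Coordinates are row vectors and [reg] acts on the right, so the product comes out reversed; [k']
    is commutative. *)
Lemma regM a b : reg E a *m reg E b = reg E (b * a).
Proof.
apply/row_matrixP => i; rewrite row_mul.
have rowE x : row i (reg E x) = coord (x * basis i).
  by apply/rowP => j; rewrite !mxE.
by rewrite !rowE coord_reg mulrA.
Qed.

Lemma reg_sum (c : 'rV[k]_d) :
  reg E (\sum_l ue_inj E (c 0 l) * basis l) = \sum_l c 0 l *: reg E (basis l).
Proof.
apply/matrixP => i j; rewrite mxE summxE mulr_suml ue_coord_sum summxE.
by apply: eq_bigr => l _; rewrite -mulrA ue_coordZ !mxE.
Qed.

Lemma reg1 : reg E 1 = 1%:M.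
Proof. by apply/matrixP => i j; rewrite mxE mul1r ue_coord_basis !mxE eqxx eq_sym. Qed.

Lemma reg0 : reg E 0 = 0.
Proof. by apply/matrixP => i j; rewrite mxE mul0r ue_coord0 !mxE. Qed.

Lemma regD a b : reg E (a + b) = reg E a + reg E b.
Proof. by apply/matrixP => i j; rewrite !mxE mulrDl ue_coordD mxE. Qed.

Lemma reg_inj : injective (reg E).
Proof.
by move=> a b ab; apply: ue_coord_inj; rewrite -[a]mulr1 -[b]mulr1 -!coord_reg ab.
Qed.

Definition res_mx c : 'M[kb]_d := \sum_l c 0 l *: map_mx ib (reg E (basis l)).

Lemma in_res_mx c : in_res ib (E := E) (res_mx c). Proof. by exists c. Qed.

Lemma res_mx_is_linear : linear res_mx.
Proof.
move=> x c c'; rewrite /res_mx scaler_sumr -big_split; apply: eq_bigr => l _.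
by rewrite !mxE scalerDl scalerA.
Qed.

HB.instance Definition _ := GRing.isLinear.Build kb 'rV[kb]_d 'M[kb]_d *:%R
  res_mx res_mx_is_linear.

Lemma res_mxZ x c : res_mx (x *: c) = x *: res_mx c.
Proof. exact: linearZZ. Qed.

(** An element of the regular representation is determined by its effect on 1. This recovers
    coordinates over [kb] by a formula with coefficients in [k]. *)
Lemma coord_res_mx c : map_mx ib (coord 1) *m res_mx c = c.
Proof.
rewrite mulmx_sumr [RHS]row_sum_delta; apply: eq_bigr => l _.
by rewrite -scalemxAr -map_mxM coord_reg mulr1 ue_coord_basis map_delta_mx.
Qed.

Lemma in_resP z : in_res ib (E := E) z -> z = res_mx (map_mx ib (coord 1) *m z).
Proof. by move=> [c ->]; rewrite -/(res_mx c) coord_res_mx. Qed.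

Lemma res_mx_map (c : 'rV[k]_d) :
  res_mx (map_mx ib c) = map_mx ib (reg E (\sum_l ue_inj E (c 0 l) * basis l)).
Proof.
rewrite reg_sum map_mx_sum; apply: eq_bigr => l _.
by rewrite mxE map_mxZ.
Qed.

Lemma res_mx_reg a : res_mx (map_mx ib (coord a)) = map_mx ib (reg E a).
Proof. by rewrite res_mx_map ue_coordK. Qed.

Lemma in_res_reg a : in_res ib (E := E) (map_mx ib (reg E a)).
Proof. by rewrite -res_mx_reg; exact: in_res_mx. Qed.

Lemma in_res1 : in_res ib (E := E) 1%:M.
Proof. by rewrite -(map_mx1 ib) -reg1; exact: in_res_reg. Qed.

Lemma in_res0 : in_res ib (E := E) 0.
Proof. by rewrite -(linear0 res_mx); exact: in_res_mx. Qed.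

Lemma res_mxM c c' : res_mx c *m res_mx c' = res_mx (c *m res_mx c').
Proof.
suff h : in_res ib (E := E) (res_mx c *m res_mx c').
  by rewrite (in_resP h) mulmxA coord_res_mx.
have hb l m : exists c, map_mx ib (reg E (basis l)) *m
    map_mx ib (reg E (basis m)) = res_mx c.
  by rewrite -map_mxM regM -res_mx_reg; eexists.
rewrite /(res_mx c) mulmx_suml.
elim/big_ind : _ => [|x y [cx ->] [cy ->]|l _]; first exact: in_res0.
  by exists (cx + cy); rewrite -!/(res_mx _) linearD.
rewrite -scalemxAl mulmx_sumr.
elim/big_ind : _ => [|x y [cx hx] [cy hy]|m _].
- by rewrite scaler0; exact: in_res0.
- exists (cx + cy); rewrite scalerDr hx hy -!/(res_mx _).
  by rewrite -(linearD res_mx).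
- have [c0 h0] := hb l m; rewrite -scalemxAr h0; exists (c 0 l *: (c' 0 m *: c0)).
  by rewrite -[RHS]/(res_mx _) !res_mxZ.
Qed.

(** Take the element of the span having the coordinates of [z^-1] at 1. Its product with [z] has the
    coordinates of 1, so it is a left inverse of [z], hence [invmx z]. *)
Lemma in_res_invmx z : in_res ib (E := E) z -> z \in unitmx ->
  in_res ib (E := E) (invmx z).
Proof.
move=> /in_resP zE uz; set c := _ *m z in zE.
have h : res_mx (map_mx ib (coord 1) *m invmx z) *m z = 1%:M.
  by rewrite {2}zE res_mxM -zE mulmxKV// res_mx_reg reg1 map_mx1.
have -> : invmx z = res_mx (map_mx ib (coord 1) *m invmx z).
  by rewrite -[RHS](mulmxK uz) h mul1mx.
exact: in_res_mx.
Qed.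

Lemma in_resM z z' : in_res ib (E := E) z -> in_res ib (E := E) z' ->
  in_res ib (E := E) (z *m z').
Proof. by move=> /in_resP -> /in_resP ->; rewrite res_mxM; exact: in_res_mx. Qed.

Lemma in_resD z z' : in_res ib (E := E) z -> in_res ib (E := E) z' ->
  in_res ib (E := E) (z + z').
Proof.
by move=> /in_resP -> /in_resP ->; rewrite -linearD; exact: in_res_mx.
Qed.

Lemma in_resZ (x : kb) z : in_res ib (E := E) z -> in_res ib (E := E) (x *: z).
Proof. by move=> /in_resP ->; rewrite -res_mxZ; exact: in_res_mx. Qed.
End RestrictionOfScalars.

Section LinearRecurrence.
Context (F : fieldType).

(** The matrix form makes closure properties visible: sums come from block matrices, products from
    Kronecker products. Invertibility of [M] excludes sequences that vanish from some point on
    without being zero. *)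
Definition linrec (a : nat -> F) := exists d (u : 'rV[F]_d) (M : 'M[F]_d)
  (w : 'cV[F]_d), M \in unitmx /\ forall n, a n = (u *m M ^+ n *m w) 0 0.

Lemma eq_linrec a b : a =1 b -> linrec a -> linrec b.
Proof. by move=> /funext ->. Qed.

Lemma linrecX (x : F) : x != 0 -> linrec (fun n => x ^+ n).
Proof.
move=> x0; exists 1%N, 1%:M, x%:M, 1%:M; split=> [|n].
  by rewrite unitmxE det_scalar expr1 unitfE.
rewrite mul1mx mulmx1 -[x%:M ^+ n]/(scalar_mx x ^+ n).
elim: n => [|n IH]; first by rewrite !expr0 -[RHS]/((1%:M : 'M[F]_1) 0 0) mxE.
by rewrite !exprS IH -[x%:M * _]/(x%:M *m _) mul_scalar_mx [RHS]mxE.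
Qed.

Lemma linrecZ (x : F) a : linrec a -> linrec (fun n => x * a n).
Proof.
move=> [d [u [M [w [uM aE]]]]]; exists d, (x *: u), M, w; split=> // n.
by rewrite aE -!scalemxAl [RHS]mxE.
Qed.

Lemma linrec_cst (x : F) : linrec (fun=> x).
Proof.
have := linrecZ x (linrecX (oner_neq0 F)).
by apply: eq_linrec => n; rewrite expr1n mulr1.
Qed.

Lemma linrecD a b : linrec a -> linrec b -> linrec (fun n => a n + b n).
Proof.
move=> [d [u [M [w [uM aE]]]]] [d' [u' [M' [w' [uM' bE]]]]].
exists (d + d')%N, (row_mx u u'), (block_mx M 0 0 M'), (col_mx w w').
split=> [|n].
  by rewrite unitmxE det_ublock unitrM -!unitmxE uM.
have -> : block_mx M 0 0 M' ^+ n = block_mx (M ^+ n) 0 0 (M' ^+ n).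
  elim: n => [|n IH]; first by rewrite !expr0 -[RHS]scalar_mx_block.
  by rewrite !exprS IH [LHS]mulmx_block !mulmx0 !mul0mx !addr0 !add0r.
by rewrite mul_row_block !mulmx0 add0r addr0 mul_row_col mxE aE bE.
Qed.

Lemma linrecM a b : linrec a -> linrec b -> linrec (fun n => a n * b n).
Proof.
move=> [d [u [M [w [uM aE]]]]] [d' [u' [M' [w' [uM' bE]]]]].
exists (d * d')%N, (mxtens.tensmx u u'), (mxtens.tensmx M M'), (mxtens.tensmx w w').
have t1 : mxtens.tensmx (1%:M : 'M[F]_d) (1%:M : 'M[F]_d') = 1%:M.
  apply/matrixP => i j; case: (mxtens.mxtens_indexP i) => i0 i1.
  case: (mxtens.mxtens_indexP j) => j0 j1; rewrite mxtens.tensmxE !mxE.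
  rewrite (can_eq (@mxtens.mxtens_indexK _ _)) xpair_eqE.
  by case: (i0 == j0); case: (i1 == j1); rewrite ?mulr0 ?mulr1 ?mul0r.
have MX n : mxtens.tensmx M M' ^+ n = mxtens.tensmx (M ^+ n) (M' ^+ n).
  elim: n => [|n IH]; first by rewrite !expr0 -[RHS]/(mxtens.tensmx 1%:M 1%:M) t1.
  by rewrite !exprS IH [LHS]mxtens.tensmx_mul.
split=> [|n].
  have : mxtens.tensmx M M' *m mxtens.tensmx (invmx M) (invmx M') = 1%:M.
    by rewrite mxtens.tensmx_mul !mulmxV// t1.
  by move=> /mulmx1_unit[].
have h : mxtens.tensmx (u *m M ^+ n *m w) (u' *m M' ^+ n *m w') =
    mxtens.tensmx u u' *m mxtens.tensmx (M ^+ n) (M' ^+ n) *m mxtens.tensmx w w'.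
  by rewrite !mxtens.tensmx_mul.
rewrite MX aE bE.
transitivity (mxtens.tensmx (u *m M ^+ n *m w) (u' *m M' ^+ n *m w')
  (mxtens.mxtens_index (0, 0)) (mxtens.mxtens_index (0, 0))).
  by rewrite mxtens.tensmxE.
by rewrite h; congr (fun_of_matrix _ _ _); exact/val_inj.
Qed.

Lemma linrec_sum I (r : seq I) (P : pred I) (f : I -> nat -> F) :
  (forall i, P i -> linrec (f i)) -> linrec (fun n => \sum_(i <- r | P i) f i n).
Proof.
move=> fP; elim: r => [|i r IH].
  by apply: eq_linrec (linrec_cst 0) => n; rewrite big_nil.
have [Pi|nPi] := boolP (P i); last first.
  by apply: eq_linrec IH => n; rewrite big_cons (negbTE nPi).
by apply: eq_linrec (linrecD (fP i Pi) IH) => n; rewrite big_cons Pi.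
Qed.

Lemma linrec_prod I (r : seq I) (P : pred I) (f : I -> nat -> F) :
  (forall i, P i -> linrec (f i)) -> linrec (fun n => \prod_(i <- r | P i) f i n).
Proof.
move=> fP; elim: r => [|i r IH].
  by apply: eq_linrec (linrec_cst 1) => n; rewrite big_nil.
have [Pi|nPi] := boolP (P i); last first.
  by apply: eq_linrec IH => n; rewrite big_cons (negbTE nPi).
by apply: eq_linrec (linrecM (fP i Pi) IH) => n; rewrite big_cons Pi.
Qed.

Lemma linrec_pow a m : linrec a -> linrec (fun n => a n ^+ m).
Proof.
move=> la; elim: m => [|m IH]; first exact: eq_linrec (linrec_cst 1).
by apply: eq_linrec (linrecM la IH) => n; rewrite exprS.
Qed.

Lemma linrec_mmap (k : fieldType) (ib : {rmorphism k -> F}) n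
    (y : nat -> 'I_n -> F) (p : mpoly.mpoly n k) :
  (forall i, linrec (y^~ i)) -> linrec (fun m => mpoly.mmap ib (y m) p).
Proof.
move=> yP; apply: linrec_sum => m _; apply: linrecZ.
by apply: linrec_prod => i _; exact: linrec_pow.
Qed.

Lemma linrec_mxpow N (g : 'M[F]_N) i j : g \in unitmx ->
  linrec (fun n => (g ^+ n) i j).
Proof.
move=> ug; exists N, (delta_mx 0 i), g, (delta_mx j 0); split=> // n.
by rewrite -rowE -colE !mxE.
Qed.

(* Cayley-Hamilton runs an invertible recurrence backwards. *)
Lemma linrec_eq0 a m : linrec a -> (forall n, (m <= n)%N -> a n = 0) -> a 0 = 0.
Proof.
move=> [[|d] [u [M [w [uM aE]]]]]; first by move=> _; rewrite aE mxE big_ord0.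
elim: m => [h|m IH h]; first exact: h.
apply: IH => n; rewrite leq_eqVlt => /predU1P[<-|]; last exact: h.
(* Cayley-Hamilton multiplied by [M^m] expresses a combination of [a m, a (m+1), ...]. All terms
   after the first vanish, and the coefficient of [a m] is the determinant of [M] up to sign. *)
have := char_poly_det M.
have /(congr1 (fun A => (u *m M ^+ m *m A *m w) 0 0)) := Cayley_Hamilton M.
set p := char_poly M; rewrite -[in horner_mx _ p](coefK p) poly_def rmorph_sum /=.
rewrite mulmx_sumr mulmx_suml summxE mulmx0 mul0mx mxE.
have sp : size p = d.+2 by rewrite size_char_poly.
rewrite sp big_ord_recl /= big1 => [|i _]; last first.
  rewrite linearZ /= rmorphXn /= horner_mx_X -!scalemxAr -!scalemxAl mxE.
  rewrite -[u *m _ *m _]mulmxA -[M ^+ m *m _]/(M ^+ m * _) -exprD -aE h ?mulr0//.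
  by rewrite /= /bump leq0n add1n addnS ltnS leq_addr.
rewrite addr0 expr0 linearZ /= rmorph1 -scalemxAr mulmx1 -!scalemxAl mxE -aE.
move=> /eqP; rewrite mulf_eq0 => /orP[/eqP -> /esym/eqP|/eqP//].
rewrite mulf_eq0 expf_eq0 oppr_eq0 oner_eq0 andbF /=.
by move: uM; rewrite unitmxE unitfE => /negbTE ->.
Qed.
End LinearRecurrence.

Section LinePolynomials.
Context (F : fieldType) (F_char0 : forall n : nat, (n.+1%:R : F) != 0).

Lemma natr_inj_char0 : injective (fun n : nat => n%:R : F).
Proof.
suff h m n : (m <= n)%N -> m%:R = n%:R :> F -> m = n.
  by move=> m n /= e; have [mn|/ltnW nm] := leqP m n; [exact: h|apply/esym/h].
move=> mn /eqP; rewrite eq_sym -subr_eq0 -natrB//.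
case E : (n - m)%N => [|l]; last by rewrite (negbTE (F_char0 l)).
by move/eqP: E; rewrite subn_eq0 => nm _; apply/eqP; rewrite eqn_leq mn.
Qed.

Lemma poly_natr_eq0 (p : {poly F}) :
  (forall m, exists2 l, (m <= l)%N & p.[l%:R] = 0) -> p = 0.
Proof.
move=> h; apply/eqP; apply: contraT => p0.
have ex m : exists s : seq nat,
    [/\ uniq s, size s = m & forall l, l \in s -> root p l%:R].
  elim: m => [|m [s [us ss rs]]]; first by exists [::].
  have [l ls pl] := h (\max_(j <- s) j).+1; exists (l :: s); split=> /=.
  - rewrite us andbT; apply/negP => lins.
    have : (l <= \max_(j <- s) j)%N by exact: (leq_bigmax_seq l lins isT).
    by rewrite leqNgt ls.
  - by rewrite ss.
  - by move=> j; rewrite inE => /predU1P[->|/rs//]; rewrite /root pl.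
have [s [us ss rs]] := ex (size p).
have := @max_poly_roots _ p [seq l%:R | l <- s] p0.
rewrite size_map ss ltnn => -> //.
  by apply/allP => _ /mapP[l /rs rl ->].
by rewrite map_inj_uniq//; exact: natr_inj_char0.
Qed.

(** Restricted to the line, [q] is a polynomial in one variable with infinitely many natural numbers
    among its roots; these are distinct in characteristic 0. *)
Lemma line_eq0 n (q : mpoly.mpoly n F) (y z : 'I_n -> F) :
  (forall m, exists2 l, (m <= l)%N & mpoly.meval (fun i => y i + l%:R * z i) q = 0) ->
  forall t, mpoly.meval (fun i => y i + t * z i) q = 0.
Proof.
move=> h.
pose p : {poly F} := mpoly.mmap polyC (fun i => (y i)%:P + z i *: 'X) q.
have pE t : p.[t] = mpoly.meval (fun i => y i + t * z i) q.
  rewrite /p /mpoly.mmap horner_sum mpoly.mevalE; apply: eq_bigr => m _.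
  rewrite hornerM hornerC /mpoly.mmap1 horner_prod; congr (_ * _).
  by apply: eq_bigr => i _; rewrite horner_exp !hornerE mulrC.
have p0 : p = 0.
  by apply: poly_natr_eq0 => m; have [l ml hl] := h m; exists l; rewrite ?pE.
by move=> t; rewrite -pE p0 horner0.
Qed.

(** The determinant along the line from 1 to [A] is a polynomial in [t] with value 1 at 0, so it
    cannot vanish at all large integers. *)
Lemma unitmx_line n (A : 'M[F]_n) m :
  exists2 l, (m <= l)%N & 1%:M + l%:R *: (A - 1%:M) \in unitmx.
Proof.
pose p : {poly F} := \det (map_mx polyC 1%:M + 'X *: map_mx polyC (A - 1%:M)).
have pE t : p.[t] = \det (1%:M + t *: (A - 1%:M)).
  rewrite -[LHS]/(horner_eval t p) -det_map_mx; congr (\det _).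
  apply/matrixP => i j; rewrite !mxE -[LHS]/(_.[t]) hornerD hornerM hornerX.
  by rewrite !hornerC.
apply: contrapT => nex; have p0 : p = 0.
  apply: poly_natr_eq0 => m'; exists (maxn m m'); first exact: leq_maxr.
  rewrite pE; apply/eqP; apply: contraT => d0; exfalso; apply: nex.
  by exists (maxn m m'); [exact: leq_maxl|rewrite unitmxE unitfE].
have := pE 0; rewrite p0 horner0 scale0r addr0 det1 => /esym/eqP.
by rewrite oner_eq0.
Qed.
End LinePolynomials.

(** * Prehomogeneity *)

Lemma det_mxX (F : fieldType) n (A : 'M[F]_n) m : \det (A ^+ m) = \det A ^+ m.
Proof.
elim: m => [|m IH]; first by rewrite !expr0 -[1]/(1%:M) det1.
by rewrite !exprS -[A * _]/(A *m _) det_mulmx IH.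
Qed.

Section Prehomogeneous.
Context (R : realType) (k k' : localField R) (E : unramifiedExt k k').
Context (kb : closedFieldType) (ib : {rmorphism k -> kb}).
Local Notation d := (ue_deg E).
Context (N m : nat) (G B P : set 'M[kb]_N) (X : set 'rV[kb]_m).
Context (act : 'M[kb]_N -> 'rV[kb]_m -> 'rV[kb]_m).
Context (rho : 'M[kb]_N -> 'M['M[kb]_d]_2).
Hypothesis X_homogeneous : homogeneous_affine_variety ib G X act.
Hypothesis P_group : matgroup P.
Hypothesis PG : P `<=` G.
Hypothesis B1 : B 1%:M.
Hypothesis BP : B `<=` P.
Hypothesis rhoM : forall p p', P p -> P p' -> rho (p *m p') = rho p *m rho p'.
Hypothesis rho_P : rho @` P = resGL2 ib (E := E) \/ rho @` P = resSL2 ib (E := E).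
Hypothesis B_stabilizer : B_is_stabilizer ib B P rho.

Lemma kb_char0 n : (n.+1%:R : kb) != 0.
Proof.
rewrite -(rmorph_nat ib) fmorph_eq0; have := lf_char0 k.
by move/pcharf0P/(_ n.+1) => ->.
Qed.

(** Along the powers of [g] the entries are linear recurrences and the inverse determinant is a
    geometric sequence; polynomials in these and in the constant [x] remain linear recurrences. *)
Lemma linrec_orbit (q : mpoly.mpoly m kb) g x : P g -> X x ->
  linrec (fun n => bval q (act (g ^+ n) x)).
Proof.
move=> Pg Xx; have [_ _ reg_act [_ _ _ _]] := X_homogeneous.
have [PU P1 PM PV] := P_group.
have ug : g \in unitmx by exact: PU.
have PX n : P (g ^+ n).
  elim: n => [|n IH]; first by rewrite expr0.
  by rewrite exprS; exact: PM.
apply: (@linrec_mmap _ _ idfun _ (fun n j => act (g ^+ n) x 0 j)) => j.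
have [p pE] := reg_act j.
have : linrec (fun n => mpoly.mmap ib (row_mx (GLcrd (g ^+ n)) x 0) p).
  apply: linrec_mmap => i; rewrite -[i](splitK i); case: (fintype.split i) => i' /=.
    apply: (@eq_linrec _ (fun n => GLcrd (g ^+ n) 0 i')) => [n|].
      by rewrite row_mxEl.
    rewrite -[i'](splitK i'); case: (fintype.split i') => l /=.
      case/mxvec_indexP: l => a b.
      apply: eq_linrec (linrec_mxpow a b ug) => n.
      by rewrite /GLcrd row_mxEl mxvecE.
    have dg0 : (\det g)^-1 != 0 by rewrite invr_eq0 -unitfE -unitmxE.
    apply: eq_linrec (linrecX dg0) => n.
    by rewrite /GLcrd row_mxEr mxE det_mxX exprVn.
  apply: eq_linrec (linrec_cst (x 0 i')) => n.
  by rewrite row_mxEr.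
apply: eq_linrec => n; have -> // := pE (g ^+ n, x).
by split=> //=; exact/PG/PX.
Qed.

Definition colV (a c : 'M[kb]_d) : 'cV['M[kb]_d]_2 :=
  \col_i (if i == 0 then a else c).

Lemma colV_eta (v : 'cV['M[kb]_d]_2) : v = colV (v 0 0) (v 1 0).
Proof.
apply/colP => i; rewrite !mxE; case: eqP => [->//|/eqP i0].
by congr (v _ _); apply/val_inj; case: i i0 => [[|[|//]]].
Qed.

Lemma Vcrd_line (a c a' c' : 'M[kb]_d) (t : kb) i :
  Vcrd (E := E) (colV a c) 0 i + t * Vcrd (E := E) (colV a' c') 0 i =
  Vcrd (E := E) (colV (a + t *: a') (c + t *: c')) 0 i.
Proof.
have -> : Vcrd (E := E) (colV (a + t *: a') (c + t *: c')) =
    Vcrd (E := E) (colV a c) + t *: Vcrd (E := E) (colV a' c').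
  by rewrite /Vcrd !mxE /= scale_row_mx add_row_mx !linearD !linearZ.
by rewrite !mxE.
Qed.

Lemma emb_v0 : emb ib E (v0 k') = colV 1%:M 0.
Proof.
apply/colP => i; rewrite !mxE eqxx andbT; case: eqP => _ /=.
  by rewrite reg1 map_mx1.
by rewrite reg0 map_mx0.
Qed.

Lemma mul_colV (A : 'M['M[kb]_d]_2) a c : A *m colV a c =
  colV (A 0 0 *m a + A 0 1 *m c) (A 1 0 *m a + A 1 1 *m c).
Proof.
have l1 : lift ord0 ord0 = 1 :> 'I_2 by apply/val_inj.
apply/colP => i; rewrite !mxE !big_ord_recl big_ord0 !mxE /= addr0 l1.
case: eqP => [->//|/eqP i0].
by have -> : i = 1 by apply/val_inj; case: i i0 => [[|[|//]]].
Qed.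

(** The lower unipotent matrix has determinant 1, so it has a lift whether the image is GL_2 or
    SL_2. Exponents start at 1, which keeps the value of [rho] at the identity out of the
    statement. *)
Lemma rho_lower c : in_res ib (E := E) c -> exists2 p, P p &
  forall n, rho (p ^+ n.+1) *m colV 1%:M 0 = colV 1%:M (n.+1%:R *: c).
Proof.
move=> rc; have [PU P1 PM PV] := P_group.
pose A : 'M['M[kb]_d]_2 := \matrix_(i, j)
  (if i == j then 1%:M else if i == 0 then 0 else c).
have Ares : resM ib (E := E) A.
  move=> i j; rewrite mxE; case: ifP => _; first exact: in_res1.
  by case: ifP => // _; exact: in_res0.
have detA : det2 A = 1%:M by rewrite /det2 !mxE /= !mul1mx mul0mx subr0.
have [p Pp rp] : (rho @` P) A.
  by case: rho_P => ->; split=> //=; rewrite /mkset detA ?unitmx1.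
exists p => //; have PX n : P (p ^+ n).
  elim: n => [|n IH]; first by rewrite expr0.
  by rewrite exprS; exact: PM.
elim=> [|n IH].
  by rewrite expr1 rp mul_colV !mxE /= !mul0mx !mulmx1 !mulmx0 !addr0 scale1r.
rewrite exprS -[p * _]/(p *m _) rhoM// -mulmxA IH rp mul_colV !mxE /=.
rewrite !mul1mx !mulmx1 mul0mx addr0; congr colV.
by rewrite -[in RHS]natr1 scalerDl scale1r addrC.
Qed.

Lemma prehomogeneous_PuV (xu : 'rV[k]_m) :
  @in_open_orbit kb (BX B X act) (map_mx ib xu) ->
  prehomogeneous (PuV ib act P rho xu).
Proof.
set x := map_mx ib xu.
have [PU P1 PM PV] := P_group.
have [_ _ _ [actX act1 actM _]] := X_homogeneous.
move=> [Xx [I IE]]; exists (emb ib E (v0 k')) => [i j|q q0].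
  by rewrite mxE; exact: in_res_reg.
have xx : orbit_of (A := BX B X act) x x.
  by exists 1%:M; split=> /=; rewrite ?act1.
(* [I] cuts out the complement of the open orbit; since [x] is not in that complement, some equation
   [h] of it fails at [x]. *)
have [h Ih hx] : exists2 h, I h & bval h x != 0.
  apply: contrapT => nex.
  have : (X `\` orbit_of (A := BX B X act) x) x.
    rewrite /= in IE; rewrite IE; split=> // p Ip; apply/eqP.
    by apply: contraT => px; exfalso; apply: nex; exists p.
  by case=> _; apply.
have horb y : X y -> bval h y != 0 -> orbit_of (A := BX B X act) x y.
  move=> Xy hy; apply: contrapT => ny.
  have : (X `\` orbit_of (A := BX B X act) x) y by split.
  rewrite /= in IE; rewrite IE => -[_ /(_ h Ih) h0].
  by rewrite h0 eqxx in hy.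
have qorb c s : in_res ib (E := E) c -> in_res ib (E := E) s -> s \in unitmx -> forall n,
    exists2 l, (n <= l)%N & bval q (Vcrd (E := E) (colV s (l%:R *: (c *m s)))) = 0.
  move=> rc rs us n; have [p Pp pP] := rho_lower rc.
  have up : p \in unitmx by exact: PU.
  (* The recurrence does not vanish at exponent 0, where its value is [h] at [x]. The strict
     inequality makes [l] positive, as [rho_lower] demands. *)
  have [l ln hl] : exists2 l, (n < l)%N & bval h (act (invmx p ^+ l) x) != 0.
    apply: contrapT => nex.
    have := linrec_eq0 (linrec_orbit h (PV _ Pp) Xx) (m := n.+1) _.
    rewrite expr0 -[1]/(1%:M) act1// => h0; move/eqP: hx; apply.
    apply: h0 => l nl; apply/eqP; apply: contraT => hl; exfalso.
    by apply: nex; exists l.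
  have PX g j : P g -> P (g ^+ j).
    move=> Pg; elim: j => [|j IH]; first by rewrite expr0.
    by rewrite exprS; exact: PM.
  have [b [Bb /= hb]] := horb _ (actX _ _ (PG (PX _ l (PV _ Pp))) Xx) hl.
  have Pb := BP Bb.
  have stb : [/\ P b, resGL1 ib (E := E) (rho b 0 0) & actV rho (b, rho b 0 0)
     (emb ib E (v0 k')) = emb ib E (v0 k')] by apply/(B_stabilizer b (rho b 0 0)).
  have P_inv : (invmx p) ^+ l *m p ^+ l = 1%:M /\ p ^+ l *m (invmx p) ^+ l = 1%:M.
    have cpi : GRing.comm (invmx p) p.
      by rewrite /GRing.comm -[LHS]/(_ *m _) -[RHS]/(_ *m _) mulVmx ?mulmxV.
    split; rewrite -[_ *m _]/(_ * _).
      by rewrite -exprMn_comm// -[invmx p * p]/(_ *m _) mulVmx// expr1n.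
    rewrite -exprMn_comm; last exact: commr_sym.
    by rewrite -[p * _]/(_ *m _) mulmxV// expr1n.
  (* [b x = p^-l x], so [p^l b] stabilizes [x]. *)
  have st_g : act (p ^+ l *m b) x = x.
    rewrite actM//; try exact/PG/PX; try exact/PG.
    rewrite -hb -actM//; try exact/PG/PX; last exact/PG/PX/PV.
    by rewrite P_inv.2 act1.
  (* [rho b] multiplies [v0] by its upper left entry; dividing by [t] cancels this factor and scales
     by [s]. The image of [v0] is therefore [(s, l c s)]. *)
  pose t := invmx (invmx (rho b 0 0) *m s).
  have [rb ub] : resGL1 ib (E := E) (rho b 0 0) by have [] := stb.
  have ut : invmx (rho b 0 0) *m s \in unitmx by rewrite unitmx_mul unitmx_inv ub.
  have Gt : resGL1 ib (E := E) t.
    split; last by rewrite unitmx_inv.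
    by apply: in_res_invmx => //; apply: in_resM => //; exact: in_res_invmx.
  exists l; first exact: ltnW.
  have := q0 (colV s (l%:R *: (c *m s))); apply.
  exists (p ^+ l *m b, t); split.
    by split=> //; split=> //; apply: PM => //; exact: PX.
  have [_ _ sb] := stb.
  rewrite /= /actV /= rhoM//; last exact: PX.
  rewrite -mulmxA /t invmxK.
  set y := emb ib E (v0 k') in sb *.
  have yE : map_mx (fun z => z *m invmx (rho b 0 0)) (rho b *m y) = y by exact: sb.
  have e1 : map_mx (fun z => z *m (invmx (rho b 0 0) *m s)) (rho (p ^+ l) *m (rho b *m y))
    = map_mx (fun z => z *m s) (rho (p ^+ l) *m y).
    apply/matrixP => i j; rewrite -[in RHS]yE !mxE !mulmx_suml.
    apply: eq_bigr => r _; rewrite !mxE.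
    exact: (etrans (mulmxA _ _ _) (congr1 (mulmx^~ s) (esym (mulmxA _ _ _)))).
  rewrite [RHS]e1 /y emb_v0; case: l ln {hl hb P_inv st_g e1} => // l ln.
  rewrite pP; apply/matrixP => i j; rewrite !mxE.
  by case: ifP => _; rewrite ?mul1mx// -scalemxAl.
(* Applied to [c s^-1], the previous claim puts infinitely many points [(s, l c)] among the zeros of
   [q]; on this line [q] vanishes identically, in particular at [(s, c)]. *)
have qunit c s : in_res ib (E := E) c -> in_res ib (E := E) s -> s \in unitmx ->
    bval q (Vcrd (E := E) (colV s c)) = 0.
  move=> rc rs us; have rc' : in_res ib (E := E) (c *m invmx s).
    by apply: in_resM => //; exact: in_res_invmx.
  pose y := Vcrd (E := E) (colV s 0); pose z := Vcrd (E := E) (colV 0 c).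
  have lineE t : (fun i => y 0 i + t * z 0 i) =1 Vcrd (E := E) (colV s (t *: c)) 0.
    by move=> i; rewrite /y /z Vcrd_line scaler0 addr0 add0r.
  have := line_eq0 kb_char0 (q := q) (y := y 0) (z := z 0) _ 1.
  rewrite (mpoly.meval_eq _ (lineE 1)) scale1r; apply => n.
  have [l nl ql] := qorb _ s rc' rs us n; exists l => //.
  by rewrite (mpoly.meval_eq _ (lineE _)); rewrite mulmxKV in ql.
move=> v rv; rewrite /= (colV_eta v).
set a := v 0 0; set c := v 1 0.
(* A general [(a, c)] lies on the line from [(1, c)] in the direction [(a - 1, 0)], which meets the
   invertible first coordinates at infinitely many integers. *)
pose y := Vcrd (E := E) (colV 1%:M c); pose z := Vcrd (E := E) (colV (a - 1%:M) 0).
have lineE t : (fun i => y 0 i + t * z 0 i) =1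
    Vcrd (E := E) (colV (1%:M + t *: (a - 1%:M)) c) 0.
  by move=> i; rewrite /y /z Vcrd_line scaler0 addr0.
have := line_eq0 kb_char0 (q := q) (y := y 0) (z := z 0) _ 1.
rewrite (mpoly.meval_eq _ (lineE 1)) scale1r addrC subrK; apply => n.
have [l nl ul] := unitmx_line kb_char0 a n; exists l => //.
rewrite (mpoly.meval_eq _ (lineE _)); apply: qunit => //; first exact: rv.
apply: in_resD; first exact: in_res1.
apply/in_resZ/in_resD; first exact: rv.
by rewrite -scaleN1r; apply/in_resZ/in_res1.
Qed.
End Prehomogeneous.

(** * Measure-preserving maps and rational functions *)

Section MeasurePreserving.
Context (R : realType) (k : localField R) (a b : nat).
Local Notation M := 'M[k]_(a, b).

Lemma preserves_balls (m : {measure set (borel M) -> \bar R}) (g : M -> M) :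
  continuous g ->
  (forall (x : M) e, m (g @^-1` ball x e) = m (ball x e)) ->
  (forall (x : M) e, (m (ball x e) < +oo)%E) ->
  forall A : set (borel M), measurable A -> m (g @^-1` A) = m A.
Proof.
move=> cg gball mfin A mA.
have mg := measurable_mx_cvg cg.
pose m' : {measure set (borel M) -> \bar R} := pushforward m (g : borel M -> borel M).
have m'E (x : M) e : m' mg (ball x e) = m (ball x e) by exact: gball.
have h := @measure_balls_unique _ _ _ _ (m' mg) m m'E _ _ mA.
by apply: h => x e; rewrite m'E.
Qed.
End MeasurePreserving.

Section RationalFunctions.
Context (R : realType).
Local Notation C := (complex.complex R).

Section Scaling.
Context (n : nat) (f : ratfun R n) (c : C) (c0 : c != 0).

Lemma scale_den_neq0 : mpoly.mpolyC n c * rf_den f != 0.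
Proof. by rewrite mulf_neq0 ?rf_den_neq0// mpoly.mpolyC_eq0. Qed.

Definition scale_num : ratfun R n :=
  RatFun (mpoly.mpolyC n c * rf_num f) (rf_den_neq0 f).
(** This is [f / c]: the constant goes into the denominator. *)
Definition scale_den : ratfun R n := RatFun (rf_num f) scale_den_neq0.
End Scaling.

Lemma continuation_value_scale q n (I I' : 'rV[C]_n -> C) c s z :
  (forall s, Re_nonneg s -> I' s = c * I s) ->
  continuation_value q I s z -> continuation_value q I' s (c * z).
Proof.
move=> II' [f [fI fd ->]]; exists (scale_num f c); split=> //.
  by move=> t t0; rewrite /= mpoly.mevalM mpoly.mevalC fI// II'// mulrCA.
by rewrite /rf_value /= mpoly.mevalM mpoly.mevalC mulrA.
Qed.

Lemma continued_by_scale q n (I I' : 'rV[C]_n -> C) c : c != 0 ->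
  (forall s, Re_nonneg s -> I' s = c * I s) ->
  (exists f, continued_by q I' f) -> exists f, continued_by q I f.
Proof.
move=> c0 II' [f fI']; exists (scale_den f c0) => s s0 /=.
by rewrite mpoly.mevalM mpoly.mevalC fI'// II'// mulrCA mulrA.
Qed.
End RationalFunctions.

Section FiniteExtension.
Context (R : realType) (k k' : localField R) (E : unramifiedExt k k').

(** The coordinates of the image of [c] are [c] times those of 1, and the latter are integral
    because 1 is. *)
Lemma ue_inj_le1 (c : k) : absv c <= 1 -> absv (ue_inj E c) <= 1.
Proof.
move=> c1; apply/(ue_integral E) => l.
rewrite -[ue_inj E c]mulr1 ue_coordZ mxE absvM -[leRHS]mulr1.
apply: ler_pM => //; try exact: absv_ge0.
by move: l; apply/(ue_integral E); rewrite absv1.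
Qed.

(** A difference smaller than [|p^n|] is [p^n] times an integer, integers go to integers, and the
    image of [p] has absolute value [1/q'] because the extension is unramified. *)
Lemma ue_inj_cvg T (F : set_system T) {FF : Filter F} (f : T -> k) (l : k) :
  f @ F --> l -> (fun t => ue_inj E (f t)) @ F --> ue_inj E l.
Proof.
move=> /lf_cvgP fl; apply/lf_cvgP => e e0.
have [p [p1 _]] := lf_uniformizer k.
have p0 : p != 0 by rewrite -absv_eq0 p1 invr_eq0 gt_eqF// lf_card_gt0R.
have [n ne] := lf_small k' e0.
have pn0 : 0 < absv (p ^+ n) by rewrite lt_def absv_eq0 expf_neq0// absv_ge0.
apply: filterS (fl _ pn0) => t ft.
rewrite -rmorphB -[l - f t](mulfVK (expf_neq0 n p0)) rmorphM absvM.
rewrite rmorphXn absvX (ue_unramified E p1) exprVn.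
apply: le_lt_trans ne; rewrite -[leRHS]mul1r ler_wpM2r ?invr_ge0 ?exprn_ge0//.
by apply: ue_inj_le1; rewrite absvM absvV ler_pdivrMr// mul1r ltW.
Qed.

Lemma emb_inj (kb : closedFieldType) (ib : {rmorphism k -> kb}) r c :
  injective (@emb _ _ kb ib k' E r c).
Proof.
move=> A A' /matrixP h; apply/matrixP => i j; have := h i j.
by rewrite !mxE => /map_mx_inj_eq/reg_inj.
Qed.

Lemma emb_mulmx (kb : closedFieldType) (ib : {rmorphism k -> kb}) r c s
    (A : 'M[k']_(r, c)) (A' : 'M[k']_(c, s)) :
  emb ib E (A *m A') = emb ib E A *m emb ib E A'.
Proof.
apply/matrixP => i j; rewrite !mxE.
rewrite (big_morph _ (regD E) (reg0 E)) map_mx_sum; apply: eq_bigr => l _.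
by rewrite !mxE mulrC -regM map_mxM.
Qed.

Lemma Vcrd_emb (kb : closedFieldType) (ib : {rmorphism k -> kb}) (v : 'cV[k']_2) :
  Vcrd (emb ib E v) = map_mx ib (Vcrd (map_mx (reg E) v)).
Proof. by rewrite /Vcrd !mxE map_row_mx !map_mxvec. Qed.
End FiniteExtension.

(** * Rational points *)

Section RationalPoints.
Context (R : realType) (k : localField R) (kb : closedFieldType).
Context (ib : {rmorphism k -> kb}) (N m : nat).
Implicit Types (g h : 'M[k]_N) (x y : 'rV[k]_m).

(** The action on rational points written with polynomials over [k], a form in which continuity for
    the absolute value makes sense. *)
Definition polact (p : 'I_m -> mpoly.mpoly (N * N + 1 + m) k) g x : 'rV[k]_m :=
  \row_j mpoly.meval (row_mx (GLcrd g) x 0) (p j).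

Lemma polact_cvgl p g x : g \in unitmx -> (fun h => polact p h x) @ g --> polact p g x.
Proof.
rewrite unitmxE unitfE => dg; apply: (@mx_cvgP _ _ _ (nbhs g)) => i j.
rewrite mxE; under eq_fun do rewrite mxE.
apply: (@lf_cvg_meval _ _ _ (nbhs g) _ _ (fun h => row_mx (GLcrd h) x 0)).
apply: (@lf_cvg_row_mx _ _ _ (nbhs g) _ _ (fun h => GLcrd h) (fun=> x)) => l;
  last exact: cvg_cst.
apply: (@lf_cvg_GLcrd _ _ _ (nbhs g) _ _ id g dg) => a b; exact: entry_cvg.
Qed.

Lemma polact_cvgr p g x : polact p g @ x --> polact p g x.
Proof.
apply: (@mx_cvgP _ _ _ (nbhs x)) => i j; rewrite mxE.
rewrite /polact; under eq_fun do rewrite mxE.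
apply: (@lf_cvg_meval _ _ _ (nbhs x) _ _ (fun y => row_mx (GLcrd g) y 0)).
apply: (@lf_cvg_row_mx _ _ _ (nbhs x) _ _ (fun=> GLcrd g) id) => l.
  exact: cvg_cst.
exact: entry_cvg.
Qed.

Lemma Xk_closed (X : set 'rV[kb]_m) : kclosed ib id setT X -> closed (Xk ib X).
Proof.
move=> [I XE]; rewrite -[Xk ib X]setCK; apply: open_closedC; rewrite openE => x nXx.
have [p [Ip px]] : exists p, I p /\ mpoly.meval (x 0) p != 0.
  apply: contrapT => nex; apply: nXx; rewrite /Xk /kpts /mkset XE; split=> // p Ip.
  rewrite kval_map; apply/eqP; rewrite fmorph_eq0; apply: contraT => px.
  by exfalso; apply: nex; exists p.
have px0 : 0 < absv (mpoly.meval (x 0) p) by rewrite lt_def absv_eq0 px absv_ge0.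
have /lf_cvgP/(_ _ px0) : (fun y => mpoly.meval (y 0) p) @ x --> mpoly.meval (x 0) p.
  by apply: (lf_cvg_meval (FF := nbhs_filter _)) => i; exact: entry_cvg.
apply: filterS => y hy Xy; move: Xy; rewrite /Xk /kpts /mkset XE => -[_ /(_ p Ip)].
rewrite kval_map => /eqP; rewrite fmorph_eq0 => /eqP y0.
by move: hy; rewrite y0 subr0 ltxx.
Qed.

Lemma kpts_group (H : set 'M[kb]_N) : matgroup H -> matgroup (kpts ib H).
Proof.
move=> [HU H1 HM HV]; split.
- by move=> g /HU /=; rewrite map_unitmx.
- by rewrite /kpts /mkset map_mx1.
- by move=> g h; rewrite /kpts /mkset map_mxM; exact: HM.
- by move=> g; rewrite /kpts /mkset map_invmx; exact: HV.
Qed.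

(** An equation over [k] that fails at [g] fails nearby. The point is taken invertible because the
    coordinate [1 / det] is continuous only there. *)
Lemma kpts_open_compl (H : set 'M[kb]_N) :
  kclosed ib (@GLcrd kb N) (GLN (N := N)) H ->
  forall g, g \in unitmx -> ~ kpts ib H g -> \forall h \near g, ~ kpts ib H h.
Proof.
move=> [I HE] g ug nHg.
have [p [Ip px]] : exists p, I p /\ mpoly.meval (GLcrd g 0) p != 0.
  apply: contrapT => nex; apply: nHg; rewrite /kpts /mkset HE; split.
    by rewrite /GLN /mkset map_unitmx.
  move=> p Ip; rewrite map_GLcrd kval_map; apply/eqP; rewrite fmorph_eq0.
  by apply: contraT => px; exfalso; apply: nex; exists p.
have px0 : 0 < absv (mpoly.meval (GLcrd g 0) p).
  by rewrite lt_def absv_eq0 px absv_ge0.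
have dg : \det g != 0 by rewrite -unitfE -unitmxE.
have /lf_cvgP/(_ _ px0) : (fun h => mpoly.meval (GLcrd h 0) p) @ g -->
    mpoly.meval (GLcrd g 0) p.
  apply: (lf_cvg_meval (FF := nbhs_filter _)) => i.
  by apply: (@lf_cvg_GLcrd _ _ _ (nbhs g) _ _ id g dg) => a b; exact: entry_cvg.
apply: filterS => h hh Hh; move: Hh; rewrite /kpts /mkset HE => -[_ /(_ p Ip)].
rewrite map_GLcrd kval_map => /eqP; rewrite fmorph_eq0 => /eqP y0.
by move: hh; rewrite y0 subr0 ltxx.
Qed.

Section Orbits.
Context (G B : set 'M[kb]_N) (X : set 'rV[kb]_m).
Context (act : 'M[kb]_N -> 'rV[kb]_m -> 'rV[kb]_m).
Hypothesis X_homogeneous : homogeneous_affine_variety ib G X act.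
Hypothesis BG : B `<=` G.
Hypothesis B_kgroup : k_group ib B.

Lemma act_rational : exists p, forall g x, G (map_mx ib g) -> X (map_mx ib x) ->
  act (map_mx ib g) (map_mx ib x) = map_mx ib (polact p g x).
Proof.
have [_ _ /choice[p pP] _] := X_homogeneous; exists p => g x Gg Xx.
apply/rowP => j; rewrite (pP j (map_mx ib g, map_mx ib x))//.
by rewrite /paircrd /= map_GLcrd -map_row_mx kval_map !mxE.
Qed.

Lemma orbit_neighborhood (J : finType) (Xu : J -> set 'rV[k]_m) u x (e : R) :
  orbit_decomposition ib B X act Xu -> Xu u x -> 0 < e ->
  exists2 s : R, 0 < s & forall y, Xk ib X y -> ball x s y -> exists g,
    [/\ kpts ib B g, ball (1%:M : 'M[k]_N) e g, ball (1%:M : 'M[k]_N) e (invmx g) &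
        map_mx ib y = act (map_mx ib g) (map_mx ib x)].
Proof.
move=> [orb op _] Xux e0.
have [Bgrp Bcl] := B_kgroup; have [BU B1 BM BV] := Bgrp.
have [Xcl _ _ [actX act1 actM _]] := X_homogeneous.
have [p pP] := act_rational.
have [x' [Xx' _] Xu'] := orb u.
have [W oW XuW] := op u.
have XWx : (Xk ib X `&` W) x by rewrite -XuW.
have [Xx Wx] := XWx.
have /nbhs_ballP[r r0 rW] : nbhs x W by apply: open_nbhs_nbhs.
(* The orbit is given through some base point [x']; [b0] rewrites it as the orbit of [x]. *)
have [b0 [_ [Bb0 -> xE]]] : ksat ib act B [set x'] x by rewrite -Xu'.
have Bb0V : B (invmx (map_mx ib b0)) by exact: BV.
have x'E : map_mx ib x' = act (invmx (map_mx ib b0)) (map_mx ib x).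
  rewrite xE -actM//; try exact: BG.
  by rewrite mulVmx ?act1//; exact: BU.
have aB g z : kpts ib B g -> Xk ib X z -> act (map_mx ib g) (map_mx ib z) =
    map_mx ib (polact p g z) by move=> Bg Xz; apply: pP => //; exact: BG.
have Xa g z : kpts ib B g -> Xk ib X z -> Xk ib X (polact p g z).
  by move=> Bg Xz; rewrite /Xk /kpts /mkset -aB//; apply: actX => //; exact: BG.
(* The ambient closed set is all of X(k): [Xu u] is merely open in it, but the theorem only asks
   that a ball of X(k) around [x] lie in the orbit. *)
have [] := @open_orbit_map R k N m (kpts ib B) (Xk ib X) (polact p)
  (kpts_group Bgrp) (kpts_open_compl Bcl) (Xk_closed Xcl) Xa _ _ _ _ x r e Xx r0 e0.
- move=> z Xz; apply: (@map_mx_inj_eq _ _ ib); rewrite -aB ?map_mx1 ?act1//.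
  by rewrite /kpts /mkset map_mx1.
- move=> g h z Bg Bh Xz; apply: (@map_mx_inj_eq _ _ ib).
  rewrite -aB//; last by rewrite /kpts /mkset map_mxM; exact: BM.
  by rewrite map_mxM actM ?aB//; try exact: BG; exact: Xa.
- by move=> g z Bg _; apply: polact_cvgl; move/BU: Bg => /=; rewrite map_unitmx.
- by move=> g z _ _; exact: polact_cvgr.
- move=> y [Xy xy]; have : Xu u y by rewrite XuW; split=> //; exact: rW.
  rewrite Xu' => -[b [_ [Bb -> yE]]].
  have Bbb : kpts ib B (b *m invmx b0).
    by rewrite /kpts /mkset map_mxM map_invmx; exact: BM.
  exists (b *m invmx b0) => //; apply: (@map_mx_inj_eq _ _ ib).
  by rewrite -aB// map_mxM map_invmx actM// -?x'E//; exact: BG.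
- move=> s s0 sP; exists s => // y Xy xy; have [g [Bg g1 g2 yE]] := sP y Xy xy.
  by exists g; split=> //; rewrite aB// yE.
Qed.
Lemma Xu_in_open_orbit (J : finType) (Xu : J -> set 'rV[k]_m) u x :
  orbit_decomposition ib B X act Xu -> Xu u x ->
  @in_open_orbit kb (BX B X act) (map_mx ib x).
Proof.
move=> [orb _ _] Xux; have [x' [Xx' cl] Xu'] := orb u.
have [BU B1 BM BV] := B_kgroup.1.
have [_ _ _ [actX act1 actM _]] := X_homogeneous.
have [b [_ [Bb -> xE]]] : ksat ib act B [set x'] x by rewrite -Xu'.
have orbE : orbit_of (A := BX B X act) (map_mx ib x) =
    orbit_of (A := BX B X act) (map_mx ib x').
  apply/seteqP; split=> z [c [/= Bc ->]].
    exists (c *m map_mx ib b); split; first exact: BM.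
    by rewrite /= xE actM//; exact: BG.
  exists (c *m invmx (map_mx ib b)); split; first by apply: BM => //; exact: BV.
  rewrite /= xE -actM//; last exact: BG.
    by rewrite mulmxKV//; exact: BU.
  by apply/BG/BM => //; exact: BV.
split; first by rewrite /= xE; apply: actX => //; exact: BG.
by rewrite orbE.
Qed.
End Orbits.
End RationalPoints.

Section RationalRepresentation.
Context (R : realType) (k k' : localField R) (E : unramifiedExt k k').
Context (kb : closedFieldType) (ib : {rmorphism k -> kb}) (N : nat).
Local Notation d := (ue_deg E).
Context (P : set 'M[kb]_N) (rho : 'M[kb]_N -> 'M['M[kb]_d]_2).
Hypothesis P_group : matgroup P.
Hypothesis rho_regular : forall i j a b,
  regular_on ib (@GLcrd kb N) P (fun p => rho p i j a b).
Hypothesis rhoM : forall p p', P p -> P p' -> rho (p *m p') = rho p *m rho p'.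
Hypothesis rho_P : rho @` P = resGL2 ib (E := E) \/ rho @` P = resSL2 ib (E := E).

Lemma rho_res p : P p -> resM ib (E := E) (rho p).
Proof.
move=> Pp; have : (rho @` P) (rho p) by exists p.
by case: rho_P => -> [].
Qed.

(** Some [p] maps to the identity matrix, and [rho 1] times its image is its image. *)
Lemma rho1 : rho 1%:M = emb ib E 1%:M.
Proof.
have [PU P1 PM PV] := P_group.
have [p Pp rp] : (rho @` P) (emb ib E 1%:M).
  have h : det2 (emb ib E 1%:M : 'M['M[kb]_d]_2) = 1%:M.
    by rewrite /det2 !mxE /= reg1 reg0 map_mx1 map_mx0 !mul1mx mul0mx subr0.
  have r : resM ib (E := E) (emb ib E (1%:M : 'M[k']_2)).
    by move=> i j; rewrite mxE; exact: in_res_reg.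
  by case: rho_P => ->; split=> //=; rewrite /mkset h ?unitmx1.
have := rhoM P1 Pp; rewrite mul1mx rp => h.
have id2 (A : 'M['M[kb]_d]_2) : A *m emb ib E 1%:M = A.
  apply/matrixP => i j; rewrite mxE (bigD1 j)//= big1 => [|l lj].
    by rewrite !mxE eqxx reg1 map_mx1 addr0; exact: mulmx1.
  by rewrite !mxE (negbTE lj) reg0 map_mx0; exact: mulmx0.
by rewrite -[LHS]id2 -h.
Qed.

(** An entry of [rho] at a rational point is a matrix over [k] lying in the span of [reg k'] over
    [kb]. Its coordinates, read off at 1, are then in [k], so the entry comes from a single element
    of [k']. *)
Lemma rho_rational : exists A : 'M[k]_N -> 'M[k']_2,
  (forall b, kpts ib P b -> rho (map_mx ib b) = emb ib E (A b)) /\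
  (fun b => A b) @ (1%:M : 'M[k]_N) --> (1%:M : 'M[k']_2).
Proof.
have [PU P1 PM PV] := P_group.
have /choice[r rP] (t : ('I_2 * 'I_2) * ('I_d * 'I_d)) :=
  rho_regular t.1.1 t.1.2 t.2.1 t.2.2.
pose Y b i j : 'M[k]_d := \matrix_(a, l) mpoly.meval (GLcrd b 0) (r ((i, j), (a, l))).
have YE b i j : kpts ib P b -> rho (map_mx ib b) i j = map_mx ib (Y b i j).
  move=> Pb; apply/matrixP => a l; rewrite (rP ((i, j), (a, l)) (map_mx ib b))//.
  by rewrite map_GLcrd kval_map !mxE.
pose A b : 'M[k']_2 := \matrix_(i, j)
  \sum_l ue_inj E ((ue_coord E 1 *m Y b i j) 0 l) * ue_basis E l.
have AE b : kpts ib P b -> rho (map_mx ib b) = emb ib E (A b).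
  move=> Pb; apply/matrixP => i j; rewrite mxE YE// mxE -res_mx_map.
  by rewrite map_mxM; apply: in_resP; rewrite -YE//; exact: rho_res.
have A1 : A 1%:M = 1%:M.
  apply: (@emb_inj _ _ _ E _ ib); rewrite -AE ?map_mx1 ?rho1//.
  by rewrite /kpts /mkset map_mx1.
exists A; split=> //; rewrite -A1.
apply: (@mx_cvgP _ _ _ (nbhs (1%:M : 'M[k]_N))) => i j.
rewrite mxE; under eq_fun do rewrite mxE.
apply: (lf_cvg_sum (FF := nbhs_filter _)) => l _.
apply: (lf_cvgM (FF := nbhs_filter _)); last exact: cvg_cst.
apply: (ue_inj_cvg _ (FF := nbhs_filter _)).
apply: (@lf_cvg_mulmx _ _ _ (nbhs (1%:M : 'M[k]_N)) _ _ _ _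
  (fun=> ue_coord E 1) _ (fun b => Y b i j)) => a c.
  exact: cvg_cst.
rewrite /Y mxE; under eq_fun do rewrite mxE.
apply: (lf_cvg_meval (FF := nbhs_filter _)) => t.
apply: (@lf_cvg_GLcrd _ _ _ (nbhs (1%:M : 'M[k]_N)) _ _ id 1%:M) => [|a' b'].
  by rewrite det1 oner_eq0.
exact: entry_cvg.
Qed.
End RationalRepresentation.

(** * Reduction to the fiber *)

Section FiberReduction.
Context (R : realType) (k k' : localField R) (E : unramifiedExt k k').
Context (kb : closedFieldType) (ib : {rmorphism k -> kb}).
Local Notation d := (ue_deg E).
Local Notation C := (complex.complex R).
Local Notation V := 'cV[k']_2.
Context (N m : nat) (G B P : set 'M[kb]_N) (X : set 'rV[kb]_m).
Context (act : 'M[kb]_N -> 'rV[kb]_m -> 'rV[kb]_m).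
Context (rho : 'M[kb]_N -> 'M['M[kb]_d]_2).
Hypothesis X_homogeneous : homogeneous_affine_variety ib G X act.
Hypothesis PG : P `<=` G.
Hypothesis BP : B `<=` P.
Hypothesis B_kgroup : k_group ib B.
Hypothesis P_group : matgroup P.
Hypothesis rho_regular : forall i j a b,
  regular_on ib (@GLcrd kb N) P (fun p => rho p i j a b).
Hypothesis rhoM : forall p p', P p -> P p' -> rho (p *m p') = rho p *m rho p'.
Hypothesis rho_P : rho @` P = resGL2 ib (E := E) \/ rho @` P = resSL2 ib (E := E).
Context (J : finType) (Xu : J -> set 'rV[k]_m).
Hypothesis Xu_orbits : orbit_decomposition ib B X act Xu.
Context (n : nat) (tf : 'I_n -> mpoly.mpoly (m + (d * d + d * d)) k).
Context (tpsi : 'I_n -> mpoly.mpoly ((N * N + 1) + (d * d + 1)) k).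
Hypothesis tf_basic : basic_regular ib (PXV ib X act P rho) tf tpsi.

Lemma map_mulmxr r (A : 'M['M[kb]_d]_(r, 2)) (v : 'cV['M[kb]_d]_2) (z : 'M[kb]_d) :
  map_mx (fun y => y *m z) (A *m v) = A *m map_mx (fun y => y *m z) v.
Proof.
apply/matrixP => i j; rewrite !mxE mulmx_suml; apply: eq_bigr => l _.
by rewrite !mxE; exact: (esym (mulmxA _ _ _)).
Qed.

Lemma XVu_translate j (b : 'M[k]_N) (A : 'M[k']_2) x y v : kpts ib P b ->
  rho (map_mx ib b) = emb ib E A ->
  map_mx ib y = act (map_mx ib b) (map_mx ib x) ->
  XVu ib act P rho Xu j (x, v) -> XVu ib act P rho Xu j (y, A *m v).
Proof.
have [_ op _] := Xu_orbits; have [W _ XuE] := op j.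
have [_ _ _ [_ _ actM _]] := X_homogeneous.
have [PU P1 PM PV] := P_group.
move=> Pb bA yE [p [t [xw [Pp t0 Sxw [xE vE]]]]].
exists (b *m p), t, xw; split=> //; first by rewrite /kpts /mkset map_mxM; exact: PM.
have Xx : X (map_mx ib xw.1) by case: Sxw; rewrite XuE => -[].
rewrite /= yE xE emb_mulmx vE /actXV /actV /= map_mxM.
rewrite actM ?rhoM//; try exact: PG.
by rewrite -mulmxA !map_mulmxr -bA.
Qed.

Lemma tpsi_near1 : \forall b \near (1%:M : 'M[k]_N), forall i,
  absv (mpoly.meval (row_mx (GLcrd b) (GLcrd (1%:M : 'M[k]_d)) 0) (tpsi i)) = 1.
Proof.
have [PU P1 PM PV] := P_group.
have FF : Filter (nbhs (1%:M : 'M[k]_N)) by exact: nbhs_filter.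
have h i : \forall b \near (1%:M : 'M[k]_N), absv (mpoly.meval
    (row_mx (GLcrd b) (GLcrd (1%:M : 'M[k]_d)) 0) (tpsi i)) = 1; last first.
  exact: (filter_forall FF h).
pose t b := mpoly.meval (row_mx (GLcrd b) (GLcrd (1%:M : 'M[k]_d)) 0) (tpsi i).
(* The value of a character at the identity is nonzero and equal to its square. *)
have t1 : t 1%:M = 1.
  have [[/(_ i) [[_ chi0 chiM] _] _] _] := tf_basic.
  pose o : 'M[kb]_N * 'M[kb]_d := (1%:M, 1%:M).
  have Ho : (P `*` resGL1 ib (E := E)) o.
    by split=> //; split; [exact: in_res1|rewrite unitmx1].
  have := chiM _ _ Ho Ho; have := chi0 _ Ho.
  rewrite /= /pairmul /= !mulmx1 /paircrd /= -!(map_mx1 ib) !map_GLcrd.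
  rewrite -map_row_mx kval_map -/(t _) -rmorphM fmorph_eq0 => t0 /fmorph_inj tt.
  by apply: (mulfI t0); rewrite mulr1 -tt.
have : (fun b => t b) @ (1%:M : 'M[k]_N) --> t 1%:M.
  apply: (lf_cvg_meval (FF := nbhs_filter _)).
  apply: (@lf_cvg_row_mx _ _ _ (nbhs (1%:M : 'M[k]_N)) _ _ (fun h => GLcrd h)
    (fun=> GLcrd 1%:M)) => l; last exact: cvg_cst.
  apply: (@lf_cvg_GLcrd _ _ _ (nbhs (1%:M : 'M[k]_N)) _ _ id 1%:M) => [|a' b'].
    by rewrite det1 oner_eq0.
  exact: entry_cvg.
rewrite t1 => /lf_cvgP/(_ 1 ltr01); apply: filterS => b hb.
by rewrite (@absv_isosceles _ _ _ 1) absv1// absvBC.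
Qed.

(** Translation by [b] gives one implication between the orbit conditions; [back] is the other one,
    which comes from the inverse of [b]. *)
Lemma tf_pow_translate j (s : 'rV[C]_n) (b : 'M[k]_N) (A : 'M[k']_2) x y v :
  kpts ib P b -> rho (map_mx ib b) = emb ib E A -> Xk ib X x ->
  map_mx ib y = act (map_mx ib b) (map_mx ib x) ->
  (forall i, absv (mpoly.meval
     (row_mx (GLcrd b) (GLcrd (1%:M : 'M[k]_d)) 0) (tpsi i)) = 1) ->
  (XVu ib act P rho Xu j (y, A *m v) -> XVu ib act P rho Xu j (x, v)) ->
  tf_pow ib act P rho Xu tf j s (y, A *m v) = tf_pow ib act P rho Xu tf j s (x, v).
Proof.
move=> Pb bA Xx yE b1 back; rewrite /tf_pow.
have -> : `[< XVu ib act P rho Xu j (y, A *m v) >] = `[< XVu ib act P rho Xu j (x, v) >].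
  by apply: asbool_equiv_eq; split=> //; exact: (XVu_translate Pb bA yE).
case: asboolP => [_|_]; last by [].
apply: eq_bigr => i _; congr cpow.
have [_ /(_ i) [_ _ _ _ /(_ (map_mx ib b, 1%:M) (map_mx ib x, emb ib E v))]] := tf_basic.
rewrite /= !mulr1 /paircrd /= !Vcrd_emb -!map_row_mx kval_map.
rewrite -(map_mx1 ib) !map_GLcrd -map_row_mx kval_map.
have e1 : actV rho (map_mx ib b, map_mx ib 1%:M) (emb ib E v) = emb ib E (A *m v).
  rewrite /actV /= map_mx1 map_mulmxr bA emb_mulmx; congr (_ *m _).
  by apply/matrixP => p r; rewrite mxE invmx1 mulmx1.
rewrite e1 -yE Vcrd_emb -map_row_mx kval_map -rmorphM => h.
have Pb1 : (P `*` resGL1 ib (E := E)) (map_mx ib b, map_mx ib 1%:M).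
  by split=> //; rewrite map_mx1; split; [exact: in_res1|rewrite unitmx1].
have Xv : X (map_mx ib x) /\ resM ib (emb ib E v).
  by split=> // p r; rewrite mxE; exact: in_res_reg.
by have /fmorph_inj -> := h Pb1 Xv; rewrite absvM b1 mul1r.
Qed.

(** An integral matrix with integral inverse carries balls to balls of the same radius, these have
    the same Haar measure by translation, and balls determine the measure. *)
Lemma mul_mx_preserves (nu : {measure set (borel V) -> \bar R}) (A A' : 'M[k']_2) :
  haar_V nu -> A' *m A = 1%:M -> A *m A' = 1%:M ->
  (forall i j, absv (A i j) <= 1) -> (forall i j, absv (A' i j) <= 1) ->
  forall Y : set (borel V), measurable Y ->
    nu ((fun v : V => A *m v) @^-1` Y) = nu Y.
Proof.
move=> nu_haar A'A AA' hA hA'; apply: preserves_balls.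
- by move=> v; exact: mulmx_cvg.
- move=> w e; have -> : (fun v : V => A *m v) @^-1` ball w e = ball (A' *m w) e.
    apply/seteqP; split=> v [e0 h]; split=> // i j.
      rewrite lf_ballE; have -> : (A' *m w) i j - v i j = (A' *m (w - A *m v)) i j.
        by rewrite mulmxBr mulmxA A'A mul1mx !mxE.
      by apply: absv_mulmx_lt => // a b; have := h a b; rewrite lf_ballE !mxE.
    rewrite lf_ballE; have -> : w i j - (A *m v) i j = (A *m (A' *m w - v)) i j.
      by rewrite mulmxBr mulmxA AA' mul1mx !mxE.
    by apply: absv_mulmx_lt => // a b; have := h a b; rewrite lf_ballE !mxE.
  have [_ /(_ (A' *m w - w) (ball w e)) <-] := nu_haar; last first.
    by apply: open_borel; exact: mx_ball_open.
  congr (nu _); apply/seteqP; split=> [v|_ [u [e0 h] <-]].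
    move=> [e0 h]; exists (v - (A' *m w - w)); last by rewrite addrC subrK.
    split=> // i j; have := h i j; rewrite !lf_ballE !mxE.
    by congr (absv _ < _); ring.
  split=> // i j; have := h i j; rewrite !lf_ballE !mxE.
  by congr (absv _ < _); ring.
- by move=> w e; have [[_ h _] _] := nu_haar; apply: h => //; exact: mx_ball_compact.
Qed.

(* Near 1, rho acts through GL_2 of the integers, congruent to 1 modulo a high
   power of the prime, hence fixes [phi]. *)
Lemma near1_invariance (phi : V -> C) : schwartz setT phi ->
  exists2 e : R, 0 < e & forall b, kpts ib B b ->
    ball (1%:M : 'M[k]_N) e b -> ball (1%:M : 'M[k]_N) e (invmx b) ->
    exists A A' : 'M[k']_2,
    [/\ A' *m A = 1%:M, A *m A' = 1%:M, (forall i j, absv (A i j) <= 1),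
        (forall i j, absv (A' i j) <= 1) &
      (forall v, phi (A *m v) = phi v) /\
      forall j s x y v, Xk ib X x -> map_mx ib y = act (map_mx ib b) (map_mx ib x) ->
        tf_pow ib act P rho Xu tf j s (y, A *m v) =
        tf_pow ib act P rho Xu tf j s (x, v)].
Proof.
move=> sphi; have [c c0 cP] := schwartz_bounded sphi.
have [r r0 rP] := schwartz_uniform sphi.
have [PU P1 PM PV] := P_group; have [[BU B1 BM BV] _] := B_kgroup.
have [_ _ _ [_ act1 actM _]] := X_homogeneous.
have [A [AE Acvg]] := rho_rational P_group rho_regular rhoM rho_P.
(* Distance below 1 from the identity makes [A b] integral; below [r / c] it moves vectors of the
   ball of radius [c] by less than [r], where [phi] does not change. *)
pose z := Num.min 1 (r / c).
have z0 : 0 < z by rewrite lt_min ltr01 divr_gt0.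
have /cvg_ballP/(_ z z0) near_A := Acvg.
have FF : Filter (nbhs (1%:M : 'M[k]_N)) by exact: nbhs_filter.
have /nbhs_ballP[e e0 eP] :=
  @filterI _ (nbhs (1%:M : 'M[k]_N)) FF _ _ near_A tpsi_near1.
exists e => // b Bb b1 b2.
have [hA hpsi] := eP _ b1; have [hA' _] := eP _ b2.
have Pb : kpts ib P b by exact: BP.
have ub : b \in unitmx by have := PU _ Pb; rewrite /= map_unitmx.
have Pb' : kpts ib P (invmx b) by rewrite /kpts /mkset map_invmx; exact: PV.
have AM p p' : kpts ib P p -> kpts ib P p' -> A (p *m p') = A p *m A p'.
  move=> Pp Pp'; apply: (@emb_inj _ _ _ E _ ib).
  rewrite -AE; last by rewrite /kpts /mkset map_mxM; exact: PM.
  by rewrite map_mxM rhoM// !AE// emb_mulmx.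
have A1 : A 1%:M = 1%:M.
  apply: (@emb_inj _ _ _ E _ ib); rewrite -AE ?map_mx1; last first.
    by rewrite /kpts /mkset map_mx1.
  exact: rho1 P_group rhoM rho_P.
have int b' : ball (1%:M : 'M[k']_2) z (A b') -> forall i j, absv (A b' i j) <= 1.
  move=> [_ h] i j; rewrite -[A b' i j](subKr ((1%:M : 'M[k']_2) i j)).
  apply: absvB_le; first by rewrite mxE; case: eqP => _; rewrite ?absv1// absv0.
  by apply: le_trans (ltW (h i j)) _; rewrite ge_min lexx.
have A'A : A (invmx b) *m A b = 1%:M by rewrite -AM// mulVmx.
have AA' : A b *m A (invmx b) = 1%:M by rewrite -AM// mulmxV.
exists (A b), (A (invmx b)); split; [exact: A'A|exact: AA'|exact: int|exact: int|].
split=> [v|j s x y v Xx yE].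
  have stable b' u : ball (1%:M : 'M[k']_2) z (A b') -> ball (0 : V) c u ->
      ball (0 : V) c (A b' *m u).
    move=> hb [_ hu]; apply/mx_ballP => // i j; rewrite mxE sub0r absvN.
    apply: absv_mulmx_lt => // [|a a']; first exact: int.
    by have := hu a a'; rewrite lf_ballE mxE sub0r absvN.
  (* [A b] and its inverse preserve the ball of radius [c], so off that ball [phi] vanishes at both
     points. *)
  have [hv|nv] := EM (ball (0 : V) c v); last first.
    rewrite (cP v nv) cP// => hAv; apply: nv.
    by rewrite -[v]mul1mx -A'A -mulmxA; exact: stable.
  apply: rP; apply/mx_ballP => // i j.
  have -> : v i j - (A b *m v) i j = ((1%:M - A b) *m v) i j.
    by rewrite mulmxBl mul1mx !mxE.
  rewrite mxE; apply: absv_sum_lt => // l _; rewrite absvM.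
  have h1 : absv ((1%:M - A b) i l) < r / c.
    case: hA => _ /(_ i l) h; rewrite !mxE in h *.
    by apply: lt_le_trans h _; rewrite ge_min lexx orbT.
  have h2 : absv (v l j) < c.
    by case: hv => _ /(_ l j); rewrite lf_ballE mxE sub0r absvN.
  by rewrite -[r](mulfVK (lt0r_neq0 c0)) ltr_pM// absv_ge0.
have xE : map_mx ib x = act (map_mx ib (invmx b)) (map_mx ib y).
  rewrite yE -actM; try exact: PG; last exact: Xx.
  by rewrite -map_mxM mulVmx// map_mx1 act1.
apply: (tf_pow_translate s Pb (AE _ Pb) Xx yE hpsi).
move=> /(XVu_translate Pb' (AE _ Pb') xE).
by rewrite mulmxA A'A mul1mx.
Qed.

Context (dx : {sigma_finite_measure set (borel 'rV[k]_m) -> \bar R}).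
Context (dv : {sigma_finite_measure set (borel 'cV[k']_2) -> \bar R}).
Hypothesis dx_radon : radon_on (Xk ib X) dx.
Hypothesis dv_haar : haar_V dv.
Hypothesis Omega_integrable : forall u (phi : 'rV[k]_m * V -> C),
  schwartz (XVk ib X k') phi -> forall s, Re_nonneg s ->
  cintegrable (Omega_measure dx dv) (XVk ib X k')
    (Omega_integrand ib act P rho Xu tf phi u s).

Definition tensor_ball (x : 'rV[k]_m) (r : R) (phi : V -> C)
    (xv : 'rV[k]_m * V) : C := if `[< ball x r xv.1 >] then phi xv.2 else 0.

Lemma tensor_ball_schwartz x r phi : 0 < r -> schwartz setT phi ->
  schwartz (XVk ib X k') (tensor_ball x r phi).
Proof.
move=> r0 [lc [Q [cQ _] Q0]]; split=> [[y v] _|].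
  exists (ball y r, [set v' | phi v' = phi v]) => /=.
    split; first exact: nbhsx_ballx.
    by apply: filterS (lc v I) => w; exact.
  move=> [y' v'] [/= yy' vv'] _; rewrite /tensor_ball /= vv'.
  suff -> : `[< ball x r y' >] = `[< ball x r y >] by [].
  apply: asbool_equiv_eq; split=> h; apply: mx_ball_ultra h _ => //.
  exact: ball_sym.
exists ((Xk ib X `&` ball x r) `*` Q).
  split; last by move=> [y v] [[Xy _] _].
  apply: compact_setX => //; rewrite setIC.
  apply: compact_closedI; first exact: mx_ball_compact.
  by have [Xcl _ _ _] := X_homogeneous; exact: Xk_closed Xcl.
move=> [y v] [Xy _] nQ; rewrite /tensor_ball /=.
by case: asboolP => // xy; apply: Q0 => // Qv; exact: nQ.
Qed.

Lemma fourierXV_tensor (eta : k' -> C) x r phi :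
  fourierXV eta dv (tensor_ball x r phi) = tensor_ball x r (fourierV eta dv phi).
Proof.
apply/funext => xv; rewrite /fourierXV /fourierV /tensor_ball.
case: asboolP => [_|_ /=]; first exact: eq_cintegral.
rewrite /cintegral /Rintegral; apply: complexP => /=; rewrite integral0_eq// => w _;
  by rewrite mulr0.
Qed.

Lemma XVk_measurable :
  measurable (XVk ib X k' : set (borel 'rV[k]_m * borel V)).
Proof.
apply: measurableX => //; rewrite -[Xk ib X]setCK; apply: measurableC.
apply: open_borel; apply: closed_openC.
by have [Xcl _ _ _] := X_homogeneous; exact: Xk_closed Xcl.
Qed.

(** All small radii are covered because the result is used for [phi] and for its Fourier transform
    with one common ball. The radius bound does not depend on [j] or [s]. *)
Lemma Omega_tensor_ball u x phi : Xu u x -> schwartz setT phi ->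
  exists2 r0 : R, 0 < r0 & forall r, 0 < r <= r0 ->
    0 < fine (dx (Xk ib X `&` ball x r)) /\ forall j s, Re_nonneg s ->
      cintegrable dv setT (fiber_integrand ib act P rho Xu tf x phi j s) /\
      Omega ib X act P rho Xu tf dx dv (tensor_ball x r phi) j s =
      complex.Complex (fine (dx (Xk ib X `&` ball x r))) 0 *
      fiber_zeta ib act P rho Xu tf dv x phi j s.
Proof.
move=> Xux sphi; have [e e0 eP] := near1_invariance sphi.
have BG : B `<=` G by move=> b Bb; exact/PG/BP.
have [r0 r00 r0P] := orbit_neighborhood X_homogeneous BG B_kgroup Xu_orbits Xux e0.
exists r0 => // r /andP[rp rr0].
have Xx : Xk ib X x.
  have [_ op _] := Xu_orbits; have [W _ XuE] := op u.
  by move: Xux; rewrite XuE => -[].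
have Xcl : closed (Xk ib X) by have [Xcl _ _ _] := X_homogeneous; exact: Xk_closed Xcl.
pose U := Xk ib X `&` ball x r.
have [_ dx_fin dx_pos] := dx_radon.
have mU : measurable (U : set (borel 'rV[k]_m)).
  apply: measurableI.
    rewrite -[Xk ib X]setCK; apply: measurableC.
    by apply: open_borel; exact: closed_openC.
  by apply: open_borel; exact: mx_ball_open.
have U0 : (0 < dx U)%E.
  by apply: dx_pos; [exact: mx_ball_open|exists x; split=> //; exact: ballxx].
have Uoo : (dx U < +oo)%E.
  apply: dx_fin; last by move=> y [].
  by rewrite /U setIC; apply: compact_closedI => //; exact: mx_ball_compact.
have UE : dx U = (fine (dx U))%:E by rewrite fineK// ge0_fin_numE.
have vol0 : 0 < fine (dx U) by rewrite -lte_fin -UE.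
split=> // j s s0.
have [iRe iIm] := Omega_integrable j (tensor_ball_schwartz x rp sphi) s0.
pose F := Omega_integrand ib act P rho Xu tf (tensor_ball x r phi) j s.
pose g := fiber_integrand ib act P rho Xu tf x phi j s.
(* [h] will be the real or the imaginary part; [h 0 = 0] keeps the integrand zero off the ball. *)
have part (h : C -> R) : h 0 = 0 ->
    (Omega_measure dx dv).-integrable (XVk ib X k') (fun z => (h (F z))%:E) ->
    dv.-integrable setT (fun v => (h (g v))%:E) /\
    Rintegral (Omega_measure dx dv) (XVk ib X k') (fun z => h (F z)) =
    fine (dx U) * Rintegral dv setT (fun v => h (g v)).
  move=> h0 iF.
  pose f := (fun z : borel 'rV[k]_m * borel V => (h (F z))%:E) \_ (XVk ib X k').
  have fi : (dx \x dv)%E.-integrable setT f.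
    by apply/(integrable_mkcond _ XVk_measurable).
  have fU y v : U y -> f (y, v) = (h (phi v * tf_pow ib act P rho Xu tf j s (y, v)))%:E.
    move=> [Xy xy]; rewrite /f patchE mem_set; last by split.
    rewrite /F /Omega_integrand /tensor_ball /=.
    by case: asboolP.
  have f0 y v : ~ U y -> f (y, v) = 0%E.
    move=> nU; rewrite /f patchE; case: ifP => // /set_mem[Xy _].
    rewrite /F /Omega_integrand /tensor_ball /=.
    case: asboolP => [xy|_]; first by exfalso; apply: nU.
    by rewrite mul0r h0.
  (* The slice over [y], composed with [A], is the slice over [x]. Invariance under [A] transfers
     integrability from [y] to [x], invariance under [A'] compares the integrals. *)
  have tr y : U y -> exists A A' : 'M[k']_2,
      [/\ A *m A' = 1%:M,
          (forall Y : set (borel V), measurable Y ->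
             dv ((fun v : V => A *m v) @^-1` Y) = dv Y),
          (forall Y : set (borel V), measurable Y ->
             dv ((fun v : V => A' *m v) @^-1` Y) = dv Y) &
          forall v, f (y, A *m v) = (h (g v))%:E].
    move=> Uy; have [Xy xy] := Uy.
    have [b [Bb b1 b2 yE]] := r0P y Xy (le_ball rr0 xy).
    have [A [A' [A'A AA' hA hA' [phiA tfA]]]] := eP b Bb b1 b2.
    exists A, A'; split=> //.
    - by move=> Y; exact: (mul_mx_preserves dv_haar A'A AA' hA hA').
    - by move=> Y; exact: (mul_mx_preserves dv_haar AA' A'A hA' hA).
    - by move=> v; apply: etrans (fU y (A *m v) Uy) _; rewrite phiA (tfA j s x y v Xx yE).
  have mA (A : 'M[k']_2) : measurable_fun setT ((fun v => A *m v) : borel V -> borel V).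
    by apply: measurable_mx_cvg => v; exact: mulmx_cvg.
  have [gi gE] : dv.-integrable setT (fun v => (h (g v))%:E) /\
      (\int[dx \x dv]_z f z = dx U * \int[dv]_v (h (g v))%:E)%E.
    apply: (integral_product_cst mU U0 Uoo fi f0) => y Uy iy.
      have [A [A' [_ pA _ fA]]] := tr y Uy.
      have := integrable_invariant (mA A) pA iy.
      by apply: eq_integrable => // v _; exact: fA.
    have [A [A' [AA' _ pA' fA]]] := tr y Uy.
    rewrite -(integral_invariant (mA A') pA' (measurable_int _ iy)).
    apply: eq_integral => v _; rewrite -fA; congr (f (y, _)).
    by rewrite mulmxA AA' mul1mx.
  have FE : (integral (Omega_measure dx dv) (XVk ib X k') (fun z => (h (F z))%:E) =
      dx U * \int[dv]_v (h (g v))%:E)%E by rewrite integral_mkcond; exact: gE.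
  split; first exact: gi.
  have gfin := integrable_fin_num measurableT gi.
  by rewrite /Rintegral FE UE fineM.
have [gRe FRe] := part (@complex.Re R) erefl iRe.
have [gIm FIm] := part (@complex.Im R) erefl iIm.
split; first by split.
by apply: complexP; rewrite ?complex_ReM ?complex_ImM /= ?FRe ?FIm !mul0r ?subr0 ?addr0.
Qed.
End FiberReduction.

Theorem theorem3p10
  (R : realType) (k : localField R)
  (kb : closedFieldType) (ib : {rmorphism k -> kb})
  (kb_algebraic : forall z : kb, algebraicOver ib z)
  (N m : nat) (G B T : set 'M[kb]_N) (X : set 'rV[kb]_m)
  (act : 'M[kb]_N -> 'rV[kb]_m -> 'rV[kb]_m) (K : set 'M[k]_N)
  (setting : basic_setting ib G B T X act K)
  (A1 : condA1 (BX B X act))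
  (A2 : condA2 ib (BX B X act))
  (A3 : condA3 ib (BX B X act) 1%:M)
  (muB : {measure set (borel 'M[k]_N) -> \bar R}) (delta : 'M[k]_N -> R)
  (muB_haar : left_haar ib B muB) (delta_modulus : modulus ib B muB delta)
  (dx : {sigma_finite_measure set (borel 'rV[k]_m) -> \bar R})
  (dx_invariant : G_invariant ib G X act dx)
  (n : nat) (f : 'I_n -> mpoly m k) (psi : 'I_n -> mpoly (N * N + 1) k)
  (f_basic : basic_regular ib (BX B X act) f psi)
  (e : nat) (e_index : X0_index ib (BX B X act) e)
  (J : finType) (Xu : J -> set 'rV[k]_m)
  (Xu_orbits : orbit_decomposition ib B X act Xu)
  (x : J -> 'rV[k]_m) (x_in : forall u, Xu u (x u))
  (* the simple root alpha, its reflection sigma (represented by w) in W_0 *)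
  (alpha : 'M[kb]_N -> kb) (alpha_simple : simple_root ib T B alpha)
  (w : 'M[k]_N) (w_reflection : reflection_rep ib G T alpha w)
  (x0 : 'rV[k]_m) (x0_open : Xop ib B X act x0)
  (w_W0 : in_W0 ib G B T act psi delta w x0)
  (Sg : {linear 'rV[complex R]_n -> 'rV[complex R]_n})
  (Sg_sigma : is_sigma ib G B T psi w Sg)
  (eps : 'rV[rat]_n) (eps_epsilon : is_epsilon ib G B T psi delta w eps)
  (* condition (A5) *)
  (P : set 'M[kb]_N) (P_parabolic : standard_parabolic ib G B T alpha P)
  (k' : localField R) (E : unramifiedExt k k')
  (rho : 'M[kb]_N -> 'M['M[kb]_(ue_deg E)]_2)
  (A5 : condA5 ib B K P rho w)
  (* known facts on the space X~ *)
  (B_stabilizer : B_is_stabilizer ib B P rho)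
  (Xu_bijection : orbit_bijection ib X act P rho Xu)
  (tf : 'I_n -> mpoly (m + (ue_deg E * ue_deg E + ue_deg E * ue_deg E)) k)
  (tpsi : 'I_n -> mpoly
     ((N * N + 1) + (ue_deg E * ue_deg E + 1)) k)
  (tf_basic : basic_regular ib (PXV ib X act P rho) tf tpsi)
  (tf_f : tf_extends ib X tf f)
  (dv : {sigma_finite_measure set (borel 'cV[k']_2) -> \bar R})
  (dv_haar : haar_V dv)
  (eta : k' -> complex R) (eta_char : additive_character eta)
  (Omega_continuation :
     forall u (phi : 'rV[k]_m * 'cV[k']_2 -> complex R),
     schwartz (XVk ib X k') phi ->
     zeta_integral (lf_card k) (Omega_measure dx dv) (XVk ib X k')
       (Omega_integrand ib act P rho Xu tf phi u))
  (gamma : J -> J -> ratfun R n)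
  (gammaP :
     forall u (phi : 'rV[k]_m * 'cV[k']_2 -> complex R),
     schwartz (XVk ib X k') phi ->
     functional_equation (lf_card k) e (Ju ib act P Xu u) (gamma u)
       Sg (map_mx ratr eps)
       (Omega ib X act P rho Xu tf dx dv (fourierXV eta dv phi) u)
       (Omega ib X act P rho Xu tf dx dv phi)) :
  forall u,
    prehomogeneous (PuV ib act P rho (x u)) /\
    forall phi : 'cV[k']_2 -> complex R,
    schwartz setT phi ->
    [/\ zeta_integral (lf_card k) dv setT
          (fiber_integrand ib act P rho Xu tf (x u) (fourierV eta dv phi) u),
        (forall j, Ju ib act P Xu u j ->
          zeta_integral (lf_card k) dv setT
            (fiber_integrand ib act P rho Xu tf (x u) phi j)) &
        functional_equation (lf_card k) e (Ju ib act P Xu u) (gamma u)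
          Sg (map_mx ratr eps)
          (fiber_zeta ib act P rho Xu tf dv (x u) (fourierV eta dv phi) u)
          (fiber_zeta ib act P rho Xu tf dv (x u) phi)].
Proof.
have [_ X_hom [B_kgroup _ _] _ _] := setting.
have [[P_group _] [_ PG _] BP _] := P_parabolic.
have [rho_regular rhoM rho_P _ _] := A5.
have [dx_radon _] := dx_invariant.
have BG : B `<=` G by move=> b Bb; exact/PG/BP.
have [_ B1 _ _] := B_kgroup.1.
have Omega_integrable j phi (sphi : schwartz (XVk ib X k') phi) :=
  (Omega_continuation j phi sphi).1.
move=> u; split.
  apply: (prehomogeneous_PuV X_hom P_group PG B1 BP rhoM rho_P B_stabilizer).
  exact: (Xu_in_open_orbit X_hom BG B_kgroup Xu_orbits (x_in u)).
move=> phi sphi; have sFphi := fourierV_schwartz eta_char dv_haar sphi.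
have red := Omega_tensor_ball X_hom PG BP B_kgroup P_group rho_regular rhoM rho_P
  Xu_orbits tf_basic dx_radon dv_haar Omega_integrable (x_in u).
have [r1 r10 red1] := red _ sphi; have [r2 r20 red2] := red _ sFphi.
(* A common radius gives the same volume factor on both sides of the functional equation. *)
pose r := Num.min r1 r2.
have r0 : 0 < r by rewrite lt_min r10.
have [|vol0 fib] := red1 r; first by rewrite r0 ge_min lexx.
have [|_ fibF] := red2 r; first by rewrite r0 ge_min lexx orbT.
set vol := fine _ in vol0 fib fibF.
pose c : complex R := complex.Complex vol 0.
have c0 : c != 0 by rewrite complex.eq_complex /= negb_and gt_eqF.
have st := tensor_ball_schwartz X_hom (x u) r0 sphi.
have stF := tensor_ball_schwartz X_hom (x u) r0 sFphi.
split.
- split=> [s s0|]; first by have [] := fibF u s s0.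
  apply: (continued_by_scale c0 _ (Omega_continuation u _ stF).2) => s s0.
  by have [_] := fibF u s s0.
- move=> j _; split=> [s s0|]; first by have [] := fib j s s0.
  apply: (continued_by_scale c0 _ (Omega_continuation j _ st).2) => s s0.
  by have [_] := fib j s s0.
(* Multiplied by the volume [c], values of the continued fiber integrals are values of the continued
   integrals over X~; the known equation applies to them and [c] is cancelled. *)
move=> s z z' hz hz'.
have := gammaP u _ st; rewrite fourierXV_tensor => /(_ s (c * z) (fun j => c * z' j)).
have h1 : continuation_value (lf_card k)
    (Omega ib X act P rho Xu tf dx dv (tensor_ball (x u) r (fourierV eta dv phi)) u)
    s (c * z).
  by apply: continuation_value_scale hz => t t0; have [_] := fibF u t t0.
have h2 j : Ju ib act P Xu u j -> rf_defined (lf_card k) e (gamma u j) s /\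
    continuation_value (lf_card k)
      (Omega ib X act P rho Xu tf dx dv (tensor_ball (x u) r phi) j)
      (Sg s + map_mx ratr eps) (c * z' j).
  move=> Jj; have [hd hv] := hz' j Jj; split=> //.
  by apply: continuation_value_scale hv => t t0; have [_] := fib j t t0.
move=> /(_ h1 h2) hcz; apply: (mulfI c0); rewrite hcz mulr_sumr.
by apply: eq_bigr => j _; rewrite mulrCA.
Qed.
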